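(* Let ND be a class of network design problems in the sense described in the context. If there exists a deterministic (respectively randomized) $\gamma$-approximation algorithm for the prize-collecting problem PCND which runs in polynomial time, then there exists an $O(\gamma\log|\mathcal{E}|)$-competitive deterministic (respectively randomized) online algorithm for ND with delay, which runs in polynomial time.
   Context: An instance of an (abstract) network design problem consists of a finite set $\mathcal{E}$ of elements with costs $c:\mathcal{E}\to\mathbb{R}^+$; each request $q$ is associated with an upward-closed family $X_q\subseteq 2^{\mathcal{E}}$ (if $E_1\subseteq E_2$ and $E_1\in X_q$ then $E_2\in X_q$); a set $E\subseteq\mathcal{E}$ satisfies $q$ if $E\in X_q$. ND denotes a class of such problems. The prize-collecting problem PCND: given a finite set $Q$ of requests and penalties $\pi:Q\to\mathbb{R}^+$, choose $E\subseteq\mathcal{E}$ minimizing $\sum_{e\in E}c(e)+\sum_{q\in Q:\,E\notin X_q}\pi(q)$. A $\gamma$-approximation algorithm returns a solution of cost at most $\gamma$ times optimal; for randomized algorithms the approximation guarantee is deterministic and the running-time bound holds in expectation. ND with delay (online): elements and costs known in advance; requests arrive over time, request $q$ released at time $r_q$ with a continuous, monotone non-decreasing delay function $d_q(t)$ tending to infinity as $t\to\infty$, revealed at release. At any time the algorithm may transmit $E\subseteq\mathcal{E}$ at cost $\sum_{e\in E}c(e)$, serving every pending request $q$ with $E\in X_q$. The cost of the algorithm is the total transmission cost plus, for each request $q$, the delay $d_q(t_q)$ accumulated until the time $t_q$ it is served. An online algorithm is $\alpha$-competitive if on every input its (expected) cost is at most $\alpha$ times the optimal offline cost. *)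

(* Defs.v *)
From mathcomp Require Import all_boot all_order all_algebra.
From mathcomp Require Import all_classical all_reals all_analysis.
Import Order.TTheory GRing.Theory Num.Theory.
Import numFieldNormedType.Exports.

Set Implicit Arguments.
Unset Strict Implicit.
Unset Printing Implicit Defensive.

Local Open Scope ring_scope.

(** * Machine model

    A real RAM with pointers, presented as a small-step machine for a finite,
    uniform program.  A value is a tree whose leaves are units, real numbers
    and two kinds of opaque tokens: a request of the network design problem
    (which gives oracle access to its family of satisfying sets), and a
    reference to a released online request (which gives oracle access to its
    delay function).  Programs contain no real constant besides 1, so no advice
    can be hidden in them.  Every machine step has unit cost; sharing makes
    [Fork] a constant-time operation. *)

Inductive val (R T : Type) : Type :=
| VUnit
| VNum of R
| VTok of T
| VRef of nat
| VPair of val R T & val R T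
| VInl of val R T
| VInr of val R T.

Arguments VUnit {R T}.
Arguments VNum {R T}.
Arguments VTok {R T}.
Arguments VRef {R T}.
Arguments VPair {R T}.
Arguments VInl {R T}.
Arguments VInr {R T}.

Inductive query := Wait | Send | Delay | Reach.

Inductive prim :=
| Id | MkUnit | Fst | Snd | MkInl | MkInr
| Dist                      (* (c, inl a) |-> inl (c, a), same for inr *)
| One | Add | Sub | Mul | Div | Leq
| Sat                       (* (request q, set E) |-> is E in X_q ? *)
| Coin
| Query of query.

Inductive prog :=
| Prim of prim
| Seq of prog & prog
| Fork of prog & prog       (* v |-> (p1 v, p2 v) *)
| Case of prog & prog       (* inl a |-> p1 a,  inr b |-> p2 b *)
| Loop of prog.             (* iterate while the result is inl a; inr b exits *)

Fixpoint uses_only (P : pred prim) (p : prog) : bool :=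
  match p with
  | Prim o => P o
  | Seq p1 p2 | Fork p1 p2 | Case p1 p2 => uses_only P p1 && uses_only P p2
  | Loop p1 => uses_only P p1
  end.

Definition offline : prog -> bool :=
  uses_only (fun o => if o is Query _ then false else true).

Definition deterministic : prog -> bool :=
  uses_only (fun o => if o is Coin then false else true).

Section Encoding.
Variables R T : Type.
Implicit Types (v : val R T).

Fixpoint vsize v : nat :=
  match v with
  | VPair a b => (vsize a + vsize b).+1
  | VInl a | VInr a => (vsize a).+1
  | _ => 1%N
  end.

Definition vbool (b : bool) : val R T := if b then VInl VUnit else VInr VUnit.

Definition vtrue v : bool := if v is VInl _ then true else false.

Fixpoint vlist (s : seq (val R T)) : val R T :=
  if s is v :: s' then VInr (VPair v (vlist s')) else VInl VUnit.

Fixpoint vseq v : seq (val R T) :=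
  if v is VInr (VPair h t) then h :: vseq t else [::].

(* A set of elements is a list of booleans, its characteristic vector. *)
Definition vset n v : {set 'I_n} := [set i : 'I_n | vtrue (nth VUnit (vseq v) i)].

End Encoding.

Section Machine.
Variables (R : realType) (T : Type) (n : nat) (X : T -> {set {set 'I_n}}).
Local Notation val := (val R T).

(* [S] is the state of the environment; [ext] answers the online queries, [None]
   meaning that the interaction is over. *)
Variables (S : Type) (ext : query -> val -> S -> option (val * S)).

Definition arith (f : R -> R -> val) (v : val) : val :=
  if v is VPair (VNum x) (VNum y) then f x y else VUnit.

(* Primitives applied to arguments of the wrong shape return [VUnit]. *)
Definition exec (coin : bool) (o : prim) (v : val) (s : S) : option (val * S) :=
  match o with
  | Id => Some (v, s)
  | MkUnit => Some (VUnit, s)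
  | Fst => Some (if v is VPair a _ then a else VUnit, s)
  | Snd => Some (if v is VPair _ b then b else VUnit, s)
  | MkInl => Some (VInl v, s)
  | MkInr => Some (VInr v, s)
  | Dist => Some (match v with
                  | VPair c (VInl a) => VInl (VPair c a)
                  | VPair c (VInr b) => VInr (VPair c b)
                  | _ => VUnit
                  end, s)
  | One => Some (VNum 1, s)
  | Add => Some (arith (fun x y => VNum (x + y)) v, s)
  | Sub => Some (arith (fun x y => VNum (x - y)) v, s)
  | Mul => Some (arith (fun x y => VNum (x * y)) v, s)
  | Div => Some (arith (fun x y => VNum (x / y)) v, s)
  | Leq => Some (arith (fun x y => vbool R T (x <= y)) v, s)
  | Sat => Some (if v is VPair (VTok q) e then vbool R T (vset n e \in X q)
                 else VUnit, s)
  | Coin => Some (vbool R T coin, s)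
  | Query q => ext q v s
  end.

Inductive control := Run of prog & val | Ret of val.

Inductive frame :=
| KSeq of prog
| KForkL of prog & val
| KForkR of val
| KLoop of prog.

Record config := Config { ctrl : control; stack : seq frame; env : S }.

Definition init (p : prog) (v : val) (s : S) := Config (Run p v) [::] s.

Definition halted (c : config) : bool :=
  match ctrl c, stack c with Ret _, [::] => true | _, _ => false end.

Definition output (c : config) : val := if ctrl c is Ret v then v else VUnit.

Definition step (coin : bool) (c : config) : config :=
  let: Config ct k s := c in
  match ct with
  | Run (Prim o) v =>
      if exec coin o v s is Some (v', s') then Config (Ret v') k s'
      else Config (Ret VUnit) [::] s
  | Run (Seq p1 p2) v => Config (Run p1 v) (KSeq p2 :: k) s
  | Run (Fork p1 p2) v => Config (Run p1 v) (KForkL p2 v :: k) s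
  | Run (Case p1 p2) (VInl a) => Config (Run p1 a) k s
  | Run (Case p1 p2) (VInr b) => Config (Run p2 b) k s
  | Run (Case p1 p2) _ => Config (Ret VUnit) k s
  | Run (Loop p) v => Config (Run p v) (KLoop p :: k) s
  | Ret v =>
      match k, v with
      | [::], _ => c
      | KSeq p :: k', _ => Config (Run p v) k' s
      | KForkL p u :: k', _ => Config (Run p u) (KForkR v :: k') s
      | KForkR u :: k', _ => Config (Ret (VPair u v)) k' s
      | KLoop p :: k', VInl a => Config (Run p a) k s
      | KLoop p :: k', VInr b => Config (Ret b) k' s
      | KLoop p :: k', _ => Config (Ret v) k' s
      end
  end.

(* The [i]-th step has the [i]-th coin at its disposal, used or not: reading
   fresh coins only, the machine cannot tell this from coins drawn on demand. *)
Fixpoint run (coins : nat -> bool) (m : nat) (c : config) : config :=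
  if m is m'.+1 then step (coins m') (run coins m' c) else c.

Definition no_coins : nat -> bool := fun=> false.

(* The first [m] steps depend on the first [m] coins only, so that
   probabilities are computed in the uniform space [m.-tuple bool]. *)
Definition run_tuple (m : nat) (b : m.-tuple bool) (c : config) : config :=
  run (nth false b) m c.

(* Probability that the running time exceeds [m]. *)
Definition prob_running (c : config) (m : nat) : R :=
  #|[set b : m.-tuple bool | ~~ halted (run_tuple b c)]|%:R / 2 ^+ m.

(* E[T] is the sum over m of Pr[T > m]. *)
Definition expected_time (c : config) : \bar R :=
  (\sum_(0 <= m <oo) (prob_running c m)%:E)%E.

(* Expectation of [f] at the halting configuration, for nonnegative [f]: the
   supremum of the contributions of the runs that halt within [m] steps. *)
Definition expected_value (f : config -> \bar R) (c : config) : \bar R :=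
  ereal_sup (range (fun m : nat =>
    (\sum_(b : m.-tuple bool | halted (run_tuple b c))
       f (run_tuple b c) * ((2 ^+ m)^-1)%:E)%E))%classic.

End Machine.

(** * Network design *)

(* A class of problems: an instance [I] has elements [0, ..., nelt I - 1], and
   [family q] is the family X_q of the sets satisfying [q].  [enc] and [enc_req]
   are arbitrary descriptions of the structure of an instance and of a request,
   available to the algorithms besides the costs and the membership oracle. *)
Record nd_class (R : realType) := NDClass {
  inst : Type;
  nelt : inst -> nat;
  cost : forall I : inst, 'I_(nelt I) -> R;
  request : inst -> Type;
  family : forall I : inst, request I -> {set {set 'I_(nelt I)}};
  enc : forall I : inst, val R (request I);
  enc_req : forall I : inst, request I -> val R (request I);
  cost_ge0 : forall (I : inst) (e : 'I_(nelt I)), 0 <= cost e;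
  family_up : forall (I : inst) (q : request I) (E1 E2 : {set 'I_(nelt I)}),
    E1 \subset E2 -> E1 \in family q -> E2 \in family q
}.

Section NetworkDesign.
Variables (R : realType) (ND : nd_class R).

Section Instance.
Variable I : inst ND.
Local Notation elt := 'I_(nelt I).
Local Notation val := (val R (request I)).

Definition set_cost (E : {set elt}) : R := \sum_(e in E) cost e.

Definition vinst : val :=
  VPair (vlist [seq VNum (cost e) | e <- enum elt]) (enc I).

Definition vreq (q : request I) : val := VPair (VTok q) (enc_req q).

(** ** Prize-collecting problem: finitely many requests with penalties *)

Definition pc_input := seq (request I * R).

Definition pc_valid (Q : pc_input) : Prop :=
  forall i : 'I_(size Q), 0 <= (tnth (in_tuple Q) i).2.

Definition pc_cost (Q : pc_input) (E : {set elt}) : R :=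
  set_cost E + \sum_(qp <- Q | E \notin family qp.1) qp.2.

Definition pc_opt (Q : pc_input) : R :=
  \big[Order.min/pc_cost Q finset.set0]_(E : {set elt}) pc_cost Q E.

Definition pc_encode (Q : pc_input) : val :=
  VPair vinst (vlist [seq VPair (vreq qp.1) (VNum qp.2) | qp <- Q]).

Definition pc_ext (_ : query) (_ : val) (s : unit) : option (val * unit) :=
  Some (VUnit, s).

Definition pc_init (p : prog) (Q : pc_input) := init p (pc_encode Q) tt.

Definition pc_run (coins : nat -> bool) (m : nat) (p : prog) (Q : pc_input) :=
  run (@family R ND I) pc_ext coins m (pc_init p Q).

Definition pc_output (c : config R (request I) unit) : {set elt} :=
  vset (nelt I) (output c).

(** ** Online problem with delay *)

Record online_request := OnlineRequest {
  req : request I;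
  release : R;
  delay : R -> R    (* relevant from the release time on only *)
}.

Definition valid_request (q : online_request) : Prop :=
  [/\ 0 <= release q,
      0 <= delay q (release q),
      {in `[release q, +oo[ &, {homo delay q : s t / s <= t}},
      ({within `[release q, +oo[, continuous (delay q)})%classic &
      (delay q t @[t --> +oo] --> +oo)%classic].

(* Requests are listed in order of arrival. *)
Definition online_input := seq online_request.

Definition valid_input (sigma : online_input) : Prop :=
  sorted <=%R (map release sigma) /\
  forall i : 'I_(size sigma), valid_request (tnth (in_tuple sigma) i).

(* The transmissions with their times. *)
Definition schedule := seq (R * {set elt}).

Definition service_time (S : schedule) (q : online_request) : \bar R :=
  \big[Order.min/+oo%E]_(s <- S | (release q <= s.1) && (s.2 \in family (req q)))
    (s.1)%:E.

(* A request that is never served has infinite delay. *)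
Definition delay_cost (q : online_request) (t : \bar R) : \bar R :=
  if t is r%:E%E then (delay q r)%:E%E else +oo%E.

Definition schedule_cost (sigma : online_input) (S : schedule) : \bar R :=
  ((\sum_(s <- S) set_cost s.2)%:E
   + \sum_(q <- sigma) delay_cost q (service_time S q))%E.

Definition online_opt (sigma : online_input) : \bar R :=
  ereal_inf (range (schedule_cost sigma))%classic.

(* The current time and the transmissions made so far.  The clock starts at -1,
   before any request is released. *)
Record world := World { now : R; log : schedule }.

Definition world0 := World (-1) [::].

Section Environment.
Variable sigma : online_input.

Definition nreleased (t : R) : nat := count (fun q => release q <= t) sigma.

(* The requests released in the time interval ]t, t'], as a list of triples:
   reference to the delay function, request token, description. *)
Definition arrivals (t t' : R) : val :=
  vlist [seq VPair (VRef iq.1) (vreq (req iq.2))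
        | iq <- drop (nreleased t)
                  (take (nreleased t') (zip (iota 0 (size sigma)) sigma))].

Definition wait_until (t : R) (alarm : option R) : option R :=
  match alarm, ohead (drop (nreleased t) sigma) with
  | Some a, Some q => Some (Num.max t (Num.min a (release q)))
  | Some a, None => Some (Num.max t a)
  | None, Some q => Some (release q)
  | None, None => None
  end.

Definition released (w : world) (i : nat) : option online_request :=
  onth (take (nreleased (now w)) sigma) i.

(* [Wait (inl a)] lets time pass until time [a] or the next arrival, whichever
   comes first; [Wait] on any other argument waits for the next arrival, and ends
   the interaction if there is none.  It returns the current time and the new
   requests.
   [Send E] transmits [E] at the current time.
   [Delay (i, t)] is the delay of request [i] at time [t].
   [Reach (i, x)] is the first time at which the delay of request [i] is at least
   [x]. *)
Definition online_ext (o : query) (v : val) (w : world) : option (val * world) :=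
  match o, v with
  | Wait, _ =>
      let alarm := if v is VInl (VNum a) then Some a else None in
      if wait_until (now w) alarm is Some t'
      then Some (VPair (VNum t') (arrivals (now w) t'), World t' (log w))
      else None
  | Send, _ =>
      Some (VUnit, World (now w) (rcons (log w) (now w, vset (nelt I) v)))
  | Delay, VPair (VRef i) (VNum t) =>
      Some (if released w i is Some q then VNum (delay q t) else VUnit, w)
  | Reach, VPair (VRef i) (VNum x) =>
      Some (if released w i is Some q
            then VNum (inf [set t | release q <= t /\ x <= delay q t]%classic)
            else VUnit, w)
  | _, _ => Some (VUnit, w)
  end.

Definition online_init (p : prog) := init p vinst world0.

Definition online_run (coins : nat -> bool) (m : nat) (p : prog) :=
  run (@family R ND I) online_ext coins m (online_init p).

Definition online_cost (c : config R (request I) world) : \bar R :=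
  schedule_cost sigma (log (env c)).

Definition online_size : nat :=
  vsize (VPair vinst (vlist [seq vreq (req q) | q <- sigma])).

End Environment.
End Instance.

(** ** Guarantees; running times are polynomial in the size of the input *)

Definition pc_approx_det (gamma : inst ND -> R) : Prop :=
  exists p : prog, exists P : {poly nat},
    [/\ offline p, deterministic p &
    forall (I : inst ND) (Q : pc_input I), pc_valid Q ->
      let T := P.[vsize (pc_encode Q)] in
      let c := pc_run no_coins T p Q in
      halted c /\ pc_cost Q (pc_output c) <= gamma I * pc_opt Q].

Definition pc_approx_rand (gamma : inst ND -> R) : Prop :=
  exists p : prog, exists P : {poly nat},
    offline p /\
    forall (I : inst ND) (Q : pc_input I), pc_valid Q ->
      (expected_time (@family R ND I) (@pc_ext I) (pc_init p Q)
         <= (P.[vsize (pc_encode Q)]%:R)%:E)%E /\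
      forall (coins : nat -> bool) (m : nat),
        let c := pc_run coins m p Q in
        halted c -> pc_cost Q (pc_output c) <= gamma I * pc_opt Q.

Definition competitive_det (alpha : inst ND -> R) : Prop :=
  exists p : prog, exists P : {poly nat},
    deterministic p /\
    forall (I : inst ND) (sigma : online_input I), valid_input sigma ->
      let T := P.[online_size sigma] in
      let c := online_run sigma no_coins T p in
      halted c /\
      (online_cost sigma c <= (alpha I)%:E * online_opt sigma)%E.

Definition competitive_rand (alpha : inst ND -> R) : Prop :=
  exists p : prog, exists P : {poly nat},
    forall (I : inst ND) (sigma : online_input I), valid_input sigma ->
      (expected_time (@family R ND I) (online_ext sigma) (online_init I p)
         <= (P.[online_size sigma]%:R)%:E)%E /\
      (expected_value (@family R ND I) (online_ext sigma) (online_cost sigma)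
         (online_init I p)
         <= (alpha I)%:E * online_opt sigma)%E.

(* max (1, log |E|): the plain logarithm is 0 for |E| = 1. *)
Definition log_nelt (I : inst ND) : R := Num.max 1 (ln (nelt I)%:R).

End NetworkDesign.

(* Main.v *)
(** The algorithm maintains a level for every pending request, initially the
    smallest [c] such that the elements of cost at most [c] satisfy it.  Once
    the unpaid delays of the fresh requests of level at most [L] add up to [L],
    the level of one of them, or the timer of a request of level [L] rings, a
    service of value [theta = 2 L] takes place.  It transmits all elements of
    cost at most [theta / n].  For the remaining requests of level at most
    [theta], the penalty of a request is the growth of its delay up to a future
    time [tau]; this time increases as long as the prize-collecting solution
    costs at most [theta].  In the end that solution is transmitted, and the
    requests that it leaves out are raised to level [theta], with timer [tau].

    When a timer rings, a prize-collecting instance had a solution of cost about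
    [theta], hence the optimal schedule pays [theta / gamma] for its requests,
    either in delays, each of which is charged once, or in elements.  When fresh
    requests of level about [L] have accumulated delay [L], the optimal schedule
    pays this delay or transmits an element of cost about [L].  The values of
    the services charged to the same transmission of an element of cost [c]
    double.  Each charges at most the minimum of its value and [gamma c], and
    those of value far above [n gamma c] can ignore it, so that
    [O(gamma c log n)] is charged in total.  The program does not know [gamma].

    The deterministic and the randomized claim follow from one argument, in
    which [ub] bounds the expected running time of a configuration and asserts a
    property of every possible output; without coins this is an ordinary bound. *)

Require Import Defs.
From mathcomp Require Import all_boot all_order all_algebra.
From mathcomp Require Import all_classical all_reals all_analysis.
From mathcomp Require Import ring lra zify.
Import Order.TTheory GRing.Theory Num.Theory.
Import numFieldNormedType.Exports.
Set Implicit Arguments.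
Unset Strict Implicit.
Unset Printing Implicit Defensive.
Local Open Scope ring_scope.

(** * Expected running time *)

(** [Reach] inverts one delay function at a time, so the moment at which a sum of delays attains a
    budget cannot be queried. Each delay is therefore allowed to grow by the budget divided by the
    number of requests: the sum overshoots by at most one budget, which explains the factor 2 in the
    bounds on unpaid delays and on penalties, and the number of increments stays polynomial. The
    cheap elements serve every request whose initial level is at most [theta / n]. Levels thus stay
    below [n] times their initial value, which limits how often a request can be raised. With gamma
    unknown, [tau] stops at the first instance whose solution is priced above [theta]. That solution
    is discarded and only yields the lower bound [theta / gamma] on the instance; transmitted is the
    last solution within the budget. The constant: a service adds at most [6 theta], namely [theta]
    for each of two transmissions, [2 theta] for unpaid delays and [2 theta] for penalties. It
    raises a potential by at least [theta / 8], and the potential is at most gamma times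
    [up_log 2 n + 3], itself at most 6 max(1, ln n), times the optimum. Hence 6 * 8 * 6 = 288. *)

Section UpperBounds.
Variables (R : realType) (T : Type) (n : nat) (X : T -> {set {set 'I_n}}).
Variables (S : Type) (ext : query -> Defs.val R T -> S -> option (Defs.val R T * S)).
Local Notation val := (Defs.val R T).
Local Notation config := (config R T S).
Local Notation step := (step X ext).
Local Notation run := (run X ext).
Local Notation exec := (exec X ext).
Implicit Types (c : config) (B K : R) (m : nat) (v : val).

(** The fuel [m] truncates: [B] bounds the expectation of min(running time, [m]), and [G] holds for
    whatever halts within [m] steps. Both coin values are averaged at every step, also where no coin
    is read, so that no probability space is needed. *)
Fixpoint ub (G : config -> Prop) m c B : Prop :=
  match m with
  | 0 => 0 <= B /\ (halted c -> G c)
  | m'.+1 =>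
      if halted c then 0 <= B /\ G c
      else exists B0 B1, [/\ 1 + (B0 + B1) / 2 <= B,
             ub G m' (step false c) B0 & ub G m' (step true c) B1]
  end.

Lemma ubS G m c B : ub G m.+1 c B =
  if halted c then 0 <= B /\ G c
  else exists B0 B1, [/\ 1 + (B0 + B1) / 2 <= B,
         ub G m (step false c) B0 & ub G m (step true c) B1].
Proof. by []. Qed.

Lemma ub_ge0 G m c B : ub G m c B -> 0 <= B.
Proof.
elim: m c B => [c B []//|m IH c B] /=; case: ifP => [_ []//|_].
move=> [B0 [B1 [h /IH h0 /IH h1]]]; lra.
Qed.

Lemma ub_le G m c B B' : B <= B' -> ub G m c B -> ub G m c B'.
Proof.
case: m => [|m] BB' /=; first by case=> B0 ?; split => //; apply: le_trans BB'.
case: ifP => _; first by case=> B0 ?; split => //; apply: le_trans BB'.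
by move=> [B0 [B1 [h h0 h1]]]; exists B0, B1; split => //; apply: le_trans BB'.
Qed.

Lemma ub_pred G m c B : ub G m.+1 c B -> ub G m c B.
Proof.
elim: m c B => [|m IH] c B; last first.
  move=> /=; case: ifP => // _ [B0 [B1 [h h0 h1]]].
  by exists B0, B1; split => //; apply: IH.
move=> /=; case: ifP => [_ []//|_ [B0 [B1 [h [h0 _] [h1 _]]]]].
by split => //; lra.
Qed.

(** The fuel is the same on both sides because a bound also holds for less fuel ([ub_pred]).
    Programs can thus be composed without counting fuel. *)
Lemma ub_step G m c c' B : ~~ halted c -> (forall b, step b c = c') ->
  ub G m c' B -> ub G m c (1 + B).
Proof.
move=> hc hs; case: m => [|m] h /=.
  by rewrite (negbTE hc); split => //; have := ub_ge0 h; lra.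
rewrite (negbTE hc) !hs; have h' := ub_pred h.
by exists B, B; split => //; lra.
Qed.

Lemma ub_halted G m c B : ub G m c B ->
  forall coins, halted (run coins m c) -> G (run coins m c).
Proof.
have runS coins k c' : run coins k.+1 c' = run (fun i => coins i.+1) k (step (coins 0) c').
  by elim: k => [//|k IH]; rewrite -[LHS]/(step (coins k.+1) (run coins k.+1 c')) IH.
have haltS b c' : halted c' -> step b c' = c' by case: c' => [[]//v []].
have haltR coins k c' : halted c' -> run coins k c' = c'.
  by move=> hc; elim: k => //= k ->; apply: haltS.
elim: m c B => [c B [_ +] coins //|m IH c B] /=.
case: ifP => [hc [_ Gc] coins|hc [B0 [B1 [_ /IH h0 /IH h1]]] coins].
  by rewrite haltR// haltS.
move: (runS coins m c) => /= ->.
by case: (coins 0); [apply: h1|apply: h0].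
Qed.

Section Triples.
Variable G : config -> Prop.

(** A timed Hoare triple in continuation-passing style: the rest of the computation is an arbitrary
    stack [k] of cost [K]. The final property [G] is involved because an unanswered query halts the
    whole machine from inside [p]. *)
Definition runs p v s B (Post : val -> S -> Prop) : Prop :=
  0 <= B /\
  forall k m K, 0 <= K ->
    (forall v' s', Post v' s' -> ub G m (Config (Ret v') k s') K) ->
    ub G m (Config (Run p v) k s) (B + K).

Lemma runs_weaken p v s B B' (Post Post' : val -> S -> Prop) :
  B <= B' -> (forall v' s', Post v' s' -> Post' v' s') ->
  runs p v s B Post -> runs p v s B' Post'.
Proof.
move=> BB' PP' [B0 h]; split; first exact: le_trans BB'.
move=> k m K K0 hK; apply: (@ub_le _ _ _ (B + K)); first by rewrite lerD2r.
by apply: h => // v' s' /PP'; apply: hK.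
Qed.

Lemma runs_prim o v s v' s' (Post : val -> S -> Prop) :
  (forall b, exec b o v s = Some (v', s')) -> Post v' s' ->
  runs (Prim o) v s 1 Post.
Proof.
move=> he hp; split=> // k m K K0 hK.
apply: (@ub_step _ _ _ (Config (Ret v') k s')) => //; last exact: hK.
by move=> b /=; rewrite he.
Qed.

(** The step empties the stack, so the continuation never runs and [Post] is arbitrary. *)
Lemma runs_exit o v s (Post : val -> S -> Prop) :
  (forall b, exec b o v s = None) -> G (Config (Ret VUnit) [::] s) ->
  runs (Prim o) v s 1 Post.
Proof.
move=> he hG; split=> // k m K K0 hK.
apply: (@ub_step _ _ _ (Config (Ret VUnit) [::] s)) => //.
  by move=> b /=; rewrite he.
by case: m {hK}.
Qed.

Lemma runs_seq p1 p2 v s B1 B2 (Mid Post : val -> S -> Prop) :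
  runs p1 v s B1 Mid ->
  0 <= B2 -> (forall v' s', Mid v' s' -> runs p2 v' s' B2 Post) ->
  runs (Seq p1 p2) v s (B1 + B2 + 2) Post.
Proof.
move=> [B10 h1] B20 h2; split; first lra.
move=> k m K K0 hK; have -> : B1 + B2 + 2 + K = 1 + (B1 + (1 + (B2 + K))) by ring.
apply: ub_step => //=; apply: h1; first lra.
move=> v' s' /h2[_ {}h2]; apply: ub_step => //=; exact: h2.
Qed.

Lemma runs_fork p1 p2 v s B1 B2 (Mid Post : val -> S -> Prop) :
  runs p1 v s B1 Mid ->
  0 <= B2 ->
  (forall v1 s', Mid v1 s' -> runs p2 v s' B2 (fun v2 s2 => Post (VPair v1 v2) s2)) ->
  runs (Fork p1 p2) v s (B1 + B2 + 3) Post.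
Proof.
move=> [B10 h1] B20 h2; split; first lra.
move=> k m K K0 hK.
have -> : B1 + B2 + 3 + K = 1 + (B1 + (1 + (B2 + (1 + K)))) by ring.
apply: ub_step => //=; apply: h1; first lra.
move=> v1 s1 /h2[_ {}h2]; apply: ub_step => //=; apply: h2; first lra.
move=> v2 s2 /hK h; exact: (@ub_step _ _ _ (Config (Ret (VPair v1 v2)) k s2)).
Qed.

Lemma runs_case_inl p1 p2 v s B (Post : val -> S -> Prop) :
  runs p1 v s B Post -> runs (Case p1 p2) (VInl v) s (1 + B) Post.
Proof.
move=> [B0 h]; split; first lra.
by move=> k m K K0 hK; rewrite -addrA; apply: ub_step => //=; apply: h.
Qed.

Lemma runs_case_inr p1 p2 v s B (Post : val -> S -> Prop) :
  runs p2 v s B Post -> runs (Case p1 p2) (VInr v) s (1 + B) Post.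
Proof.
move=> [B0 h]; split; first lra.
by move=> k m K K0 hK; rewrite -addrA; apply: ub_step => //=; apply: h.
Qed.

(** The index bounds the remaining repetitions. Each round costs [C] and one step for the loop
    frame; one more step enters the loop. *)
Lemma runs_loop (I : nat -> val -> S -> Prop) p C (Post : val -> S -> Prop) :
  0 <= C ->
  (forall j v s, I j v s -> runs p v s C (fun v' s' =>
     (exists u, v' = VInl u /\ exists2 j', (j' < j)%N & I j' u s') \/
     (exists u, v' = VInr u /\ Post u s'))) ->
  forall j v s, I j v s -> runs (Loop p) v s (j.+1%:R * (C + 1) + 1) Post.
Proof.
move=> C0 hp j v s Ij; split; first by have := ler0n R j.+1; nra.
move=> k m K K0 hK; rewrite addrAC [_ + 1]addrC; apply: ub_step => //=.
elim/ltn_ind: j v s Ij => j IH v s /hp[_ {}hp].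
apply: (@ub_le _ _ _ (C + (j%:R * (C + 1) + 1 + K))).
  by rewrite -natr1; lra.
apply: hp; first by have := ler0n R j; nra.
move=> v' s' [[u [-> [j' jj' Ij']]]|[u [-> /hK {}hK]]].
  rewrite addrAC [_ + 1]addrC; apply: ub_step => //=.
  apply: ub_le (IH _ jj' _ _ Ij'); rewrite lerD2r ler_wpM2r//; first lra.
  by rewrite ler_nat.
rewrite addrAC [_ + 1]addrC; apply: ub_step => //=.
by apply: ub_le hK; have := ler0n R j; nra.
Qed.

End Triples.
End UpperBounds.

Section Expectation.
Variables (R : realType) (T : Type) (n : nat) (X : T -> {set {set 'I_n}}).
Variables (S : Type) (ext : query -> Defs.val R T -> S -> option (Defs.val R T * S)).
Local Notation val := (Defs.val R T).
Local Notation config := (config R T S).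
Local Notation step := (step X ext).
Local Notation run := (run X ext).
Local Notation exec := (exec X ext).
Local Notation ub := (ub X ext).
Implicit Types (c : config) (B K : R) (m : nat) (v : val).

(** [run] adds steps at the end, whereas [ub] and [mean_time] peel off the first one. *)
Lemma run_shift coins m c :
  run coins m.+1 c = run (fun i => coins i.+1) m (step (coins 0) c).
Proof.
by elim: m => [//|m IH]; rewrite -[LHS]/(step (coins m.+1) (run coins m.+1 c)) IH.
Qed.

Lemma step_halted b c : halted c -> step b c = c.
Proof. by case: c => [[]//v []]. Qed.

Lemma run_halted coins m c : halted c -> run coins m c = c.
Proof. by move=> hc; elim: m => //= m ->; apply: step_halted. Qed.

Fixpoint mean_time m c : R :=
  if m is m'.+1 then
    if halted c then 0
    else 1 + (mean_time m' (step false c) + mean_time m' (step true c)) / 2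
  else 0.

Lemma mean_time_le G m c B : ub G m c B -> mean_time m c <= B.
Proof.
elim: m c B => [c B []//|m IH c B] /=; case: ifP => [_ []//|_].
by move=> [B0 [B1 [h /IH h0 /IH h1]]]; lra.
Qed.

Lemma ub_mean_time G m c :
  (forall coins k, halted (run coins k c) -> G (run coins k c)) ->
  ub G m c (mean_time m c).
Proof.
elim: m c => [c hG|m IH c hG] /=.
  by split=> // hc; have := hG xpred0 0%N; apply.
case hc: (halted c); first by split=> //; have := hG xpred0 0%N; apply.
exists (mean_time m (step false c)), (mean_time m (step true c)).
have h b coins k : halted (run coins k (step b c)) -> G (run coins k (step b c)).
  by have := hG (fun i => if i is i'.+1 then coins i' else b) k.+1; rewrite run_shift.
by split=> //; apply: IH => coins k; apply: h.
Qed.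

Lemma sum_tuple_cons m (f : m.+1.-tuple bool -> R) :
  \sum_(b : m.+1.-tuple bool) f b =
  \sum_(b : m.-tuple bool) f [tuple of false :: b] +
  \sum_(b : m.-tuple bool) f [tuple of true :: b].
Proof.
rewrite (reindex (fun p : bool * m.-tuple bool => [tuple of p.1 :: p.2])) /=; last first.
  exists (fun b : m.+1.-tuple bool => (thead b, [tuple of behead b])).
    by move=> [x b] _ /=; congr (_, _); apply/val_inj.
  by move=> b _; rewrite /= -tuple_eta.
rewrite -(pair_bigA _ (fun x (b : m.-tuple bool) => f [tuple of x :: b])) /=.
by rewrite big_bool addrC.
Qed.

Lemma prob_runningE m c :
  prob_running X ext c m =
  (\sum_(b : m.-tuple bool) (~~ halted (run_tuple X ext b c))%:R) / 2 ^+ m.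
Proof.
rewrite /prob_running; congr (_ / _).
rewrite -sum1_card natr_sum big_mkcond/=.
by apply: eq_bigr => b _; rewrite inE; case: ifP.
Qed.

Lemma prob_running_halted m c : halted c -> prob_running X ext c m = 0.
Proof.
move=> hc; rewrite prob_runningE big1 ?mul0r// => b _.
by rewrite /run_tuple run_halted// hc.
Qed.

Lemma prob_running_step m c :
  prob_running X ext c m.+1 =
  (prob_running X ext (step false c) m + prob_running X ext (step true c) m) / 2.
Proof.
rewrite !prob_runningE sum_tuple_cons /run_tuple.
under eq_bigr do rewrite run_shift/=.
under [X in _ + X]eq_bigr do rewrite run_shift/=.
by rewrite exprS -mulrDl invfM [2^-1 * _]mulrC mulrA.
Qed.

(** The tail-sum formula for the expectation of min(running time, [m]). *)
Lemma sum_prob_running m c :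
  \sum_(0 <= j < m) prob_running X ext c j = mean_time m c.
Proof.
elim: m c => [c|m IH c]; first by rewrite big_nil.
rewrite /=; case: ifP => hc.
  by rewrite big1_seq// => j _; rewrite prob_running_halted.
rewrite big_nat_recl//; congr (_ + _).
  rewrite prob_runningE expr0 divr1 (eq_bigr (fun=> 1)); last first.
    by move=> b _; rewrite /run_tuple/= hc.
  by rewrite sumr_const card_tuple expn0.
under eq_bigr do rewrite prob_running_step.
by rewrite -mulr_suml big_split/= !IH.
Qed.

Lemma prob_running_ge0 m c : 0 <= prob_running X ext c m.
Proof. by rewrite divr_ge0// ?exprn_ge0. Qed.

Lemma expected_time_le G c B :
  (forall m, ub G m c B) -> (expected_time X ext c <= B%:E)%E.
Proof.
move=> h; apply: lime_le.
  by apply: is_cvg_nneseries => m _ _; rewrite lee_fin prob_running_ge0.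
apply: nearW => m; rewrite sumEFin lee_fin sum_prob_running.
exact: mean_time_le (h m).
Qed.

Lemma ub_expected_time G c B m :
  (expected_time X ext c <= B%:E)%E ->
  (forall coins k, halted (run coins k c) -> G (run coins k c)) ->
  ub G m c B.
Proof.
move=> hB hG; apply: (@ub_le _ _ _ _ _ _ _ _ _ (mean_time m c)); last exact: ub_mean_time.
rewrite -lee_fin; apply: le_trans hB; rewrite -sum_prob_running -sumEFin.
apply: nneseries_lim_ge => j _; by rewrite lee_fin prob_running_ge0.
Qed.

(** The bound on [f] holds for every coin sequence, and the runs that halt within [m] steps have
    total mass at most 1. *)
Lemma expected_value_le (f : config -> \bar R) c (x : \bar R) :
  (0 <= x)%E ->
  (forall coins m, halted (run coins m c) -> (f (run coins m c) <= x)%E) ->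
  (expected_value X ext f c <= x)%E.
Proof.
move=> x0 hf; apply: ge_ereal_sup => _ [m _ <-].
apply: (@le_trans _ _ (\sum_(b : m.-tuple bool | halted (run_tuple X ext b c))
   x * ((2 ^+ m)^-1)%:E)%E).
  apply: lee_sum => b hb; apply: lee_wpmul2r; last exact: hf.
  by rewrite lee_fin invr_ge0 exprn_ge0.
case: x x0 {hf} => [x x0|_|//]; last by rewrite leey.
apply: (@le_trans _ _ (\sum_(b : m.-tuple bool) (x * (2 ^+ m)^-1)%:E)%E).
  rewrite big_mkcond; apply: lee_sum => b _; case: ifP => // _.
  by rewrite lee_fin mulr_ge0// invr_ge0 exprn_ge0.
rewrite sumEFin lee_fin sumr_const card_tuple card_bool -(mulr_natr (x / 2 ^+ m)) natrX.
by rewrite -mulrA mulVf ?mulr1// expf_neq0.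
Qed.

(** Frames contain code that is still to be run, so a restriction on primitives has to cover the
    stack as well. *)
Fixpoint stack_uses (P : pred prim) (k : seq (frame R T)) : bool :=
  match k with
  | [::] => true
  | (KSeq p | KForkL p _ | KLoop p) :: k' => uses_only P p && stack_uses P k'
  | KForkR _ :: k' => stack_uses P k'
  end.

Definition config_uses P c : bool :=
  (if ctrl c is Run p _ then uses_only P p else true) && stack_uses P (stack c).

Lemma config_uses_step P b c : config_uses P c -> config_uses P (step b c).
Proof.
case: c => [[[pr|p1 p2|p1 p2|p1 p2|p] v|v] k s]; rewrite /config_uses /=.
- by case: (exec _ _ _ _) => [[v' s']|] //=; case/andP.
- by rewrite andbA andbAC; case/andP=> /andP[-> ->] ->.
- by rewrite andbA andbAC; case/andP=> /andP[-> ->] ->.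
- by case/andP=> /andP[h1 h2] h3; case: v => *; rewrite /= ?h1 ?h2 ?h3.
- by case/andP => -> ->.
- by case: k => [|[p|p u|u|p] k] //= /andP[h1 h2]; case: v => * /=; rewrite ?h1 ?h2.
Qed.

Lemma step_deterministic c b b' :
  config_uses (fun o => if o is Coin then false else true) c ->
  step b c = step b' c.
Proof.
case: c => [[[pr|p1 p2|p1 p2|p1 p2|p] v|v] k s] //=.
by rewrite /config_uses /=; case: pr.
Qed.

(** Without coins both successors coincide, and the average is an ordinary step count. *)
Lemma ub_deterministic G c m N :
  config_uses (fun o => if o is Coin then false else true) c ->
  halted (run no_coins N c) -> G (run no_coins N c) ->
  ub G m c N%:R.
Proof.
elim: m c N => [|m IH] c N cd; first by move=> hc Gc; split=> // h; rewrite run_halted in Gc.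
case hc: (halted c); first by rewrite run_halted//= hc => _ Gc; split.
case: N => [|N]; first by rewrite /= hc.
rewrite run_shift => hN GN /=; rewrite hc (step_deterministic true false cd).
exists N%:R, N%:R; split; [by rewrite -(natr1 N); lra| |]; apply: IH => //; exact: config_uses_step.
Qed.

(** A run still active after [N] steps has mean time [N + 1] under fuel [N + 1], which exceeds the
    assumed bound. *)
Lemma halted_deterministic G c N :
  config_uses (fun o => if o is Coin then false else true) c ->
  (forall m, ub G m c N%:R) -> halted (run no_coins N c).
Proof.
move=> cd hub; apply: contraT => hN.
suff : N.+1%:R <= N%:R :> R by rewrite ler_nat ltnn.
rewrite (le_trans _ (mean_time_le (hub N.+1)))//.
elim: N c cd hN {hub} => [|N IH] c cd; first by rewrite /= => /negbTE ->; rewrite addr0 mul0r addr0.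
case hc: (halted c); first by rewrite run_halted ?hc.
rewrite run_shift => /IH -/(_ (config_uses_step _ cd)) /= h.
rewrite hc (step_deterministic true false cd) -natr1.
move: h; case: ifP => _; lra.
Qed.

End Expectation.

(** * Running an offline program inside the online machine *)

Section Subroutine.
Variables (R : realType) (T : Type) (n : nat) (X : T -> {set {set 'I_n}}).
Variables (S S' : Type) (ext : query -> Defs.val R T -> S -> option (Defs.val R T * S)).
Variables (ext' : query -> Defs.val R T -> S' -> option (Defs.val R T * S')).

(** The subroutine works on top of the caller's stack [k], and the caller's environment replaces its
    own. *)
Definition transplant (k : seq (frame R T)) (w : S') (c : config R T S) : config R T S' :=
  Config (ctrl c) (stack c ++ k) w.

Let off o := if o is Query _ then false else true.

Lemma transplant_step b k w c : config_uses off c -> ~~ halted c ->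
  step X ext' b (transplant k w c) = transplant k w (step X ext b c).
Proof.
case: c => [[[pr|p1 p2|p1 p2|p1 p2|p] v|v] k1 s]; rewrite /config_uses /transplant //=.
- by case: pr.
- by case: v.
- by case: k1 => [|[p|p u|u|p] k1] //= _ _; case: v.
Qed.

(** Both machines make the same steps with the same coins until the offline one halts; there the
    caller's frames [k] take over. The caller's environment is untouched as offline code makes no
    queries. *)
Lemma runs_offline (G : config R T S -> Prop) (G' : config R T S' -> Prop)
    (Post : Defs.val R T -> Prop) p v s w B :
  offline p -> (forall c, G c -> Post (output c)) ->
  (forall m, ub X ext G m (init p v s) B) ->
  runs X ext' G' p v w B (fun v' w' => Post v' /\ w' = w).
Proof.
move=> offp GP hub; split; first exact: ub_ge0 (hub 0%N).
move=> k m K K0 hK.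
have : config_uses off (init p v s) by rewrite /config_uses/= andbT.
rewrite -[Config (Run p v) k w]/(transplant k w (init p v s)).
move: (init p v s) (hub m) => c.
elim: m B c hK {hub} => [|m IH] B c hK.
  move=> /= [B0 Gc] offc; split; first lra.
  case: c Gc offc => [[p0 v0|v0] [|f k1] s0] //= Gc _.
  by have [_] := hK v0 w (conj (GP _ (Gc erefl)) erefl).
case hc: (halted c).
  rewrite ubS hc => -[B0 Gc] _.
  case: c hc Gc => [[p0 v0|v0] [|f k1] s0] //= _ Gc.
  by have := hK v0 w (conj (GP _ Gc) erefl); apply: ub_le; lra.
rewrite !ubS hc => -[B0 [B1 [hB h0 h1]]] offc.
have hc' : halted (transplant k w c) = false.
  by case: c hc {h0 h1 offc} => [[p0 v0|v0] [|f k1] s0].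
rewrite hc'; exists (B0 + K), (B1 + K); split; first lra.
  rewrite transplant_step ?hc//; apply: IH => //; last exact: config_uses_step.
  by move=> v' s' /hK /ub_pred.
rewrite transplant_step ?hc//; apply: IH => //; last exact: config_uses_step.
by move=> v' s' /hK /ub_pred.
Qed.
End Subroutine.

(** * Programs over an environment of variables *)

(** An environment is a left-nested pair with the newest binding on the right, so that [i] is a de
    Bruijn index. *)
Fixpoint Var (i : nat) : prog := if i is j.+1 then Seq (Prim Fst) (Var j) else Prim Snd.
Definition Un (o : prim) (a : prog) := Seq a (Prim o).
Definition Op (o : prim) (a b : prog) := Seq (Fork a b) (Prim o).
Definition Let (a b : prog) := Seq (Fork (Prim Id) a) b.
Definition Match (c a b : prog) := Seq (Fork (Prim Id) c) (Seq (Prim Dist) (Case a b)).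
Definition If (c a b : prog) := Match c (Seq (Prim Fst) a) (Seq (Prim Fst) b).
Definition Nil := Seq (Prim MkUnit) (Prim MkInl).
Definition Cons (a b : prog) := Un MkInr (Fork a b).
Definition Zero := Op Defs.Sub (Prim One) (Prim One).
(* The state of the loop is [(env, (list, acc))]. *)
Definition fold_body (f : prog) :=
  Match (Seq (Prim Snd) (Prim Fst))
    (Un MkInr (Seq (Prim Fst) (Seq (Prim Snd) (Prim Snd))))
    (Un MkInl (Fork (Seq (Prim Fst) (Prim Fst)) (Fork (Seq (Prim Snd) (Prim Snd))
      (Seq (Fork (Fork (Seq (Prim Fst) (Prim Fst)) (Seq (Prim Fst) (Seq (Prim Snd) (Prim Snd))))
                 (Seq (Prim Snd) (Prim Fst))) f)))).
Definition Fold (l a f : prog) := Seq (Fork (Prim Id) (Fork l a)) (Loop (fold_body f)).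
(* [VInl VUnit] stands for an undefined minimum. *)
Definition MinOpt (acc v : prog) :=
  Let v (Match (Seq (Prim Fst) acc)
    (Un MkInr (Var 1))
    (Un MkInr (If (Op Leq (Var 0) (Var 1)) (Var 0) (Var 1)))).

(** The excluded primitives toss a coin, let time pass or transmit; the other queries only read the
    world. *)
Definition pure_prim (o : prim) : bool :=
  match o with Coin | Query Wait | Query Send => false | _ => true end.

Fixpoint loop_free (p : prog) : bool :=
  match p with
  | Prim o => pure_prim o
  | Seq a b | Fork a b | Case a b => loop_free a && loop_free b
  | Loop _ => false
  end.

(** [K] bounds the length of every list traversed; a fold runs its body once more to notice the end
    of the list, hence [K.+1]. *)
Fixpoint steps (p : prog) (K : nat) : nat :=
  match p with
  | Prim _ => 1
  | Seq a b => steps a K + steps b K + 2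
  | Fork a b => steps a K + steps b K + 3
  | Case a b => steps a K + steps b K + 1
  | Loop a => K.+1 * (steps a K + 1) + 1
  end%N.

Section Evaluation.
Variables (R : realType) (ND : nd_class R) (I : inst ND) (sigma : online_input I).
Variable G : config R (request I) (world I) -> Prop.
Local Notation val := (Defs.val R (request I)).
Local Notation fam := (@Defs.family R ND I).
Variables (K : nat) (w : world I).
Implicit Types (p : prog) (v r : val).

(** Verification of loop-free code by reflection: [evp_loop_free] reduces it to computing this
    function. The value at [Loop] is a dummy. *)
Fixpoint den p v : val :=
  match p with
  | Prim o => if Defs.exec fam (online_ext sigma) false o v w is Some (v', _) then v' else VUnit
  | Seq a b => den b (den a v)
  | Fork a b => VPair (den a v) (den b v)
  | Case a b => match v with VInl x => den a x | VInr x => den b x | _ => VUnit end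
  | Loop _ => VUnit
  end.

Definition evp p v v' :=
  runs fam (online_ext sigma) G p v w (steps p K)%:R (fun v1 w1 => v1 = v' /\ w1 = w).

Lemma evp_seq a b v u v' : evp a v u -> evp b u v' -> evp (Seq a b) v v'.
Proof.
move=> ha hb; rewrite /evp /= !natrD; apply: runs_seq ha _ _ => // u1 w1 [-> ->].
exact: hb.
Qed.

Lemma evp_fork a b v x y : evp a v x -> evp b v y -> evp (Fork a b) v (VPair x y).
Proof.
move=> ha hb; rewrite /evp /= !natrD; apply: runs_fork ha _ _ => // u1 w1 [-> ->].
by apply: runs_weaken hb => // u2 w2 [-> ->].
Qed.

Lemma evp_casel a b x v' : evp a x v' -> evp (Case a b) (VInl x) v'.
Proof.
move=> ha; have := runs_case_inl b ha; apply: runs_weaken => //.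
by rewrite /= !natrD; have := ler0n R (steps b K); lra.
Qed.

Lemma evp_caser a b x v' : evp b x v' -> evp (Case a b) (VInr x) v'.
Proof.
move=> hb; have := runs_case_inr a hb; apply: runs_weaken => //.
by rewrite /= !natrD; have := ler0n R (steps a K); lra.
Qed.

Lemma evp_prim o v : pure_prim o ->
  evp (Prim o) v (den (Prim o) v).
Proof.
move=> po; apply: (@runs_prim _ _ _ _ _ _ _ _ _ _ (den (Prim o) v) w) => // b.
case: o po => //= -[] // _; case: v => //= -[] // i [] // x.
Qed.

Lemma evp_loop_free p v v' : loop_free p -> den p v = v' -> evp p v v'.
Proof.
move=> + <-; elim: p v => //.
- by move=> o v; apply: evp_prim.
- by move=> a IHa b IHb v /= /andP[? ?]; apply: evp_seq; [apply: IHa|apply: IHb].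
- by move=> a IHa b IHb v /= /andP[? ?]; apply: evp_fork; [apply: IHa|apply: IHb].
- move=> a IHa b IHb v /= /andP[fa fb].
  (* A [Case] on a value that is not a sum takes one step and returns [VUnit], in agreement with
     [den]. *)
  have bad : (forall k m B, ub fam (online_ext sigma) G m (Config (Ret VUnit) k w) B ->
      ub fam (online_ext sigma) G m (Config (Run (Case a b) v) k w) (1 + B)) ->
      evp (Case a b) v VUnit.
    move=> h; split; rewrite ?ler0n// => k m B B0 /(_ VUnit w (conj erefl erefl)) hB.
    by apply: ub_le (h _ _ _ hB); rewrite lerD2r ler1n /= addn1.
  case: v bad => [|?|?|?|? ?|v|v] bad;
    try (by apply: bad => k m B hB; apply: ub_step hB).
    by apply: evp_casel; apply: IHa.
  by apply: evp_caser; apply: IHb.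
Qed.

Lemma evp_match_inl c a b r x v' :
  evp c r (VInl x) -> evp a (VPair r x) v' -> evp (Match c a b) r v'.
Proof.
move=> hc ha; apply: evp_seq; first by apply: evp_fork hc; apply: evp_prim.
by apply: evp_seq; [apply: evp_prim|apply: evp_casel].
Qed.

Lemma evp_match_inr c a b r x v' :
  evp c r (VInr x) -> evp b (VPair r x) v' -> evp (Match c a b) r v'.
Proof.
move=> hc ha; apply: evp_seq; first by apply: evp_fork hc; apply: evp_prim.
by apply: evp_seq; [apply: evp_prim|apply: evp_caser].
Qed.

Lemma evp_if c a b r (t : bool) v' :
  evp c r (vbool _ _ t) -> (if t then evp a r v' else evp b r v') ->
  evp (If c a b) r v'.
Proof.
case: t => hc hab; [apply: evp_match_inl hc _|apply: evp_match_inr hc _];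
  by apply: evp_seq hab; apply: evp_prim.
Qed.

Lemma evp_let a b r x v' : evp a r x -> evp b (VPair r x) v' -> evp (Let a b) r v'.
Proof. by move=> ha; apply: evp_seq; apply: evp_fork ha; apply: evp_prim. Qed.

Lemma evp_un o a r x v' : pure_prim o -> evp a r x -> den (Prim o) x = v' ->
  evp (Un o a) r v'.
Proof. by move=> po ha <-; apply: evp_seq ha _; apply: evp_prim. Qed.

Lemma evp_op o a b r x y v' : pure_prim o -> evp a r x -> evp b r y ->
  den (Prim o) (VPair x y) = v' -> evp (Op o a b) r v'.
Proof.
by move=> po ha hb <-; apply: evp_seq; [apply: evp_fork ha hb|apply: evp_prim].
Qed.

Lemma evp_cons a b r x s : evp a r x -> evp b r (vlist s) ->
  evp (Cons a b) r (vlist (x :: s)).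
Proof. by move=> ha hb; apply: evp_un (evp_fork ha hb) _. Qed.

Lemma evp_fold (A E : Type) (ea : A -> val) (ee : E -> val) (g : A -> E -> A)
    (J : seq E -> A -> Prop) l a f r s a0 :
  evp l r (vlist [seq ee x | x <- s]) -> evp a r (ea a0) -> (size s <= K)%N ->
  J s a0 ->
  (forall acc x t, J (x :: t) acc ->
     evp f (VPair (VPair r (ea acc)) (ee x)) (ea (g acc x)) /\ J t (g acc x)) ->
  evp (Fold l a f) r (ea (foldl g a0 s)).
Proof.
move=> hl ha sK Js hf; apply: evp_seq.
  by apply: evp_fork; [apply: evp_prim|apply: evp_fork hl ha].
pose Inv j v w' := w' = w /\ exists t acc,
  [/\ v = VPair r (VPair (vlist [seq ee x | x <- t]) (ea acc)), size t = j, J t acc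
    & foldl g acc t = foldl g a0 s].
rewrite /evp /=; apply: (@runs_weaken _ _ _ _ _ _ _ _ _ _
  ((size s).+1%:R * ((steps (fold_body f) K)%:R + 1) + 1) _
  (fun v1 w1 => v1 = ea (foldl g a0 s) /\ w1 = w)) => //.
  by rewrite natrD natrM natrD lerD2r ler_wpM2r ?ler_nat.
apply: (runs_loop (I := Inv)) => //; last by split=> //; exists s, a0.
move=> j v w1 [-> [t [acc [-> szt Jt ht]]]].
case: t szt Jt ht => [|x t] szt Jt ht /=.
  have h : evp (fold_body f) (VPair r (VPair (VInl VUnit) (ea acc))) (VInr (ea acc)).
    by apply: evp_match_inl; apply: evp_loop_free.
  apply: runs_weaken h => // v' w' [-> ->]; right; exists (ea acc); split=> //.
  by rewrite -ht.
have [hfx Jt'] := hf _ _ _ Jt.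
have h : evp (fold_body f) (VPair r (VPair (vlist [seq ee y | y <- x :: t]) (ea acc)))
    (VInl (VPair r (VPair (vlist [seq ee y | y <- t]) (ea (g acc x))))).
  apply: evp_match_inr; first by apply: evp_loop_free => //=.
  apply: evp_un => //; apply: evp_fork; first by apply: evp_loop_free.
  apply: evp_fork; first by apply: evp_loop_free.
  by apply: evp_seq hfx; apply: evp_loop_free.
apply: runs_weaken h => // v' w' [-> ->]; left; eexists; split; first by [].
exists (size t); first by rewrite -szt.
by split=> //; exists t, (g acc x).
Qed.

Lemma evp_fold_in (A : Type) (E : eqType) (ea : A -> val) (ee : E -> val) (g : A -> E -> A)
    l a f r s a0 :
  evp l r (vlist [seq ee x | x <- s]) -> evp a r (ea a0) -> (size s <= K)%N ->
  (forall acc x, x \in s ->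
     evp f (VPair (VPair r (ea acc)) (ee x)) (ea (g acc x))) ->
  evp (Fold l a f) r (ea (foldl g a0 s)).
Proof.
move=> hl ha sK hf.
apply: (evp_fold (J := fun t _ => {subset t <= s})) hl ha sK _ _ => // acc x t ts.
by split; [apply: hf; apply: ts; rewrite inE eqxx|move=> y yt; apply: ts; rewrite inE yt orbT].
Qed.

Definition min_opt (acc : option R) (x : R) : option R :=
  if acc is Some y then Some (if y <= x then y else x) else Some x.

Definition vopt (x : option R) : val := if x is Some y then VInr (VNum y) else VInl VUnit.

Lemma evp_min_opt acc pv r x y : evp acc r (vopt x) -> evp pv r (VNum y) ->
  evp (MinOpt acc pv) r (vopt (min_opt x y)).
Proof.
move=> hx hy; apply: evp_let hy _.
have h : evp (Seq (Prim Fst) acc) (VPair r (VNum y)) (vopt x).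
  by apply: evp_seq hx; apply: evp_prim.
case: x h {hx} => [x|] h.
  apply: evp_match_inr h _; apply: evp_loop_free => //=.
  by case: (x <= y).
by apply: evp_match_inl h _; apply: evp_loop_free.
Qed.

End Evaluation.

(** * The online algorithm *)

(* A pending request is a tuple (reference, request, level, delay paid for,
   timer); the timer is [VInl VUnit] until the first service involving it. *)
Definition eRef i := Un Fst (Var i).
Definition eReq i := Un Fst (Un Snd (Var i)).
Definition eLev i := Un Fst (Un Snd (Un Snd (Var i))).
Definition ePaid i := Un Fst (Un Snd (Un Snd (Un Snd (Var i)))).
Definition eTimer i := Un Snd (Un Snd (Un Snd (Un Snd (Var i)))).
Definition DelayP i t := Op (Query Delay) (eRef i) t.
Definition ReachP i x := Op (Query Reach) (eRef i) x.
Definition SatP i s := Op Sat (Un Fst (eReq i)) s.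
Definition MaxP a b := If (Op Leq a b) b a.
Definition PenaltyP i t := Op Defs.Sub (MaxP (DelayP i t) (ePaid i)) (ePaid i).
Definition FalseP := Un MkInr (Prim MkUnit).
Definition TrueP := Un MkInl (Prim MkUnit).
Definition Count l := Fold l Zero (Op Add (Var 1) (Prim One)).
Definition Rev l a := Fold l a (Cons (Var 0) (Var 1)).
Fixpoint Up (i : nat) : prog := if i is j.+1 then Seq (Prim Fst) (Up j) else Prim Id.

(* The environment of the main loop lists, the latest first: pending requests,
   time, number of elements, reversed list of costs, instance. *)
Definition candidateP :=
  Fold (Var 0) Nil (Match (eTimer 0)
    (If (Op Leq (eLev 1) (Fold (Var 3) Zero (Match (eTimer 0)
           (If (Op Leq (eLev 1) (eLev 4))
               (Op Add (Var 2) (Op Defs.Sub (DelayP 1 (Var 7)) (ePaid 1)))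
               (Var 2))
           (Var 2))))
        (MinOpt (Var 2) (eLev 1)) (Var 2))
    (If (Op Leq (Var 0) (Var 4)) (MinOpt (Var 2) (eLev 1)) (Var 2))).

(** A fresh request rings when its delay has grown by its level divided by the number of pending
    requests. Until then the fresh requests of level at most [c] gain at most [c] together. *)
Definition alarmP :=
  Match (Let (Count (Var 0)) (Fold (Var 1) Nil (Match (eTimer 0)
      (MinOpt (Var 2) (ReachP 1 (Op Add (DelayP 1 (Var 5)) (Op Div (eLev 1) (Var 3)))))
      (MinOpt (Var 2) (Var 0)))))
    (Un MkInr (Var 0)) (Un MkInl (Var 0)).

Definition bottleneckP :=
  Fold (Cons Zero (Un Fst (Var 7))) Nil
    (If (Op Sat (Un Fst (Un Snd (Var 2)))
           (Fold (Var 8) Nil (Cons (Op Leq (Var 0) (Var 2)) (Var 1))))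
        (MinOpt (Var 1) (Var 0)) (Var 1)).

Definition admitP :=
  Fold (Un Snd (Var 0)) (Var 1)
    (Match bottleneckP (Var 2)
      (Cons (Fork (Un Fst (Var 1)) (Fork (Un Snd (Var 1)) (Fork (Var 0)
               (Fork (Op (Query Delay) (Un Fst (Var 1)) (Un Fst (Var 3))) Nil))))
        (Var 2))).

Definition waitP :=
  Seq (Prim Fst) (Seq (Fork (Prim Id) (Seq alarmP (Prim (Query Wait))))
    (Un MkInl (Fork (Fork (Up 3) (Un Fst (Var 0))) admitP))).

Definition cheapP := Fold (Var 5) Nil (Cons (Op Leq (Op Mul (Var 0) (Var 6)) (Var 2)) (Var 1)).

Definition keptP :=
  Fold (Var 4) Nil (If (Op Leq (eLev 0) (Var 4)) (Var 1) (Cons (Var 0) (Var 1))).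

Definition eligibleP :=
  Fold (Var 5) Nil (If (Op Leq (eLev 0) (Var 5))
    (If (SatP 0 (Var 4)) (Var 1)
       (Match (eTimer 0)
          (Cons (Fork (eRef 1) (Fork (eReq 1) (Fork (eLev 1) (Fork (DelayP 1 (Var 9)) Nil))))
             (Var 2))
          (Cons (Var 1) (Var 2))))
    (Var 1)).

(* [prune] makes an arbitrary output of the prize-collecting algorithm readable:
   a bit that is not of the form [VInl _] counts as false, but a program cannot
   branch on it unless it is of the form [VInr _].  Elements are dropped one by
   one as long as no request is lost; one that cannot be dropped was in the set.
   The accumulator is (bits known so far, (remaining raw list, cost)). *)
Definition pruneP :=
  Let (Fold (Un Fst (Var 14)) (Fork Nil (Fork (Var 0) Zero))
    (Let (Un Snd (Seq (Un Fst (Un Snd (Var 1))) (Case (Prim MkUnit) (Prim Id))))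
    (Let (Rev (Un Fst (Var 2)) (Cons FalseP (Var 0)))
    (Let (Fold (Var 8) TrueP (If (SatP 0 (Var 6)) (If (SatP 0 (Var 2)) (Var 1) FalseP) (Var 1)))
      (If (Var 0)
        (Fork (Cons FalseP (Un Fst (Var 4))) (Fork (Var 2) (Un Snd (Un Snd (Var 4)))))
        (Fork (Cons TrueP (Un Fst (Var 4)))
           (Fork (Var 2) (Op Add (Un Snd (Un Snd (Var 4))) (Var 3)))))))))
  (Fork (Rev (Un Fst (Var 0)) Nil) (Un Snd (Un Snd (Var 0)))).

Definition pc_instanceP :=
  Fork (Var 13) (Fold (Var 3) Nil (Cons (Fork (eReq 0) (PenaltyP 0 (Var 3))) (Var 1))).

Definition next_timeP :=
  Fold (Var 6) Nil (If (SatP 0 (Un Fst (Var 3))) (Var 1)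
    (MinOpt (Var 1) (ReachP 0 (Op Add (MaxP (DelayP 0 (Var 6)) (ePaid 0))
                                      (Op Div (Var 12) (Var 7)))))).

(** The loop state is a time and the last accepted set. A set above the budget ends the loop with
    the old state; the absence of a next time means that the new set serves everything. *)
Definition decideP :=
  Let pruneP
  (Let (Fold (Var 5) (Un Snd (Var 0))
          (If (SatP 0 (Un Fst (Var 2))) (Var 1) (Op Add (Var 1) (PenaltyP 0 (Var 5)))))
    (If (Op Leq (Var 0) (Var 10))
       (Match next_timeP
          (Un MkInr (Fork (Up 5) (Un Fst (Var 2))))
          (Un MkInl (Fork (Fork (Up 6) (Var 0)) (Un Fst (Var 2)))))
       (Un MkInr (Up 3)))).

Definition forwardP (pc : prog) :=
  Loop (Seq (Fork (Prim Id) (Seq pc_instanceP pc)) decideP).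

Definition finishP :=
  Fold (Var 4) (Var 5) (If (SatP 0 (Var 3)) (Var 1)
    (Cons (Fork (eRef 0) (Fork (eReq 0) (Fork (Var 10)
             (Fork (MaxP (DelayP 0 (Var 4)) (ePaid 0)) (Un MkInr (Var 4)))))) (Var 1))).

Definition serviceP (pc : prog) :=
  Seq (Let (Op Add (Var 0) (Var 0)) (Let cheapP (Prim Id)))
  (Seq (Fork (Prim Id) (Seq (Var 0) (Prim (Query Send))))
  (Seq (Let keptP (Let eligibleP (Let (Count (Var 0)) (Fork (Fork (Prim Id) (Var 8)) Nil))))
  (Seq (forwardP pc)
  (Seq (Fork (Prim Id) (Seq (Var 0) (Prim (Query Send))))
    (Un MkInl (Fork (Up 11) finishP)))))).

Definition startP :=
  Seq (Fork (Prim MkUnit) (Prim Id))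
    (Let (Rev (Un Fst (Var 0)) Nil)
    (Let (Count (Un Fst (Var 1)))
      (Fork (Fork (Prim Id) (Op Defs.Sub Zero (Prim One))) Nil))).

Definition onlineP (pc : prog) :=
  Seq startP (Loop (Match candidateP waitP (serviceP pc))).

(** * Values computed by the online algorithm *)

Section Spec.
Variables (R : realType) (ND : nd_class R) (I : inst ND) (sigma : online_input I).
Local Notation val := (Defs.val R (request I)).
Local Notation fam := (@Defs.family R ND I).
Local Notation n := (nelt I).
Local Notation elt := 'I_n.
Local Notation N := (size sigma).

Definition rq (i : 'I_N) : online_request I := tnth (in_tuple sigma) i.

Definition entry : Type := ('I_N * (R * (R * option R)))%type.
Definition idx (e : entry) := e.1.
Definition level (e : entry) := e.2.1.
Definition paid (e : entry) := e.2.2.1.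
Definition timer (e : entry) := e.2.2.2.
Definition fam_of (e : entry) := fam (req (rq (idx e))).
Definition wait_cost (t : R) (e : entry) := delay (rq (idx e)) t.

Definition enc_entry (e : entry) : val :=
  VPair (VRef (idx e)) (VPair (vreq (req (rq (idx e))))
    (VPair (VNum (level e)) (VPair (VNum (paid e)) (vopt I (timer e))))).

Definition costs : seq R := [seq cost e | e <- enum elt].
Definition threshold (x : R) : {set elt} := [set e | cost e <= x].
Definition vbits (s : seq bool) : val := vlist [seq vbool _ _ b | b <- s].
Definition bits_set (s : seq bool) : {set elt} := [set e : elt | nth false s e].

(** The specifications are folds of the same shape as the programs, so that [evp_fold] applies
    directly; their meaning as sums and filters is extracted later ([partial_sumE], [keptE] and so
    on). *)
Definition partial_sum (t : R) (P : seq entry) (x : R) : R :=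
  foldl (fun acc y => if timer y is Some _ then acc
    else if level y <= x then acc + (wait_cost t y - paid y) else acc) 0 P.

Definition fires (t : R) (P : seq entry) (x : entry) : bool :=
  if timer x is Some tau then tau <= t else level x <= partial_sum t P (level x).

Definition candidate (t : R) (P : seq entry) : option R :=
  foldl (fun acc x => if fires t P x then min_opt acc (level x) else acc) None P.

Definition reach (i : 'I_N) (x : R) : R :=
  inf [set t | release (rq i) <= t /\ x <= delay (rq i) t]%classic.

Definition alarm (t : R) (P : seq entry) : option R :=
  foldl (fun acc x => min_opt acc
    (if timer x is Some tau then tau
     else reach (idx x) (wait_cost t x + level x / (size P)%:R))) None P.

(** The extra candidate 0 takes care of requests satisfied by the empty set. [None] marks a request
    that no set satisfies. *)
Definition bottleneck (q : request I) : option R :=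
  foldl (fun acc x => if threshold x \in fam q then min_opt acc x else acc) None (0 :: costs).

Definition admit_all (t : R) (P : seq entry) (s : seq 'I_N) : seq entry :=
  foldl (fun acc i => if bottleneck (req (rq i)) is Some b
                      then (i, (b, (delay (rq i) t, None))) :: acc else acc) P s.

Definition cheap (theta : R) : {set elt} := [set e | cost e * n%:R <= theta].

Definition kept (theta : R) (P : seq entry) : seq entry :=
  foldl (fun acc x => if level x <= theta then acc else x :: acc) [::] P.

Definition eligible (theta t : R) (P : seq entry) : seq entry :=
  foldl (fun acc x => if level x <= theta then
      if cheap theta \in fam_of x then acc
      else (if timer x is Some _ then x else (idx x, (level x, (wait_cost t x, None)))) :: acc
    else acc) [::] P.

(** The maximum is needed because [paid] may already cover a time later than [t], namely the timer
    of the request. *)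
Definition penalty (t : R) (x : entry) : R := Num.max (wait_cost t x) (paid x) - paid x.

Definition pc_instance (t : R) (Q : seq entry) : pc_input I :=
  foldl (fun acc x => (req (rq (idx x)), penalty t x) :: acc) [::] Q.

Definition raw_tail (v : val) : val := if v is VInr (VPair _ t) then t else VUnit.

Definition vprepend (s : seq bool) (v : val) : val :=
  foldl (fun a b => VInr (VPair (vbool _ _ b) a)) v s.

Definition prune_step (Q : seq entry) (S0 : val) (acc : seq bool * (val * R)) (c : R) :=
  let tl := raw_tail acc.2.1 in
  let S1 := vset n (vprepend acc.1 (VInr (VPair (vbool _ _ false) tl))) in
  if all (fun x => (vset n S0 \in fam_of x) ==> (S1 \in fam_of x)) Q
  then (false :: acc.1, (tl, acc.2.2)) else (true :: acc.1, (tl, acc.2.2 + c)).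

Definition prune (Q : seq entry) (S0 : val) :=
  foldl (prune_step Q S0) ([::], (S0, 0)) costs.

Definition pruned_bits Q S0 : seq bool := rev (prune Q S0).1.

Definition price (t : R) (Q : seq entry) (E : {set elt}) (c : R) : R :=
  foldl (fun acc x => if E \in fam_of x then acc else acc + penalty t x) c Q.

Definition next_time (theta t : R) (Q : seq entry) (E : {set elt}) : option R :=
  foldl (fun acc x => if E \in fam_of x then acc
    else min_opt acc (reach (idx x) (Num.max (wait_cost t x) (paid x) + theta / (size Q)%:R)))
   None Q.

Definition finish (theta t : R) (E : {set elt}) (P Q : seq entry) : seq entry :=
  foldl (fun acc x => if E \in fam_of x then acc
    else (idx x, (theta, (Num.max (wait_cost t x) (paid x), Some t))) :: acc) P Q.

End Spec.

(** * The programs compute the specified values *)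

Section Correctness.
Variables (R : realType) (ND : nd_class R) (I : inst ND) (sigma : online_input I).
Variable G : config R (request I) (world I) -> Prop.
Local Notation val := (Defs.val R (request I)).
Local Notation fam := (@Defs.family R ND I).
Local Notation n := (nelt I).
Local Notation elt := 'I_n.
Local Notation N := (size sigma).
Local Notation rq := (@rq R ND I sigma).
Local Notation entry := (entry sigma).
Local Notation enc_entry := (@enc_entry R ND I sigma).
Local Notation costs := (@costs R ND I).
Local Notation release := (@release R ND I).
Hypothesis sorted_sigma : sorted <=%R (map release sigma).

Lemma rq_nth x0 (i : 'I_N) : rq i = nth x0 sigma i.
Proof. exact: tnth_nth. Qed.

(** Release times are sorted, so the released requests form a prefix of the input. *)
Lemma nreleasedP (t : R) (i : 'I_N) : (i < nreleased sigma t)%N = (release (rq i) <= t).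
Proof.
rewrite /nreleased -(count_map release (fun x => x <= t)).
have -> : release (rq i) = nth 0 (map release sigma) i.
  by rewrite (nth_map (rq i)) // -rq_nth.
apply/idP/idP => h; first exact: (Order.POrderTheory.nth_count_le 0 sorted_sigma).
rewrite ltnNge; apply/negP => h'; move: h; apply/negP; rewrite -ltNge.
apply: (Order.TotalTheory.DualTotalTheory.nth_count_gt 0 sorted_sigma).
by rewrite h' size_map/=.
Qed.

Lemma releasedE (w : world I) (i : 'I_N) :
  release (rq i) <= now w -> released sigma w i = Some (rq i).
Proof.
rewrite -nreleasedP => hi.
rewrite /released onthE map_take nth_take// -onthE.
exact/(tnth_onth _ (in_tuple sigma)).
Qed.

Lemma zip_iota : zip (iota 0 N) sigma = [seq (nat_of_ord i, rq i) | i <- enum 'I_N].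
Proof.
have -> : [seq (nat_of_ord i, rq i) | i <- enum 'I_N] =
    zip [seq nat_of_ord i | i <- enum 'I_N] [seq rq i | i <- enum 'I_N].
  by elim: (enum 'I_N) => //= i s ->.
rewrite val_enum_ord; congr zip.
by rewrite -[LHS]/(tval (in_tuple sigma)) -[in LHS](map_tnth_enum (in_tuple sigma)).
Qed.

Definition new_requests (t t' : R) : seq 'I_N :=
  drop (nreleased sigma t) (take (nreleased sigma t') (enum 'I_N)).

Lemma arrivalsE (t t' : R) :
  arrivals sigma t t' = vlist [seq VPair (VRef (nat_of_ord i)) (vreq (req (rq i)))
                              | i <- new_requests t t'].
Proof.
by rewrite /arrivals zip_iota -map_take -map_drop -map_comp.
Qed.

Variables (K : nat) (w : world I).
Hypotheses (nK : (n < K)%N) (NK : (N <= K)%N).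
Local Notation evp := (evp sigma G K w).

Definition genv : val :=
  VPair (VPair (VPair VUnit (vinst I)) (vlist [seq VNum x | x <- rev costs]))
    (VNum n%:R).
Definition senv (t : R) (P : seq entry) : val :=
  VPair (VPair genv (VNum t)) (vlist [seq enc_entry e | e <- P]).

Definition known (e : entry) : Prop := release (rq (idx e)) <= now w.
Definition all_known (P : seq entry) : Prop := {in P, forall e, known e}.

Lemma costs_num :
  [seq VNum (cost e) | e <- enum elt] = [seq VNum x | x <- costs] :> seq val.
Proof. by rewrite /costs -map_comp. Qed.

Lemma size_costs : size costs = n.
Proof. by rewrite size_map size_enum_ord. Qed.

Lemma evp_candidate t P : all_known P -> (size P <= K)%N ->
  evp candidateP (senv t P) (vopt I (candidate t P)).
Proof.
move=> kP sP.
apply: (evp_fold_in (ee := enc_entry)) => //; try exact: evp_loop_free.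
move=> acc [i [l [h [tau|]]]] xP.
  apply: evp_match_inr; first by apply: evp_loop_free.
  apply: (@evp_if _ _ _ _ _ _ _ _ _ _ _ (tau <= t)).
    by apply: evp_loop_free.
  rewrite /fires /=; case: (tau <= t); last by apply: evp_loop_free.
  by apply: evp_min_opt; apply: evp_loop_free.
apply: evp_match_inl; first by apply: evp_loop_free.
apply: (@evp_if _ _ _ _ _ _ _ _ _ _ _ (l <= partial_sum t P l)); last first.
  rewrite /fires /=; case: (_ <= _); last by apply: evp_loop_free.
  by apply: evp_min_opt; apply: evp_loop_free.
apply: (@evp_op _ _ _ _ _ _ _ _ _ _ _ (VNum l) (VNum (partial_sum t P l))) => //;
  first by apply: evp_loop_free.
apply: (evp_fold_in (ea := VNum) (ee := enc_entry)) => //; try exact: evp_loop_free.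
  by apply: evp_loop_free => //=; rewrite subrr.
move=> s [j [l' [h' [tau|]]]] /kP; rewrite /known /idx /= => /releasedE kj.
  by apply: evp_loop_free.
by apply: evp_loop_free => //=; case: (_ <= _) => //=; rewrite kj.
Qed.

Lemma evp_leq a b r x y : evp a r (VNum x) -> evp b r (VNum y) ->
  evp (Op Leq a b) r (vbool _ _ (x <= y)).
Proof. by move=> ha hb; apply: evp_op ha hb _. Qed.

Lemma evp_add a b r x y : evp a r (VNum x) -> evp b r (VNum y) ->
  evp (Op Add a b) r (VNum (x + y)).
Proof. by move=> ha hb; apply: evp_op ha hb _. Qed.

Lemma evp_max a b r x y : evp a r (VNum x) -> evp b r (VNum y) ->
  evp (MaxP a b) r (VNum (Num.max x y)).
Proof.
move=> ha hb; apply: evp_if; first exact: evp_leq ha hb.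
by rewrite maxEle; case: (x <= y).
Qed.

Lemma evp_delay a b r (i : 'I_N) t : release (rq i) <= now w ->
  evp a r (VRef i) -> evp b r (VNum t) ->
  evp (Op (Query Delay) a b) r (VNum (delay (rq i) t)).
Proof. by move=> /releasedE hi ha hb; apply: evp_op ha hb _ => //=; rewrite hi. Qed.

Lemma evp_reach a b r (i : 'I_N) t : release (rq i) <= now w ->
  evp a r (VRef i) -> evp b r (VNum t) ->
  evp (Op (Query Reach) a b) r (VNum (reach i t)).
Proof. by move=> /releasedE hi ha hb; apply: evp_op ha hb _ => //=; rewrite hi. Qed.

Lemma evp_sat a b r q v : evp a r (VTok q) -> evp b r v ->
  evp (Op Sat a b) r (vbool _ _ (vset n v \in fam q)).
Proof. by move=> ha hb; apply: evp_op ha hb _. Qed.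

Lemma evp_penalty i b r e t : known e -> evp (Var i) r (enc_entry e) ->
  evp b r (VNum t) -> evp (PenaltyP i b) r (VNum (penalty t e)).
Proof.
move=> ke he hb; have hp : evp (ePaid i) r (VNum (paid e)).
  apply: (evp_un (x := VPair (VNum (paid e)) (vopt I (timer e)))) => //.
  apply: (evp_un (x := VPair (VNum (level e)) (VPair (VNum (paid e)) (vopt I (timer e))))) => //.
  apply: (evp_un (x := VPair (vreq (req (rq (idx e))))
    (VPair (VNum (level e)) (VPair (VNum (paid e)) (vopt I (timer e)))))) => //.
  exact: evp_un he _.
apply: (evp_op (x := VNum (Num.max (wait_cost t e) (paid e)))) (hp) _ => //.
apply: evp_max hp; apply: evp_delay hb => //; exact: evp_un he _.
Qed.

Lemma vset_vbits s : vset n (vbits I s) = bits_set I s.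
Proof.
apply/setP => i; rewrite !inE.
have -> : vseq (vbits I s) = [seq vbool _ _ b | b <- s].
  by rewrite /vbits; elim: s => //= b s ->.
case: (ltnP i (size s)) => hi; last by rewrite !nth_default ?size_map.
by rewrite (nth_map false)//; case: nth.
Qed.

Lemma bits_set_costs (f : R -> bool) :
  bits_set I [seq f x | x <- costs] = [set e | f (cost e)].
Proof.
apply/setP => i; rewrite !inE (nth_map 0) ?size_costs//.
by rewrite /costs (nth_map i) ?size_enum_ord// nth_ord_enum.
Qed.

Lemma foldl_cons_map (A B : Type) (f : A -> B) a s :
  foldl (fun acc x => f x :: acc) a s = rev (map f s) ++ a.
Proof. by elim: s a => //= x s IH a; rewrite IH rev_cons cat_rcons. Qed.

(* The costs are listed in reverse because folding reverses. *)
Lemma evp_thresholds l f r (g : R -> bool) : evp l r (vlist [seq VNum x | x <- rev costs]) ->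
  (forall acc x, evp f (VPair (VPair r (vbits I acc)) (VNum x)) (vbits I (g x :: acc))) ->
  evp (Fold l Nil f) r (vbits I [seq g x | x <- costs]).
Proof.
move=> hl hf; rewrite -[map _ _]cats0 -[map _ _]revK -map_rev -foldl_cons_map.
apply: (evp_fold_in (ea := @vbits R ND I) (ee := VNum)) => //.
  exact: evp_loop_free.
by rewrite size_rev size_costs ltnW.
Qed.

Lemma evp_count l r (E : eqType) (ee : E -> val) s :
  evp l r (vlist [seq ee x | x <- s]) -> (size s <= K)%N ->
  evp (Count l) r (VNum (size s)%:R).
Proof.
move=> hl hs; have -> : (size s)%:R = foldl (fun acc _ => acc + 1) (0 : R) s.
  rewrite -[LHS]addr0; elim: {hl hs} s (0 : R) => [|x s IH] a /=; first by rewrite add0r.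
  by rewrite -IH -natr1 addrAC addrA.
apply: (evp_fold_in (ea := VNum) (ee := ee)) => //.
by apply: evp_loop_free => //=; rewrite subrr.
by move=> acc x _; apply: evp_loop_free.
Qed.

Lemma evp_alarm t P : all_known P -> (size P <= K)%N ->
  evp alarmP (senv t P) (if alarm t P is Some a then VInl (VNum a) else VInr VUnit).
Proof.
move=> kP sP.
suff h : evp (Let (Count (Var 0)) (Fold (Var 1) Nil (Match (eTimer 0)
      (MinOpt (Var 2) (ReachP 1 (Op Add (DelayP 1 (Var 5)) (Op Div (eLev 1) (Var 3)))))
      (MinOpt (Var 2) (Var 0))))) (senv t P) (vopt I (alarm t P)).
  case: (alarm t P) h => [a|] h; [apply: evp_match_inr h _|apply: evp_match_inl h _];
    exact: evp_loop_free.
apply: evp_let.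
  by apply: (evp_count (ee := enc_entry) (s := P)) => //; apply: evp_loop_free.
apply: (evp_fold_in (ee := enc_entry)) => //; try exact: evp_loop_free.
move=> acc [i [l [h [tau|]]]] /kP ke.
  apply: evp_match_inr; first exact: evp_loop_free.
  by apply: evp_min_opt; apply: evp_loop_free.
apply: evp_match_inl; first exact: evp_loop_free.
apply: evp_min_opt; first exact: evp_loop_free.
apply: evp_reach; [exact: ke|exact: evp_loop_free|].
apply: evp_add; last exact: evp_loop_free.
by apply: evp_delay; [exact: ke|exact: evp_loop_free|exact: evp_loop_free].
Qed.

(* [ra] is the environment in which a newly arrived request is examined. *)
Lemma evp_bottleneck (x y z : val) t P (q : request I) :
  let ra := VPair (VPair (VPair (senv t P) x) y) (VPair z (vreq q)) in
  evp bottleneckP ra (vopt I (bottleneck q)).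
Proof.
move=> ra; have -> : vopt I (bottleneck q) = vopt I (foldl (fun acc c => if
   threshold I c \in fam q then min_opt acc c else acc) None (0 :: costs)) by [].
apply: (evp_fold_in (ee := VNum)) => //.
- apply: (evp_cons (s := [seq VNum x | x <- costs])); first by apply: evp_loop_free => //=; rewrite subrr.
  by apply: evp_loop_free => //; rewrite -[RHS]/(vlist [seq VNum x | x <- costs]) /costs -map_comp.
- exact: evp_loop_free.
- by rewrite /= size_costs.
move=> acc c _; apply: (@evp_if _ _ _ _ _ _ _ _ _ _ _ (threshold I c \in fam q)).
  have -> : threshold I c = vset n (vbits I [seq x <= c | x <- costs]).
    by rewrite vset_vbits bits_set_costs.
  apply: evp_sat; first exact: evp_loop_free.
  apply: (evp_thresholds (g := fun x => x <= c)); first exact: evp_loop_free.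
  by move=> s c'; apply: evp_loop_free.
case: (_ \in _); last exact: evp_loop_free.
by apply: evp_min_opt; exact: evp_loop_free.
Qed.

Lemma evp_admit t t' P s : {in s, forall i, release (rq i) <= now w} -> (size s <= K)%N ->
  evp admitP (VPair (senv t P)
     (VPair (VNum t') (vlist [seq VPair (VRef (nat_of_ord i)) (vreq (req (rq i))) | i <- s])))
   (vlist [seq enc_entry e | e <- admit_all t' P s]).
Proof.
move=> ks hs.
apply: (evp_fold_in (ea := fun P => vlist [seq enc_entry e | e <- P])
  (ee := fun i : 'I_N => VPair (VRef (nat_of_ord i)) (vreq (req (rq i))))) => //;
  try exact: evp_loop_free.
move=> acc i /ks ki; have := evp_bottleneck (VPair (VNum t')
  (vlist [seq VPair (VRef (nat_of_ord i)) (vreq (req (rq i))) | i <- s]))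
  (vlist [seq enc_entry e | e <- acc]) (VRef i) t P (req (rq i)).
case: (bottleneck _) => [b|] hb.
  apply: evp_match_inr hb _; rewrite /= -/(enc_entry _).
  apply: evp_cons; last exact: evp_loop_free.
  apply: evp_fork; first exact: evp_loop_free.
  apply: evp_fork; first exact: evp_loop_free.
  apply: evp_fork; first exact: evp_loop_free.
  apply: evp_fork; last exact: evp_loop_free.
  by apply: evp_delay => //; apply: evp_loop_free.
by apply: evp_match_inl hb _; apply: evp_loop_free.
Qed.

Definition lenv t P L : val := VPair (senv t P) (VNum L).
Definition cenv t P L : val :=
  VPair (VPair (lenv t P L) (VNum (L + L))) (vbits I [seq c * n%:R <= L + L | c <- costs]).

Lemma evp_cheap t P L :
  evp (Let (Op Add (Var 0) (Var 0)) (Let cheapP (Prim Id))) (lenv t P L) (cenv t P L).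
Proof.
apply: evp_let; first by apply: evp_loop_free.
apply: evp_let; last exact: evp_loop_free.
apply: (evp_thresholds (g := fun x => x * n%:R <= L + L)); first exact: evp_loop_free.
by move=> s c'; apply: evp_loop_free.
Qed.

Lemma vset_cheap theta :
  vset n (vbits I [seq c * n%:R <= theta | c <- costs]) = cheap I theta.
Proof. by rewrite vset_vbits (bits_set_costs (fun c => c * n%:R <= theta)). Qed.

Definition qenv t P L theta (u e0 k : val) Q : val :=
  VPair (VPair (VPair (VPair (VPair (VPair (VPair (lenv t P L) (VNum theta)) e0) u) k)
    (vlist [seq enc_entry e | e <- Q])) (VNum (size Q)%:R)) (VNum t).
Definition fenv t P L theta u e0 k Q tau (s : val) : val :=
  match qenv t P L theta u e0 k Q with
  | VPair r _ => VPair (VPair r (VNum tau)) s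
  | _ => VUnit end.

Lemma evp_split t P L u : all_known P -> (size P <= K)%N ->
  let theta := L + L in
  let e0 := vbits I [seq c * n%:R <= theta | c <- costs] in
  evp (Let keptP (Let eligibleP (Let (Count (Var 0)) (Fork (Fork (Prim Id) (Var 8)) Nil))))
    (VPair (cenv t P L) u)
    (fenv t P L theta u e0 (vlist [seq enc_entry e | e <- kept theta P])
       (eligible theta t P) t (VInl VUnit)).
Proof.
move=> kP sP theta e0.
apply: (evp_let (x := vlist [seq enc_entry e | e <- kept theta P])).
  apply: (evp_fold_in (ea := fun P => vlist [seq enc_entry e | e <- P])
    (ee := enc_entry) (s := P)) => //; try exact: evp_loop_free.
  move=> acc [i [l [h tm]]] xP; apply: (evp_if (t := l <= theta)); first exact: evp_loop_free.
  by rewrite /level /=; case: (l <= theta); apply: evp_loop_free.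
apply: (evp_let (x := vlist [seq enc_entry e | e <- eligible theta t P])).
  apply: (evp_fold_in (ea := fun P => vlist [seq enc_entry e | e <- P])
    (ee := enc_entry) (s := P)) => //; try exact: evp_loop_free.
  move=> acc [i [l [h tm]]] /kP kx; apply: (evp_if (t := l <= theta)); first exact: evp_loop_free.
  rewrite /level /=; case: (l <= theta); last exact: evp_loop_free.
  apply: (evp_if (t := vset n e0 \in fam_of (i, (l, (h, tm)))));
    first exact: evp_loop_free.
  rewrite vset_cheap; case: (cheap I theta \in _); first exact: evp_loop_free.
  case: tm kx => [tau|] kx; first by apply: evp_match_inr; apply: evp_loop_free.
  apply: evp_match_inl; first exact: evp_loop_free.
  apply: evp_cons; last exact: evp_loop_free.
  apply: evp_fork; first exact: evp_loop_free.
  apply: evp_fork; first exact: evp_loop_free.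
  apply: evp_fork; first exact: evp_loop_free.
  apply: evp_fork; last exact: evp_loop_free.
  by apply: evp_delay; [exact: kx|apply: evp_loop_free|apply: evp_loop_free].
apply: (evp_let (x := VNum (size (eligible theta t P))%:R)); last exact: evp_loop_free.
apply: (evp_count (ee := enc_entry) (s := eligible theta t P)); first exact: evp_loop_free.
apply: leq_trans sP; rewrite /eligible -[X in (_ <= X)%N]addn0 -[X in (_ <= _ + X)%N]/(size ([::] : seq entry)).
elim: P [::] {kP} => [|[i [l [h tm]]] P IH] a //=.
apply: leq_trans (IH _) _; rewrite addSnnS leq_add2l.
by case: ifP => // _; case: ifP.
Qed.

Section Forward.
Variables (t L theta : R) (u e0 k : val) (P Q : seq entry).
Hypotheses (kQ : all_known Q) (sQ : (size Q <= K)%N).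
Local Notation fe := (fenv t P L theta u e0 k Q).

Lemma evp_pc_instance tau s :
  evp pc_instanceP (fe tau s) (pc_encode (pc_instance tau Q)).
Proof.
apply: evp_fork; first exact: evp_loop_free.
apply: (evp_fold_in (ea := fun Q : pc_input I =>
  vlist [seq VPair (vreq qp.1) (VNum qp.2) | qp <- Q]) (ee := enc_entry) (s := Q)) => //;
  try exact: evp_loop_free.
move=> acc x /kQ kx; apply: evp_cons; last exact: evp_loop_free.
apply: evp_fork; first exact: evp_loop_free.
by apply: evp_penalty => //; apply: evp_loop_free.
Qed.

Definition enc_prune (acc : seq bool * (val * R)) : val :=
  VPair (vbits I acc.1) (VPair acc.2.1 (VNum acc.2.2)).

Lemma evp_prune tau s S0 :
  evp pruneP (VPair (fe tau s) S0)
    (VPair (vbits I (pruned_bits Q S0)) (VNum (prune Q S0).2.2)).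
Proof.
apply: (evp_let (x := enc_prune (prune Q S0))); last first.
  apply: evp_fork; last exact: evp_loop_free.
  have -> : vbits I (pruned_bits Q S0) =
      vbits I (foldl (fun acc b => b :: acc) [::] (prune Q S0).1).
    by rewrite (foldl_cons_map id) map_id cats0.
  apply: (evp_fold_in (ea := @vbits R ND I) (ee := vbool _ _)) => //;
    try exact: evp_loop_free.
    2: by move=> acc x _; exact: evp_loop_free.
  suff -> : size (prune Q S0).1 = n by exact: ltnW.
  rewrite -size_costs -[RHS]addn0 /prune.
  have h cs (acc : seq bool * (val * R)) :
      size (foldl (prune_step Q S0) acc cs).1 = (size cs + size acc.1)%N.
    elim: cs acc => //= c cs IH acc; rewrite IH addSnnS; congr addn.
    by rewrite /prune_step; case: ifP.
  exact: h.
(* The invariant keeps the number of known bits below [n], so that copying them fits into the bound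
   [K] on list lengths. *)
apply: (evp_fold (ea := enc_prune) (ee := VNum) (g := prune_step Q S0)
  (a0 := ([::], (S0, 0))) (s := costs)
  (J := fun r (acc : seq bool * (val * R)) => (size acc.1 + size r = n)%N)) => //.
- by apply: evp_loop_free => //; rewrite -costs_num.
- by apply: evp_loop_free => //=; rewrite subrr.
- by rewrite size_costs ltnW.
- exact: size_costs.
move=> [done [rest sum]] c r /= sr; split; last first.
  by rewrite -sr /prune_step addnS -addSn; case: ifP.
apply: (evp_let (x := raw_tail rest)).
  by apply: evp_loop_free => //=; case: rest => // -[].
set S1 := vprepend done (VInr (VPair (vbool _ _ false) (raw_tail rest))).
apply: (evp_let (x := S1)).
  apply: (evp_fold_in (ea := id) (ee := vbool _ _)); try exact: evp_loop_free.
    by rewrite (leq_trans _ (ltnW nK))// -sr leq_addr.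
  by move=> acc x _; apply: evp_loop_free.
rewrite /prune_step /= -/S1; set b := all _ _.
apply: (evp_let (x := vbool _ _ b)).
  have -> : b = foldl (fun acc x => if vset n S0 \in fam_of x
     then (if vset n S1 \in fam_of x then acc else false) else acc) true Q.
    rewrite -[LHS]andTb {}/b; elim: (Q) true => [|x Q' IH] a /=; first by rewrite andbT.
    by rewrite -IH andbA; case: (_ \in _) (_ \in _) => -[]; rewrite /= ?andbT ?andbF.
  apply: (evp_fold_in (ea := vbool _ _) (ee := enc_entry)) => //;
    try exact: evp_loop_free.
  move=> acc x _.
  apply: (evp_if (t := vset n S0 \in fam_of x)); first exact: evp_loop_free.
  case: (vset n S0 \in _); last exact: evp_loop_free.
  apply: (evp_if (t := vset n S1 \in fam_of x)); first exact: evp_loop_free.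
  by case: (vset n S1 \in _); exact: evp_loop_free.
apply: (evp_if (t := b)); first exact: evp_loop_free.
by case: b; exact: evp_loop_free.
Qed.

Lemma evp_decide tau s S0 :
  let bs := pruned_bits Q S0 in let E := bits_set I bs in
  evp decideP (VPair (fe tau s) S0)
    (if price tau Q E (prune Q S0).2.2 <= theta
     then if next_time theta tau Q E is Some tau' then VInl (fe tau' (vbits I bs))
          else VInr (fe tau (vbits I bs))
     else VInr (fe tau s)).
Proof.
move=> bs E; apply: evp_let; first exact: evp_prune.
apply: (evp_let (x := VNum (price tau Q E (prune Q S0).2.2))).
  apply: (evp_fold_in (ea := VNum) (ee := enc_entry)) => //; try exact: evp_loop_free.
  move=> acc x /kQ kx.
  apply: (evp_if (t := E \in fam_of x)).
    by apply: evp_loop_free => //=; rewrite vset_vbits.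
  case: (E \in _); first exact: evp_loop_free.
  apply: evp_add; first exact: evp_loop_free.
  by apply: evp_penalty => //; apply: evp_loop_free.
apply: (evp_if (t := price tau Q E (prune Q S0).2.2 <= theta)); first exact: evp_loop_free.
case: (_ <= theta); last exact: evp_loop_free.
set r := VPair _ _; have h : evp next_timeP r (vopt I (next_time theta tau Q E)).
  apply: (evp_fold_in (ee := enc_entry)) => //; try exact: evp_loop_free.
  move=> acc x /kQ kx.
  apply: (evp_if (t := E \in fam_of x)).
    by apply: evp_loop_free => //=; rewrite vset_vbits.
  case: (E \in _); first exact: evp_loop_free.
  apply: evp_min_opt; first exact: evp_loop_free.
  apply: evp_reach => //; first exact: evp_loop_free.
  apply: evp_add; last exact: evp_loop_free.
  apply: evp_max; last exact: evp_loop_free.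
  by apply: evp_delay => //; exact: evp_loop_free.
case: (next_time theta tau Q E) h => [tau'|] h; [apply: evp_match_inr h _|apply: evp_match_inl h _];
  exact: evp_loop_free.
Qed.

Lemma evp_finish tau s keep v : k = vlist [seq enc_entry e | e <- keep] ->
  evp (Un MkInl (Fork (Up 11) finishP)) (VPair (fe tau (vbits I s)) v)
    (VInl (senv t (finish theta tau (bits_set I s) keep Q))).
Proof.
move=> hk; apply: evp_un => //; apply: evp_fork; first exact: evp_loop_free.
apply: (evp_fold_in (ea := fun P => vlist [seq enc_entry e | e <- P])
    (ee := enc_entry)) => //; try exact: evp_loop_free.
move=> acc x /kQ kx.
apply: (evp_if (t := bits_set I s \in fam_of x)).
  by apply: evp_loop_free => //=; rewrite vset_vbits.
case: (bits_set I s \in _); first exact: evp_loop_free.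
apply: evp_cons; last exact: evp_loop_free.
apply: evp_fork; first exact: evp_loop_free.
apply: evp_fork; first exact: evp_loop_free.
apply: evp_fork; first exact: evp_loop_free.
apply: evp_fork; last exact: evp_loop_free.
apply: evp_max; last exact: evp_loop_free.
by apply: evp_delay => //; exact: evp_loop_free.
Qed.

End Forward.

Lemma evp_start : evp startP (vinst I) (senv (-1) [::]).
Proof.
apply: (evp_seq (u := VPair VUnit (vinst I))); first exact: evp_loop_free.
apply: (evp_let (x := vlist [seq VNum x | x <- rev costs])).
  have -> : rev costs = foldl (fun acc x => x :: acc) [::] costs.
    by rewrite (foldl_cons_map id) map_id cats0.
  apply: (evp_fold_in (ea := fun s => vlist [seq VNum x | x <- s]) (ee := VNum)) => //;
    try exact: evp_loop_free.
    by apply: evp_loop_free => //; rewrite -costs_num.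
    by rewrite size_costs ltnW.
  by move=> acc x _; exact: evp_loop_free.
apply: (evp_let (x := VNum n%:R)).
  rewrite -size_costs; apply: (evp_count (ee := VNum)); last by rewrite size_costs ltnW.
  by apply: evp_loop_free => //; rewrite -costs_num.
by apply: evp_loop_free => //=; rewrite subrr sub0r.
Qed.

End Correctness.

(** * Folds as sums, filters and minima *)

Section FoldLemmas.

Lemma foldl_cond_cons (A B : Type) (p : pred A) (f : A -> B) a s :
  foldl (fun acc x => if p x then f x :: acc else acc) a s = rev [seq f x | x <- s & p x] ++ a.
Proof.
elim: s a => //= x s IH a; rewrite IH; case: (p x) => //=.
by rewrite rev_cons cat_rcons.
Qed.

Lemma foldl_cond_add (R : realType) (A : Type) (p : pred A) (f : A -> R) a s :
  foldl (fun acc x => if p x then acc + f x else acc) a s = a + \sum_(x <- s | p x) f x.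
Proof.
elim: s a => [a|x s IH a] /=; first by rewrite big_nil addr0.
by rewrite IH big_cons; case: (p x) => //; rewrite addrA.
Qed.

Lemma foldl_min_opt (R : realType) (E : eqType) (p : pred E) (f : E -> R) s :
  match foldl (fun acc x => if p x then min_opt acc (f x) else acc) None s with
  | None => {in s, forall x, ~~ p x}
  | Some y => (exists x, [/\ x \in s, p x & f x = y]) /\ {in s, forall x, p x -> y <= f x}
  end.
Proof.
elim/last_ind: s => [//|s x]; rewrite foldl_rcons.
case: (foldl _ _ _) => [y|] /=.
  move=> [[z [zs pz fz]] hmin]; case: ifPn => px /=.
    split.
      case: ifP => hy; first by exists z; rewrite mem_rcons inE zs orbT.
      by exists x; rewrite mem_rcons inE eqxx.
    move=> t; rewrite mem_rcons inE => /predU1P[->|ts] pt.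
      by case: ifP => //; rewrite lexx.
    case: ifP; first by move=> _; exact: hmin.
    by move=> /negbT; rewrite -ltNge => /ltW h; apply: le_trans h (hmin _ ts pt).
  split; first by exists z; rewrite mem_rcons inE zs orbT.
  move=> t; rewrite mem_rcons inE => /predU1P[->|ts] pt; last exact: hmin.
  by rewrite pt in px.
move=> hs; case: ifPn => px /=.
  split; first by exists x; rewrite mem_rcons inE eqxx.
  move=> t; rewrite mem_rcons inE => /predU1P[->//|ts] pt.
  by have := hs _ ts; rewrite pt.
by move=> t; rewrite mem_rcons inE => /predU1P[->//|ts]; exact: hs.
Qed.

End FoldLemmas.

Section SpecLemmas.
Variables (R : realType) (ND : nd_class R) (I : inst ND) (sigma : online_input I).
Local Notation val := (Defs.val R (request I)).
Local Notation fam := (@Defs.family R ND I).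
Local Notation n := (nelt I).
Local Notation elt := 'I_n.
Local Notation N := (size sigma).
Local Notation rq := (@rq R ND I sigma).
Local Notation entry := (entry sigma).
Local Notation costs := (@costs R ND I).
Local Notation release := (@release R ND I).
Implicit Types (P Q : seq entry) (e x y : entry) (E : {set elt}).

Definition fresh x := ~~ isSome (timer x).

Lemma partial_sumE t P z :
  partial_sum t P z = \sum_(y <- P | fresh y && (level y <= z)) (wait_cost t y - paid y).
Proof.
rewrite -[RHS]add0r -foldl_cond_add; congr foldl; apply/funext => acc; apply/funext => y.
by rewrite /fresh; case: (timer y).
Qed.

Lemma candidate_spec t P :
  match candidate t P with
  | None => {in P, forall x, ~~ fires t P x}
  | Some L => (exists x, [/\ x \in P, fires t P x & level x = L]) /\
              {in P, forall x, fires t P x -> L <= level x}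
  end.
Proof. exact: foldl_min_opt. Qed.

Lemma keptE theta P : kept theta P = rev [seq x <- P | theta < level x].
Proof.
rewrite -[RHS]cats0 -[in RHS](map_id [seq x <- P | _]) -foldl_cond_cons.
congr foldl; apply/funext => acc; apply/funext => y.
by rewrite ltNge; case: ifP.
Qed.

Definition refresh t x : entry :=
  if timer x is Some _ then x else (idx x, (level x, (wait_cost t x, None))).

Definition is_eligible theta x := (level x <= theta) && (cheap I theta \notin fam_of x).

Lemma eligibleE theta t P :
  eligible theta t P = rev [seq refresh t x | x <- P & is_eligible theta x].
Proof.
rewrite -[RHS]cats0 -foldl_cond_cons.
congr foldl; apply/funext => acc; apply/funext => y.
by rewrite /is_eligible; case: (_ <= theta) => //=; case: (_ \in _).
Qed.

Lemma finishE theta t E P Q :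
  finish theta t E P Q =
  rev [seq (idx x, (theta, (Num.max (wait_cost t x) (paid x), Some t))) : entry
      | x <- Q & E \notin fam_of x] ++ P.
Proof.
rewrite -foldl_cond_cons; congr foldl; apply/funext => acc; apply/funext => y.
by case: (_ \in _).
Qed.

Lemma admit_allE t P s :
  admit_all t P s =
  rev [seq (i, (odflt 0 (bottleneck (req (rq i))), (delay (rq i) t, None))) : entry
      | i <- s & isSome (bottleneck (req (rq i)))] ++ P.
Proof.
rewrite -foldl_cond_cons; congr foldl; apply/funext => acc; apply/funext => i.
by case: (bottleneck _).
Qed.

Lemma priceE t Q E c :
  price t Q E c = c + \sum_(x <- Q | E \notin fam_of x) penalty t x.
Proof.
rewrite -foldl_cond_add; congr foldl; apply/funext => acc; apply/funext => i.
by case: (_ \in _).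
Qed.

Lemma next_time_spec theta t Q E :
  let f x := reach (idx x) (Num.max (wait_cost t x) (paid x) + theta / (size Q)%:R) in
  match next_time theta t Q E with
  | None => {in Q, forall x, E \in fam_of x}
  | Some y => (exists x, [/\ x \in Q, E \notin fam_of x & f x = y]) /\
              {in Q, forall x, E \notin fam_of x -> y <= f x}
  end.
Proof.
move=> f; have := foldl_min_opt (fun x => E \notin fam_of x) f Q.
rewrite (_ : (fun acc x => _) = (fun acc x => if E \in fam_of x then acc
  else min_opt acc (f x))); last first.
  by apply/funext => acc; apply/funext => i; case: (_ \in _).
rewrite -[foldl _ _ _]/(next_time theta t Q E).
by case: (next_time _ _ _ _) => // h x /h; rewrite negbK.
Qed.

Lemma alarm_spec t P :
  let f x := if timer x is Some tau then tau
             else reach (idx x) (wait_cost t x + level x / (size P)%:R) in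
  match alarm t P with
  | None => P = [::]
  | Some y => (exists x, [/\ x \in P & f x = y]) /\ {in P, forall x, y <= f x}
  end.
Proof.
move=> f; have := foldl_min_opt xpredT f P.
rewrite -[foldl _ _ _]/(alarm t P); case: (alarm t P) => [y [[x [xP _ fx]] h]|h].
  by split; [exists x|move=> z zP; apply: h].
by case: P {f} h => // x P /(_ x); rewrite inE eqxx => /(_ isT).
Qed.

Lemma cost_in_costs (e : elt) : cost e \in costs.
Proof. by apply/mapP; exists e; rewrite ?mem_enum. Qed.

(** A satisfying set lies below the threshold of its most expensive element, so that element's cost
    competes in the minimum; for the empty set 0 does. *)
Lemma bottleneck_spec (q : request I) :
  match bottleneck q with
  | None => forall E, E \notin fam q
  | Some b => [/\ 0 <= b, threshold I b \in fam q
       & forall E, E \in fam q -> b = 0 \/ exists2 e, e \in E & b <= cost e]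
  end.
Proof.
have := foldl_min_opt (fun x : R => threshold I x \in fam q) (fun x : R => x) (0 :: costs).
rewrite -[foldl _ _ _]/(bottleneck q).
have hE E : E \in fam q -> exists x : R, [/\ x \in 0 :: costs, threshold I x \in fam q
    & x = 0 \/ exists2 e, e \in E & x = cost e].
  move=> Eq; have [E0|/finset.set0Pn[e0 e0E]] := eqVneq E finset.set0.
    exists 0; split; [by rewrite inE eqxx| |by left].
    by apply: family_up Eq; rewrite E0 finset.sub0set.
  case: (@Order.TotalTheory.arg_maxP _ _ _ e0 (mem E) (@cost _ _ I) e0E) => e eE emax.
  exists (cost e); split; [by rewrite inE cost_in_costs orbT| |by right; exists e].
  by apply: family_up Eq; apply/fintype.subsetP => e' /emax; rewrite inE.
have ge0 (x : R) : x \in 0 :: costs -> 0 <= x.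
  by rewrite inE => /predU1P[->//|/mapP[e _ ->]]; exact: cost_ge0.
case: (bottleneck q) => [b|] h.
  have [[x [xin xq xb]] hb] := h; rewrite -{}xb in hb *.
  split; [exact: ge0|by []|move=> E /hE[y [yin yq hy]]].
  have := hb _ yin yq => {}hb; case: hy => [y0|[e eE ye]].
    by left; apply/eqP; rewrite eq_le ge0// -y0 hb.
  by right; exists e => //; rewrite -ye.
by move=> E; apply/negP => /hE[x [/h + xq]]; rewrite xq.
Qed.

Lemma pc_cost_instance t Q E :
  pc_cost (pc_instance t Q) E = set_cost E + \sum_(x <- Q | E \notin fam_of x) penalty t x.
Proof.
rewrite /pc_cost; congr (_ + _).
have -> : pc_instance t Q = rev [seq (req (rq (idx x)), penalty t x) | x <- Q].
  by rewrite -[RHS]cats0 -(foldl_cons_map (fun x => (req (rq (idx x)), penalty t x))).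
by rewrite big_rev/= big_map.
Qed.

Lemma penalty_ge0 t x : 0 <= penalty t x.
Proof. by rewrite subr_ge0 le_max lexx orbT. Qed.

Lemma pc_valid_instance t Q : pc_valid (pc_instance t Q).
Proof.
apply/(@all_tnthP _ _ (fun qp : request I * R => 0 <= qp.2)).
rewrite /= /pc_instance; have : all (fun qp : request I * R => 0 <= qp.2) [::] by [].
elim: Q ([::] : pc_input I) => [//|x Q IH] a ha /=.
by apply: IH; rewrite /= penalty_ge0.
Qed.

Lemma set_cost_ge0 E : 0 <= set_cost E.
Proof. by apply: sumr_ge0 => e _; exact: cost_ge0. Qed.

Lemma vseq_raw_tail (v : val) : vseq (raw_tail v) = behead (vseq v).
Proof. by case: v => // -[]. Qed.

Lemma vseq_prepend s (v : val) : vseq (vprepend s v) = [seq vbool _ _ b | b <- rev s] ++ vseq v.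
Proof.
by elim: s v => //= b s IH v; rewrite IH rev_cons map_rcons cat_rcons.
Qed.

Lemma prune_correct Q (S0 : val) :
  let E := bits_set I (pruned_bits Q S0) in
  [/\ E \subset vset n S0,
      {in Q, forall x, vset n S0 \in fam_of x -> E \in fam_of x}
    & (prune Q S0).2.2 = set_cost E].
Proof.
(* [mix a] is the set described by the bits known so far and the raw rest. *)
pose mix (a : seq bool * (val * R)) := vset n (vprepend a.1 a.2.1).
pose inv (k : nat) (a : seq bool * (val * R)) :=
  [/\ size a.1 = k, mix a \subset vset n S0,
     {in Q, forall x, vset n S0 \in fam_of x -> mix a \in fam_of x}
   & a.2.2 = \sum_(e : elt | (e < k)%N && (nth false (rev a.1) e)) cost e].
have mixE a (e : elt) : (e \in mix a) = if (e < size a.1)%N then nth false (rev a.1) e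
    else vtrue (nth VUnit (vseq a.2.1) (e - size a.1)).
  rewrite /mix inE vseq_prepend nth_cat size_map size_rev; case: ifP => // he.
  by rewrite (nth_map false) ?size_rev//; case: nth.
have step k a (hk : (k < n)%N) : inv k a -> inv k.+1 (prune_step Q S0 a (cost (Ordinal hk))).
  move=> [sa sub sat sumE]; rewrite /prune_step.
  set S1 := vset n (vprepend _ _); set b := all _ _.
  pose a' c := ((~~ c) :: a.1, (raw_tail a.2.1,
     if c then a.2.2 else a.2.2 + cost (Ordinal hk))).
  have -> : (if b then (false :: a.1, (raw_tail a.2.1, a.2.2))
     else (true :: a.1, (raw_tail a.2.1, a.2.2 + cost (Ordinal hk)))) = a' b.
    by rewrite /a'; case: b.
  have S1E : S1 = mix (a' true) by [].
  have S1sub : S1 \subset mix a.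
    apply/fintype.subsetP => e; rewrite S1E !mixE /= sa ltnS rev_cons nth_rcons size_rev sa.
    case: ltngtP => // he.
    by rewrite vseq_raw_tail nth_behead subnS prednK ?subn_gt0.
  have a'sub : mix (a' b) = if b then S1 else mix a.
    case hb: b; first by rewrite S1E.
    apply/setP => e; rewrite !mixE /= sa ltnS rev_cons nth_rcons size_rev sa.
    case: ltngtP => // he; first by rewrite vseq_raw_tail nth_behead subnS prednK ?subn_gt0.
    (* If the raw bit of an undroppable element were false, [S1] would equal [mix a], and the test
       would have succeeded. *)
    rewrite he subnn; apply/esym; apply: contraFT hb => hm.
    have S1a : S1 = mix a.
      apply/eqP; rewrite finset.eqEsubset S1sub; apply/fintype.subsetP => e' he'.
      move: (he'); rewrite S1E !mixE /= sa ltnS rev_cons nth_rcons size_rev sa.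
      case: ltngtP => // he1; first by rewrite vseq_raw_tail nth_behead subnS prednK ?subn_gt0.
      by rewrite he1 subnn (negbTE hm).
    by apply/allP => x xQ; apply/implyP => hx; rewrite -/S1 S1a; exact: sat.
  split; rewrite ?a'sub.
  - by rewrite /= sa.
  - by case: ifP => // _; apply: fintype.subset_trans sub.
  - case: ifP => // hb x xQ hx.
    by move/allP: hb => /(_ _ xQ); rewrite hx.
  - rewrite /= [RHS](bigID (fun e : elt => (e < k)%N)) /=.
    have -> : \sum_(e : elt | ((e < k.+1)%N && nth false (rev (~~ b :: a.1)) e) && (e < k)%N)
        cost e = a.2.2.
      rewrite sumE; apply: eq_bigl => e; rewrite rev_cons nth_rcons size_rev sa.
      by case: (ltnP e k) => he; rewrite ?andbF ?andbT//= ltnS ltnW.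
    have -> : \sum_(e : elt | ((e < k.+1)%N && nth false (rev (~~ b :: a.1)) e) && ~~ (e < k)%N)
        cost e = if b then 0 else cost (Ordinal hk).
      rewrite (eq_bigl (fun e : elt => (e == Ordinal hk) && ~~ b)); last first.
        move=> e; rewrite rev_cons nth_rcons size_rev sa ltnS -val_eqE /=.
        by case: ltngtP => //= _; rewrite ?andbF ?andbT.
      case: (b); first by rewrite big_pred0// => e; rewrite andbF.
      by rewrite (eq_bigl (pred1 (Ordinal hk))) ?big_pred1_eq// => e; rewrite andbT.
    by case: (b); rewrite ?addr0.
have : inv n (prune Q S0).
  have inv0 : inv 0%N ([::], (S0, 0)) by split => //=; rewrite big_pred0.
  rewrite /prune /costs; have := inv0; rewrite -{1}(subnn n).
  suff h m (a : seq bool * (val * R)) s : (m <= n)%N -> s = drop (n - m) (enum elt) ->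
      inv (n - m)%N a -> inv n (foldl (prune_step Q S0) a [seq cost e | e : elt <- s]).
    by apply: (h n); rewrite // subnn drop0.
  elim: m a s => [|m IH] a s hm ->; first by rewrite subn0 drop_oversize ?size_enum_ord.
  have hk : (n - m.+1 < n)%N by rewrite ltn_subrL (leq_trans _ hm).
  rewrite (drop_nth (Ordinal hk)) ?size_enum_ord//= => /step h.
  rewrite subnSK//; apply: IH => //; first exact: ltnW.
  have := h hk; rewrite subnSK//; congr (inv _ (prune_step _ _ _ (cost _))).
  by apply/val_inj; rewrite /= nth_enum_ord.
move=> [sz sub sat sumE] E.
have EE : E = mix (prune Q S0).
  by apply/setP => e; rewrite mixE sz ltn_ord inE.
split; rewrite ?EE// sumE /set_cost; apply: eq_bigl => e.
by rewrite mixE sz ltn_ord.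
Qed.

End SpecLemmas.

(** * Inverting a delay function *)

Section DelayFunctions.
Variables (R : realType) (ND : nd_class R) (I : inst ND).
Implicit Type q : online_request I.

Lemma delay_homo q s t : valid_request q -> release q <= s -> s <= t ->
  delay q s <= delay q t.
Proof.
move=> [_ _ mono _ _] rs st; apply: mono => //; rewrite in_itv/= andbT//.
exact: le_trans st.
Qed.

(** Divergence makes the set nonempty and continuity makes the infimum attain [x] exactly; the
    premise excludes a delay that starts above [x]. *)
Lemma delay_reach q x : valid_request q -> delay q (release q) <= x ->
  let s := inf [set t | release q <= t /\ x <= delay q t]%classic in
  release q <= s /\ delay q s = x.
Proof.
move=> vq rx s; have [_ _ mono cont infty] := vq.
set A := [set t | _]%classic in s *.
have [T [rT xT]] : exists T, release q <= T /\ x <= delay q T.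
  have : (\forall t \near +oo, x <= delay q t /\ release q <= t)%classic.
    near=> t; split; last by near: t; apply: nbhs_pinfty_ge; rewrite num_real.
    near: t; move/cvgryPge: infty; exact.
  by move=> /(pinfty_ex_ge (num_real (release q)))[t _ [? ?]]; exists t.
have ivt a b v : release q <= a -> a <= b -> delay q a <= v -> v <= delay q b ->
    exists2 c, a <= c <= b & delay q c = v.
  move=> ra ab av vb; have [||c] := @IVT R (delay q) a b v ab.
  - apply: continuous_subspaceW cont => t /=; rewrite !in_itv/= andbT => /andP[at' _].
    exact: le_trans at'.
  - have dab := delay_homo vq ra ab.
    by rewrite (min_idPl dab) (max_idPr dab) av vb.
  by rewrite in_itv/=; exists c.
have [c /andP[rc _] dc] := ivt _ _ _ (lexx _) rT rx xT.
have Ac : A c by split => //; rewrite dc.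
have lbA : lbound A (release q) by move=> t [].
have rs : release q <= s by apply: lb_le_inf => //; exists c.
have sc : s <= c by apply: ge_inf => //; exists (release q).
split=> //; apply/eqP; rewrite eq_le -{1}dc delay_homo//=.
rewrite leNgt; apply/negP => sx.
(* A value strictly between [delay q s] and [x] is taken at some [c']. By monotonicity [c'] is a
   lower bound of the set, so it is at most [s], which contradicts its value. *)
have [||c' /andP[sc' _] dc'] := ivt s c ((delay q s + x) / 2) rs sc; [lra|rewrite dc; lra|].
suff : c' <= s.
  by move=> /(delay_homo vq (le_trans rs sc')); rewrite dc'; lra.
apply: lb_le_inf; first by exists c.
move=> t [rt xt]; rewrite leNgt; apply/negP => /ltW /(delay_homo vq rt).
by rewrite dc'; lra.
Unshelve. all: by end_near. Qed.

End DelayFunctions.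

(** * Moving the prize-collecting time forward *)

Section ForwardLoop.
Variables (R : realType) (ND : nd_class R) (I : inst ND) (sigma : online_input I).
Variable G : config R (request I) (world I) -> Prop.
Local Notation val := (Defs.val R (request I)).
Local Notation fam := (@Defs.family R ND I).
Local Notation n := (nelt I).
Local Notation elt := 'I_n.
Local Notation N := (size sigma).
Local Notation rq := (@rq R ND I sigma).
Local Notation entry := (entry sigma).
Local Notation enc_entry := (@enc_entry R ND I sigma).
Local Notation release := (@release R ND I).
Local Notation runs := (runs fam (online_ext sigma) G).
Hypothesis sorted_sigma : sorted <=%R (map release sigma).
Hypothesis valid_rq : forall i, valid_request (rq i).
Variables (K : nat).
Hypotheses (nK : (n < K)%N) (NK : (N <= K)%N).
Variables (pc : prog) (Tpc : nat) (g : R).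
Hypothesis run_pc : forall w tau (Q : seq entry), (size Q <= N)%N ->
  runs pc (pc_encode (pc_instance tau Q)) w Tpc%:R (fun v w' =>
    pc_cost (pc_instance tau Q) (vset n v) <= g * pc_opt (pc_instance tau Q) /\ w' = w).

Definition forward_time : nat :=
  ((K * K.+1).+1 * (steps pc_instanceP K + Tpc + 6 + steps decideP K + 2 + 1) + 1)%N.

Definition unserved (tau : R) (Q : seq entry) (E : {set elt}) : R :=
  \sum_(x <- Q | E \notin fam_of x) penalty tau x.

Lemma penalty_homo x tau tau' : release (rq (idx x)) <= tau -> tau <= tau' ->
  penalty tau x <= penalty tau' x.
Proof.
move=> rx tt'; rewrite lerD2r ge_max !le_max lexx orbT andbT.
by rewrite (delay_homo (valid_rq _) rx tt').
Qed.

(** The next time is the first at which an unserved request gains [theta / size Q]. That none gains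
    more bounds the overshoot; that one gains exactly this much bounds the number of rounds. *)
Lemma next_time_step (Q : seq entry) theta t tau tau' E : 0 < theta ->
  (forall y, y \in Q -> release (rq (idx y)) <= t) -> t <= tau ->
  next_time theta tau Q E = Some tau' ->
  [/\ tau <= tau',
     forall x, x \in Q -> E \notin fam_of x ->
       penalty tau' x <= penalty tau x + theta / (size Q)%:R &
     exists x, [/\ x \in Q, E \notin fam_of x &
       penalty tau' x = penalty tau x + theta / (size Q)%:R]].
Proof.
move=> th0 rel ttau; have := next_time_spec theta tau Q E.
case: (next_time _ _ _ _) => // tau1 [[x0 [x0Q x0E fx0]] hmin] [<-].
have m0 : 0 < theta / (size Q)%:R.
  by rewrite divr_gt0// ltr0n; case: (Q) x0Q.
have reachP x : x \in Q -> let y := Num.max (wait_cost tau x) (paid x) + theta / (size Q)%:R in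
    tau <= reach (idx x) y /\ wait_cost (reach (idx x) y) x = y.
  move=> xQ y; have rx : release (rq (idx x)) <= tau by rewrite (le_trans (rel _ xQ)).
  have dy : wait_cost tau x < y.
    by rewrite ltr_pwDr// le_max lexx.
  have [] := @delay_reach _ _ _ (rq (idx x)) y (valid_rq _).
    exact: le_trans (delay_homo (valid_rq _) (lexx _) rx) (ltW dy).
  rewrite -/(reach (idx x) y) => h1 h2; split => //.
  rewrite leNgt; apply/negP => /ltW /(delay_homo (valid_rq _) h1); rewrite h2.
  by rewrite leNgt dy.
have tt1 : tau <= tau1 by rewrite -fx0; have [] := reachP _ x0Q.
split=> // [x xQ xE|].
  have [h1 h2] := reachP _ xQ; have hle := hmin _ xQ xE.
  have : wait_cost tau1 x <= Num.max (wait_cost tau x) (paid x) + theta / (size Q)%:R.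
    rewrite -[leRHS]h2; apply: (delay_homo (valid_rq _)) => //.
    by rewrite (le_trans (rel _ xQ))// (le_trans ttau).
  rewrite /penalty addrAC lerD2r ge_max => -> /=.
  by apply: ler_wpDr; [exact: ltW|rewrite le_max lexx orbT].
exists x0; split => //; have [h1 h2] := reachP _ x0Q.
rewrite /penalty -fx0 h2 addrAC; congr (_ - _); apply/max_idPl.
by apply: ler_wpDr; [exact: ltW|rewrite le_max lexx orbT].
Qed.

Lemma set_cost_homo (E E' : {set elt}) : E \subset E' -> set_cost E <= set_cost E'.
Proof.
move=> /finset.setIidPr sub; rewrite /set_cost [leRHS](big_setID E) sub /= lerDl.
by apply: sumr_ge0 => e _; exact: cost_ge0.
Qed.

Section Loop.
Variables (t L theta : R) (u e0 k : val) (P Q : seq entry) (w : world I).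
Hypotheses (tw : now w = t) (th0 : 0 <= theta) (sQ : (size Q <= N)%N).
Hypothesis knownQ : forall x, x \in Q -> release (rq (idx x)) <= t.
Hypothesis paidQ : forall x, x \in Q -> wait_cost t x <= paid x.
Hypothesis posQ : forall x, x \in Q -> 0 < theta.
Local Notation fe := (fenv t P L theta u e0 k Q).

Let m : R := (size Q)%:R.
(** The number of increments [theta / m] that [x] has left, cut off at 0. *)
Let progress (tau : R) (x : entry) : R := m + 1 - Num.min (m + 1) (m * penalty tau x / theta).

(** The set was bought within budget [theta] at an earlier time; the move to [tau] may have added
    another [theta] to its penalties. *)
Let sane tau (s : seq bool) :=
  [/\ t <= tau, set_cost (bits_set I s) <= theta & unserved tau Q (bits_set I s) <= theta + theta].

Let inv (j : nat) (v : val) (w' : world I) := w' = w /\ exists tau s,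
  [/\ v = fe tau (vbits I s), sane tau s & \sum_(x <- Q) progress tau x <= j%:R].

Lemma unserved_ge0 tau E : 0 <= unserved tau Q E.
Proof. by apply: sumr_ge0 => x _; exact: penalty_ge0. Qed.

(** The request [x0] that gains [theta / m] was left out by a set within budget, so its penalty was
    at most [theta]. Hence the cutoff at [m + 1] is not exceeded and a full unit is lost. *)
Lemma progress_step tau tau' s x : t <= tau ->
  unserved tau Q (bits_set I s) <= theta -> next_time theta tau Q (bits_set I s) = Some tau' ->
  x \in Q -> \sum_(x <- Q) progress tau' x + 1 <= \sum_(x <- Q) progress tau x.
Proof.
move=> ttau uns nxt xQ; have th := posQ xQ.
have m0 : 0 < m by rewrite ltr0n; case: (Q) xQ.
have [tt' _ [x0 [x0Q x0E px0]]] := next_time_step th knownQ ttau nxt.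
have mono y : y \in Q -> progress tau' y <= progress tau y.
  move=> yQ; rewrite lerD2l lerN2 le_min ge_min lexx/= ge_min; apply/orP; right.
  rewrite ler_pM2r ?invr_gt0// ler_pM2l// penalty_homo//.
  by rewrite (le_trans (knownQ yQ)).
have px : penalty tau x0 <= theta.
  apply: le_trans uns; rewrite /unserved (big_rem x0)//= x0E lerDl.
  by apply: sumr_ge0 => y _; exact: penalty_ge0.
rewrite (big_rem x0)//= [leRHS](big_rem x0)//= addrAC lerD//; last first.
  rewrite !big_seq; apply: ler_sum => y /mem_rem; exact: mono.
have h1 : m * penalty tau x0 / theta <= m by rewrite ler_pdivrMr// ler_pM2l.
rewrite /progress; have -> : m * penalty tau' x0 / theta = m * penalty tau x0 / theta + 1.
  by rewrite px0; field; rewrite !gt_eqF.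
rewrite (min_idPr _); last by rewrite lerD2r.
by rewrite (min_idPr _); [lra|rewrite (le_trans h1)// lerDl].
Qed.

Lemma runs_forward : runs (forwardP pc) (fe t (VInl VUnit)) w forward_time%:R
  (fun v w' => w' = w /\ exists tau s,
     [/\ v = fe tau (vbits I s), sane tau s &
         {in Q, forall x, bits_set I s \in fam_of x} \/
         theta <= g * pc_opt (pc_instance tau Q)]).
Proof.
have kQ : all_known w Q by move=> x /knownQ; rewrite /known tw.
have sQK : (size Q <= K)%N by exact: leq_trans NK.
pose C := (steps pc_instanceP K + Tpc + 6 + steps decideP K + 2)%N.
have -> : forward_time%:R = (K * K.+1).+1%:R * (C%:R + 1) + 1 :> R.
  by rewrite /forward_time -/C natrD natrM natrD.
apply: (runs_loop (I := inv)); first exact: ler0n.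
  move=> j v _ [-> [tau [s [-> [ttau costs uns] hj]]]].
  have -> : C%:R = 1 + ((steps pc_instanceP K)%:R + Tpc%:R + 2) + 3
      + (steps decideP K)%:R + 2 :> R.
    rewrite /C !natrD; ring.
  have h1 : runs (Seq pc_instanceP pc) (fe tau (vbits I s)) w
      ((steps pc_instanceP K)%:R + Tpc%:R + 2) (fun v w' =>
    pc_cost (pc_instance tau Q) (vset n v) <= g * pc_opt (pc_instance tau Q) /\ w' = w).
    have hi := evp_pc_instance G sorted_sigma t L theta u e0 k P kQ sQK tau (vbits I s).
    apply: (runs_seq hi) => //.
    by move=> v1 w1 [-> ->]; exact: run_pc.
  have h2 : runs (Fork (Prim Id) (Seq pc_instanceP pc)) (fe tau (vbits I s)) w
      (1 + ((steps pc_instanceP K)%:R + Tpc%:R + 2) + 3) (fun v w' => exists S0,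
    [/\ v = VPair (fe tau (vbits I s)) S0,
      pc_cost (pc_instance tau Q) (vset n S0) <= g * pc_opt (pc_instance tau Q) & w' = w]).
    have h0 : runs (Prim Id) (fe tau (vbits I s)) w 1
        (fun v w' => v = fe tau (vbits I s) /\ w' = w) by apply: runs_prim.
    apply: runs_fork h0 _ _; first by case: h1.
    move=> v1 w1 [-> ->]; apply: runs_weaken (lexx _) _ h1 => v2 w2 [h3 ->].
    by exists v2; split.
  apply: runs_seq h2 _ _ => // v1 _ [S0 [-> hS0 ->]].
  have hd := evp_decide G sorted_sigma nK t L theta u e0 k P kQ sQK tau (vbits I s) S0.
  apply: (runs_weaken (lexx _) _ hd) => {hd} v2 w2 [-> ->].
  set bs := pruned_bits Q S0; set E := bits_set I bs.
  have [Esub Esat costE] := prune_correct Q S0; rewrite -/bs -/E in Esub Esat costE.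
  rewrite priceE costE; case: ifP => [hle|/negbT]; last first.
    (* Over budget: pruning did not raise the price, so [theta] is below the cost of the raw output
       and thus below [g] times the optimum. The state of the previous round is returned. *)
    rewrite -ltNge => hlt; right; exists (fe tau (vbits I s)); split=> //; split=> //.
    exists tau, s; split=> //; right; apply: le_trans hS0; apply: ltW (lt_le_trans hlt _).
    rewrite pc_cost_instance lerD ?set_cost_homo//.
    rewrite big_seq_cond [leRHS]big_seq_cond [leLHS]big_mkcond [leRHS]big_mkcond/=; apply: ler_sum => x _.
    case xQ: (x \in Q); last by exact: lexx.
    rewrite /=; case hx: (vset n S0 \in _) => /=; first by rewrite Esat.
    by case: ifP => // _; exact: penalty_ge0.
  have E0 := set_cost_ge0 E; have U0 := unserved_ge0 tau E.
  rewrite -/(unserved tau Q E) in hle.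
  have costE' : set_cost E <= theta by lra.
  have unsE : unserved tau Q E <= theta by lra.
  have := next_time_spec theta tau Q E.
  case hn: (next_time theta tau Q E) => [tau'|]; last first.
    move=> hall; right; exists (fe tau (vbits I bs)); split=> //; split=> //.
    by exists tau, bs; split=> //; [split=> //; lra|left].
  move=> [[x0 [x0Q _ _]] _]; left; exists (fe tau' (vbits I bs)); split=> //.
  have [tt' hstep _] := next_time_step (posQ x0Q) knownQ ttau hn.
  have hp := progress_step ttau unsE hn x0Q.
  exists j.-1.
    rewrite prednK// -(ltr0n R) (lt_le_trans _ hj)// (lt_le_trans _ hp)//.
    by rewrite ltr_wpDl// sumr_ge0// => y _; rewrite subr_ge0 ge_min lexx.
  have j0 : (0 < j)%N.
    rewrite -(ltr0n R) (lt_le_trans _ hj)// (lt_le_trans _ hp)//.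
    by rewrite ltr_wpDl// sumr_ge0// => y _; rewrite subr_ge0 ge_min lexx.
  split=> //; exists tau', bs; split => //.
    split=> //; first exact: le_trans tt'.
    (* At most [size Q] requests grow by [theta / size Q] each. *)
    have : unserved tau' Q E <= unserved tau Q E + \sum_(x <- Q) theta / (size Q)%:R.
      rewrite /unserved [X in _ <= X + _]big_mkcond [leLHS]big_mkcond -big_split/= !big_seq.
      apply: ler_sum => y yQ; case: ifP => yE; first exact: hstep.
      by rewrite add0r divr_ge0.
    rewrite big_const_seq count_predT iter_addr_0 -[_ *+ size Q]mulr_natr divfK.
      by rewrite -/E; lra.
    by rewrite pnatr_eq0 -lt0n; case: (Q) x0Q.
  rewrite -(lerD2r 1) (le_trans hp)// (le_trans hj)//.
  by rewrite -[in leLHS](prednK j0) -natr1.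
(* The loop starts from the empty set, for which every penalty is zero since [paid] covers the delay
   up to [t]. *)
split=> //; exists t, [::]; split=> //.
- have E0 : bits_set I [::] = finset.set0 by apply/setP => e; rewrite !inE nth_nil.
  split=> //; first by rewrite E0 /set_cost big_set0.
  rewrite /unserved big_seq_cond big1 ?addr_ge0// => x /andP[xQ _].
  by rewrite /penalty (max_idPr (paidQ xQ)) subrr.
- apply: (@le_trans _ _ (\sum_(x <- Q) (m + 1))).
    rewrite !big_seq; apply: ler_sum => x xQ; rewrite gerBl le_min addr_ge0//=.
    by rewrite divr_ge0// mulr_ge0// penalty_ge0.
  rewrite big_const_seq count_predT iter_addr_0 -[_ *+ size Q]mulr_natr /m natr1 -natrM ler_nat.
  by rewrite mulnC leq_mul// ltnS.
Qed.
End Loop.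
End ForwardLoop.

Ltac nonneg_sum := repeat match goal with
  | |- is_true (0 <= _ + _) => apply: addr_ge0
  | |- is_true (0 <= _) => first [exact: ler0n | exact: ler01]
  end.

(** * One service and one wait *)

Section Phases.
Variables (R : realType) (ND : nd_class R) (I : inst ND) (sigma : online_input I).
Variable G : config R (request I) (world I) -> Prop.
Local Notation val := (Defs.val R (request I)).
Local Notation fam := (@Defs.family R ND I).
Local Notation n := (nelt I).
Local Notation elt := 'I_n.
Local Notation N := (size sigma).
Local Notation rq := (@rq R ND I sigma).
Local Notation entry := (entry sigma).
Local Notation enc_entry := (@enc_entry R ND I sigma).
Local Notation release := (@release R ND I).
Local Notation idx := (@idx R ND I sigma).
Local Notation runs := (runs fam (online_ext sigma) G).
Hypothesis sorted_sigma : sorted <=%R (map release sigma).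
Hypothesis valid_rq : forall i, valid_request (rq i).
Variables (K : nat).
Hypotheses (nK : (n < K)%N) (NK : (N <= K)%N).
Variables (pc : prog) (Tpc : nat) (g : R).
Hypothesis run_pc : forall w tau (Q : seq entry), (size Q <= N)%N ->
  runs pc (pc_encode (pc_instance tau Q)) w Tpc%:R (fun v w' =>
    pc_cost (pc_instance tau Q) (vset n v) <= g * pc_opt (pc_instance tau Q) /\ w' = w).

Definition cheap_prog := Let (Op Add (Var 0) (Var 0)) (Let cheapP (Prim Id)).
Definition split_prog :=
  Let keptP (Let eligibleP (Let (Count (Var 0)) (Fork (Fork (Prim Id) (Var 8)) Nil))).
Definition finish_prog := Un MkInl (Fork (Up 11) finishP).

Definition service_steps : nat :=
  (steps cheap_prog K + (8 + (steps split_prog K +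
    (forward_time K Tpc + (8 + steps finish_prog K + 2) + 2) + 2) + 2) + 2)%N.

Lemma runs_send r (bs : seq bool) w :
  runs (Fork (Prim Id) (Seq (Var 0) (Prim (Query Send)))) (VPair r (vbits I bs)) w 8
    (fun v w' => v = VPair (VPair r (vbits I bs)) VUnit /\
       w' = World (now w) (rcons (log w) (now w, bits_set I bs))).
Proof.
have h0 : runs (Prim Id) (VPair r (vbits I bs)) w 1
   (fun v w' => v = VPair r (vbits I bs) /\ w' = w) by apply: runs_prim.
have h1 : runs (Seq (Var 0) (Prim (Query Send))) (VPair r (vbits I bs)) w (1 + 1 + 2)
   (fun v w' => v = VUnit /\ w' = World (now w) (rcons (log w) (now w, bits_set I bs))).
  have h2 : runs (Var 0) (VPair r (vbits I bs)) w 1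
    (fun v w' => v = vbits I bs /\ w' = w) by apply: runs_prim.
  apply: (runs_seq h2) => // v w' [-> ->].
  by rewrite -vset_vbits; apply: runs_prim.
have -> : 8 = 1 + (1 + 1 + 2) + 3 :> R by ring.
apply: (runs_fork h0) => // v1 w1 [-> ->].
by apply: (runs_weaken (lexx _) _ h1) => v2 w2 [-> ->].
Qed.

(** The last disjunction is all that the analysis retains of the approximation algorithm: nothing is
    left over, or the instance at [tau] certifies a cost of [theta / g]. *)
Lemma runs_service t (P : seq entry) (L : R) w :
  now w = t -> 0 <= L -> all_known w P -> (size P <= N)%N ->
  let theta := L + L in let Q := eligible theta t P in
  {in Q, forall x, wait_cost t x <= paid x /\ 0 < theta} ->
  runs (serviceP pc) (lenv t P L) w service_steps%:R (fun v w' =>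
   exists tau E,
   [/\ v = VInl (senv t (finish theta tau E (kept theta P) Q)),
       w' = World t (rcons (rcons (log w) (t, cheap I theta)) (t, E)),
       [/\ t <= tau, set_cost E <= theta & unserved tau Q E <= theta + theta] &
       {in Q, forall x, E \in fam_of x} \/ theta <= g * pc_opt (pc_instance tau Q)]).
Proof.
move=> tw L0 kP sP theta Q hQ.
have QP : {subset map idx Q <= map idx P}.
  move=> i /mapP[x]; rewrite /Q eligibleE mem_rev => /mapP[y].
  rewrite mem_filter => /andP[_ yP] -> ->; apply/mapP; exists y => //.
  by rewrite /refresh; case: (timer y).
have sQ : (size Q <= N)%N.
  apply: leq_trans sP; rewrite /Q eligibleE size_rev size_map size_filter.
  exact: count_size.
have knQ x : x \in Q -> release (rq (idx x)) <= t.
  move=> xQ; have /QP /mapP[y yP ->] : idx x \in map idx Q by apply: map_f.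
  by rewrite -tw; exact: kP.
set e0 := [seq c * n%:R <= theta | c <- costs I].
have e0E : bits_set I e0 = cheap I theta by rewrite -vset_vbits vset_cheap.
pose w1 := World t (rcons (log w) (t, cheap I theta)).
have kP1 : all_known w1 P by move=> x /kP; rewrite /known tw.
have kQ1 : all_known w1 Q by move=> x /knQ.
rewrite /service_steps.
have -> : (steps cheap_prog K + (8 + (steps split_prog K +
    (forward_time K Tpc + (8 + steps finish_prog K + 2) + 2) + 2) + 2) + 2)%:R =
  (steps cheap_prog K)%:R + (8 + ((steps split_prog K)%:R +
    ((forward_time K Tpc)%:R + (8 + (steps finish_prog K)%:R + 2) + 2) + 2) + 2) + 2 :> R.
  rewrite !natrD; ring.
have h1 := evp_cheap G w nK t P L.
apply: (runs_seq h1); first by nonneg_sum.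
move=> _ _ [-> ->]; rewrite /cenv -/theta -/e0.
apply: (runs_seq (runs_send _ e0 w)); first by nonneg_sum.
move=> _ _ [-> ->]; rewrite tw e0E -/w1.
have h3 := evp_split G sorted_sigma t L VUnit kP1 (leq_trans sP NK).
apply: (runs_seq h3); first by nonneg_sum.
move=> _ _ [-> ->].
have h4 := @runs_forward R ND I sigma G sorted_sigma valid_rq K nK NK pc Tpc g run_pc t L theta
  VUnit (vbits I e0) (vlist [seq enc_entry e | e <- kept theta P]) P Q w1 erefl
  (addr_ge0 L0 L0) sQ knQ (fun x xQ => (hQ x xQ).1) (fun x xQ => (hQ x xQ).2).
apply: (runs_seq h4); first by nonneg_sum.
move=> _ _ [-> [tau [s [-> sane ev]]]].
apply: (runs_seq (runs_send _ s w1)) => //.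
move=> _ _ [-> ->].
have kQ2 : all_known (World t (rcons (log w1) (t, bits_set I s))) Q by move=> x /knQ.
have h5 := evp_finish G sorted_sigma t L theta VUnit (vbits I e0) P kQ2 (leq_trans sQ NK) tau s
  VUnit (erefl (vlist [seq enc_entry e | e <- kept theta P])).
apply: (runs_weaken (lexx _) _ h5) => v w' [-> ->].
by exists tau, (bits_set I s).
Qed.

(** The interaction can end only here, when there is neither an alarm nor an arrival to come; that
    is why [G] is demanded in this case. *)
Lemma runs_wait t (P : seq entry) w :
  now w = t -> all_known w P -> (size P <= N)%N ->
  (wait_until sigma t (alarm t P) = None -> G (Config (Ret VUnit) [::] w)) ->
  runs waitP (VPair (senv t P) VUnit) w
    (steps waitP K)%:R (fun v w' => exists t',
      [/\ wait_until sigma t (alarm t P) = Some t',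
          v = VInl (senv t' (admit_all t' P (new_requests sigma t t'))) &
          w' = World t' (log w)]).
Proof.
move=> tw kP sP hG.
set A := Un MkInl (Fork (Fork (Up 3) (Un Fst (Var 0))) admitP).
have -> : (steps waitP K)%:R =
   1 + (1 + ((steps alarmP K)%:R + 1 + 2) + 3 + (steps A K)%:R + 2) + 2 :> R.
  by rewrite -/(steps A K) -[waitP]/(Seq (Prim Fst) (Seq (Fork (Prim Id) (Seq alarmP
    (Prim (Query Wait)))) A)) [steps]lock /= -lock !natrD /=.
have h0 : runs (Prim Fst) (VPair (senv t P) VUnit) w 1
  (fun v w' => v = senv t P /\ w' = w) by apply: runs_prim.
apply: (runs_seq h0); first by nonneg_sum.
move=> _ _ [-> ->].
have h1 := evp_alarm G sorted_sigma t kP (leq_trans sP NK).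
have h2 : runs (Seq alarmP (Prim (Query Wait))) (senv t P) w ((steps alarmP K)%:R + 1 + 2)
  (fun v w' => exists t', [/\ wait_until sigma t (alarm t P) = Some t',
      v = VPair (VNum t') (arrivals sigma t t') & w' = World t' (log w)]).
  apply: (runs_seq h1) => // _ _ [-> ->].
  case hw: (wait_until sigma t (alarm t P)) => [t'|].
    apply: (@runs_prim _ _ _ _ _ _ _ _ _ _ (VPair (VNum t') (arrivals sigma t t')) (World t' (log w))).
      by move=> b /=; rewrite tw; case: (alarm t P) hw => [a|] ->.
    by exists t'.
  apply: runs_exit; last exact: hG.
  by move=> b /=; rewrite tw; case: (alarm t P) hw => [a|] ->.
have h3 : runs (Prim Id) (senv t P) w 1
  (fun v w' => v = senv t P /\ w' = w) by apply: runs_prim.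
have h4 : runs (Fork (Prim Id) (Seq alarmP (Prim (Query Wait)))) (senv t P) w
   (1 + ((steps alarmP K)%:R + 1 + 2) + 3)
  (fun v w' => exists t', [/\ wait_until sigma t (alarm t P) = Some t',
      v = VPair (senv t P) (VPair (VNum t') (arrivals sigma t t')) & w' = World t' (log w)]).
  apply: runs_fork h3 _ _; first by nonneg_sum.
  move=> v1 w1 [-> ->]; apply: (runs_weaken (lexx _) _ h2) => v2 w2 [t' [ht -> ->]].
  by exists t'.
apply: (runs_seq h4) => // _ _ [t' [ht -> ->]].
have hs : {in new_requests sigma t t', forall i, release (rq i) <= t'}.
  move=> i /mem_drop; rewrite -nreleasedP// => hi.
  have := hi; rewrite in_take ?mem_enum// index_enum_ord.
  by [].
have h5 := evp_admit G sorted_sigma nK t (w := World t' (log w)) t' P hs _.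
have h6 : evp sigma G K (World t' (log w)) A
    (VPair (senv t P) (VPair (VNum t') (arrivals sigma t t')))
    (VInl (senv t' (admit_all t' P (new_requests sigma t t')))).
  apply: evp_un => //; apply: evp_fork; first exact: evp_loop_free.
  rewrite arrivalsE; apply: h5.
  by rewrite (leq_trans _ NK)// /new_requests size_drop (leq_trans (leq_subr _ _))//
    size_take_min size_enum_ord geq_minr.
by apply: (runs_weaken (lexx _) _ h6) => v w' [-> ->]; exists t'.
Qed.

End Phases.

Lemma uniq_map_inj (A B : eqType) (f : A -> B) (s : seq A) x y :
  uniq (map f s) -> x \in s -> y \in s -> f x = f y -> x = y.
Proof.
elim: s => //= z s IH /andP[zs us]; rewrite !inE.
move=> /predU1P[->|xs] /predU1P[->|ys] // fxy; last exact: IH.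
  by move: zs; rewrite fxy map_f.
by move: zs; rewrite -fxy map_f.
Qed.

(** * Invariants and progress *)

Section Structure.
Variables (R : realType) (ND : nd_class R) (I : inst ND) (sigma : online_input I).
Local Notation fam := (@Defs.family R ND I).
Local Notation n := (nelt I).
Local Notation elt := 'I_n.
Local Notation N := (size sigma).
Local Notation rq := (@rq R ND I sigma).
Local Notation entry := (entry sigma).
Local Notation release := (@release R ND I).
Local Notation idx := (@idx R ND I sigma).
Hypothesis sorted_sigma : sorted <=%R (map release sigma).
Hypothesis valid_rq : forall i, valid_request (rq i).
Implicit Types (P Q : seq entry) (x y z : entry) (E : {set elt}) (t tau theta : R).

Definition arrival x := release (rq (idx x)).
Definition need x : R := odflt 0 (bottleneck (req (rq (idx x)))).

(** A touched level stays below [n * need x] because a service of larger value serves the request by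
    cheap elements. Since [paid] of a touched request runs ahead to its timer, only fresh requests
    have unpaid delay. *)
Definition sound t x : Prop :=
  [/\ arrival x <= t, bottleneck (req (rq (idx x))) = Some (need x) &
      if timer x is Some tau
      then [/\ 0 < level x, need x <= level x, level x < n%:R * need x, t <= tau &
               wait_cost tau x <= paid x]
      else level x = need x /\ paid x = wait_cost (arrival x) x].

(** In the last clause, one [c] holds as long as nothing fires and the other is the growth until the
    next alarm. *)
Definition structured t P : Prop :=
  [/\ uniq (map idx P), {in P, forall x, sound t x} &
      forall c : R, 0 <= c -> partial_sum t P c <= c + c].

Lemma need_ge0 x : 0 <= need x.
Proof. by rewrite /need; have := bottleneck_spec (req (rq (idx x))); case: bottleneck => //= b []. Qed.

Lemma wait_cost_homo x s t : arrival x <= s -> s <= t -> wait_cost s x <= wait_cost t x.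
Proof. exact: delay_homo. Qed.

Lemma sound_paid_ge t x : sound t x -> timer x -> wait_cost t x <= paid x.
Proof.
move=> [rx _]; case: (timer x) => // tau [_ _ _ tt' h] _.
by apply: le_trans h; exact: wait_cost_homo.
Qed.

Lemma sound_paid_le t x : sound t x -> fresh x -> paid x <= wait_cost t x.
Proof.
move=> [rx _]; rewrite /fresh; case: (timer x) => // -[_ ->] _.
exact: wait_cost_homo.
Qed.

Lemma size_structured t P : structured t P -> (size P <= N)%N.
Proof.
move=> [uP _ _]; rewrite -(size_map idx) -[leqRHS]card_ord.
by rewrite -(card_uniqP uP) max_card.
Qed.

Lemma partial_sum_ge0 t P c : {in P, forall x, sound t x} -> 0 <= partial_sum t P c.
Proof.
move=> sP; rewrite partial_sumE big_seq_cond sumr_ge0// => x /and3P[xP fx _].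
by rewrite subr_ge0 sound_paid_le//; exact: sP.
Qed.

(** The fresh request of greatest level up to [c] has the same partial sum as [c], and it does not
    fire. *)
Lemma partial_sum_quiet t P c : 0 <= c ->
  {in P, forall x, fresh x -> level x <= c -> ~~ fires t P x} ->
  partial_sum t P c <= c.
Proof.
move=> c0 quiet; have [hn|] := boolP (has (fun x => fresh x && (level x <= c)) P).
  have [x0 x0P] := hasP hn; move=> /andP[fx0 lx0].
  pose Pc := [seq x <- P | fresh x && (level x <= c)].
  have [x [xP /andP[fx lx] xmax]] : exists x, [/\ x \in P, fresh x && (level x <= c) &
      {in P, forall y, fresh y && (level y <= c) -> level y <= level x}].
    have : forall s : seq entry, has xpredT s ->
        exists2 x, x \in s & {in s, forall y, level y <= level x}.
      elim=> // y s IH _; case: s IH => [_|y' s /(_ isT)[x xs hx]].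
        by exists y; rewrite ?inE// => z; rewrite inE => /eqP ->.
      case: (leP (level y) (level x)) => hxy.
        exists x; first by rewrite inE xs orbT.
        by move=> z; rewrite inE => /predU1P[->//|/hx].
      exists y; first by rewrite inE eqxx.
      move=> z; rewrite inE => /predU1P[->//|/hx hz].
      exact: le_trans hz (ltW hxy).
    move=> /(_ Pc)[|x]; first by rewrite has_filter filter_predT -has_filter.
    rewrite mem_filter => /andP[hx xP] hmax; exists x; split => // y yP hy.
    by apply: hmax; rewrite mem_filter hy.
  have := quiet x xP fx lx; rewrite /fires; move: fx; rewrite /fresh; case: (timer x) => // _.
  rewrite -ltNge => hlt; apply: le_trans (lx); apply: le_trans (ltW hlt).
  rewrite !partial_sumE big_seq_cond [leRHS]big_seq_cond.
  rewrite (eq_bigl (fun i => (i \in P) && (fresh i && (level i <= level x)))) => // y.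
  case yP: (y \in P) => //=; case fy: (fresh y) => //=.
  apply/idP/idP => [hy|hy]; last exact: le_trans hy lx.
  by apply: xmax => //; rewrite fy.
move=> hn; rewrite partial_sumE big_seq_cond big_pred0// => x.
by apply: contraNF hn => /andP[xP hx]; apply/hasP; exists x.
Qed.

Section Service.
Variables (t tau L : R) (P : seq entry) (E : {set elt}).
Let theta := L + L.
Let Q := eligible theta t P.
Let P' := finish theta tau E (kept theta P) Q.

Definition raised theta tau x : entry :=
  (idx x, (theta, (Num.max (wait_cost tau x) (paid x), Some tau))).

Lemma idx_refresh s x : idx (refresh s x) = idx x.
Proof. by rewrite /refresh; case: timer. Qed.

Lemma mem_eligible x : reflect (exists y, [/\ y \in P, level y <= theta,
  cheap I theta \notin fam_of y & x = refresh t y]) (x \in Q).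
Proof.
rewrite /Q eligibleE mem_rev; apply: (iffP mapP) => [[y]|[y [yP hy cy ->]]].
  by rewrite mem_filter => /andP[/andP[hy cy] yP] ->; exists y.
by exists y => //; rewrite mem_filter yP /is_eligible hy cy.
Qed.

Lemma mem_finish z : z \in P' ->
  (z \in P /\ theta < level z) \/
  (exists2 x, x \in Q & E \notin fam_of x /\ z = raised theta tau x).
Proof.
rewrite /P' finishE mem_cat mem_rev keptE mem_rev mem_filter.
move=> /orP[/mapP[x]|/andP[hz zP]]; last by left.
by rewrite mem_filter => /andP[hx xQ] ->; right; exists x.
Qed.

Hypothesis SP : structured t P.
Hypothesis cand : candidate t P = Some L.
Hypothesis ttau : t <= tau.

Lemma candidate_ge0 : 0 <= L.
Proof.
have := candidate_spec t P; rewrite cand => -[[x [xP _ <-]] _].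
have [_ sP _] := SP; have [_ _] := sP _ xP; case: (timer x) => [tau'|].
  by move=> [/ltW].
by move=> [-> _]; exact: need_ge0.
Qed.

Lemma uniq_eligible : uniq (map idx Q).
Proof.
have [uP _ _] := SP.
rewrite /Q eligibleE map_rev rev_uniq -map_comp.
rewrite (eq_map (g := idx)); last by move=> x /=; exact: idx_refresh.
by apply: subseq_uniq uP; apply: map_subseq; exact: filter_subseq.
Qed.

(** If [n * need x] were at most [theta], the elements of cost at most [need x], which satisfy the
    request, would all be cheap. *)
Lemma cheapN_need x : cheap I theta \notin fam_of x ->
  bottleneck (req (rq (idx x))) = Some (need x) -> theta < n%:R * need x.
Proof.
move=> cx hb; rewrite ltNge; apply: contra cx => hle.
have := bottleneck_spec (req (rq (idx x))); rewrite hb => -[_ hth _].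
apply: family_up hth; apply/fintype.subsetP => e; rewrite !inE => he.
by apply: le_trans hle; rewrite mulrC ler_wpM2l.
Qed.

Lemma eligible_sound x : x \in Q -> exists y, [/\ y \in P, sound t y, level y <= theta,
  theta < n%:R * need y & x = refresh t y].
Proof.
move=> /mem_eligible[y [yP ly cy ->]]; have [_ sP _] := SP; have sy := sP _ yP.
by exists y; split=> //; apply: cheapN_need => //; case: sy.
Qed.

Lemma eligible_paid x : x \in Q -> wait_cost t x <= paid x /\ 0 < theta.
Proof.
move=> /eligible_sound[y [yP sy ly hy ->]]; split.
  have := sound_paid_ge sy.
  by rewrite /refresh; case: y {yP sy ly hy} => i [l [p [tm|]]] //=; apply.
have L0 := candidate_ge0; rewrite lt_def; apply/andP; split; last exact: addr_ge0.
(* A request of level 0 has [need y = 0], and the free elements, cheap for every [theta], would have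
   served it. *)
apply/eqP => th0; have := sy; rewrite th0 in ly hy.
move=> [_ _]; case: (timer y) => [tau'|] [].
  by rewrite ltNge ly.
move=> hl _; have : need y = 0 by apply/eqP; rewrite eq_le -{1}hl ly need_ge0.
by move=> h; rewrite h mulr0 ltxx in hy.
Qed.

Lemma partial_sum_finish c : partial_sum t P' c <= partial_sum t P c.
Proof.
rewrite !partial_sumE /P' finishE big_cat/= [X in X + _]big_seq_cond big_pred0 ?add0r.
  rewrite keptE big_rev big_filter_cond [leLHS]big_mkcond [leRHS]big_mkcond !big_seq/=.
  have [_ sP _] := SP; apply: ler_sum => x xP.
  case fx: (fresh x); rewrite ?andbF//=; case: (level x <= c); rewrite ?andbF//= andbT.
  by case: ifP => // _; rewrite subr_ge0 sound_paid_le//; exact: sP.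
move=> x; apply/negbTE; rewrite mem_rev; apply/negP => /andP[/mapP[y _ ->]].
by rewrite /fresh.
Qed.

Lemma structured_finish : structured t P'.
Proof.
have [uP sP hP] := SP; have uQ := uniq_eligible; split.
- rewrite /P' finishE map_cat cat_uniq map_rev rev_uniq -map_comp.
  have hQ : subseq [seq idx x | x <- Q & E \notin fam_of x] (map idx Q).
    by apply: map_subseq; exact: filter_subseq.
  rewrite [X in [&& X, _ & _]](subseq_uniq hQ uQ) /=; apply/andP; split; last first.
    rewrite keptE map_rev rev_uniq; apply: subseq_uniq uP.
    by apply: map_subseq; exact: filter_subseq.
  apply/hasPn => i /mapP[x]; rewrite keptE mem_rev mem_filter => /andP[lx xP] ->.
  rewrite mem_rev; apply/negP => /mapP[x']; rewrite mem_filter => /andP[_ x'Q].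
  rewrite /= => hi; have /mem_eligible[y [yP ly _ hx']] := x'Q.
  have hxy : idx x = idx y by rewrite hi hx' -[LHS]/(idx _) idx_refresh.
  have xy := uniq_map_inj uP xP yP hxy.
  by move: lx; rewrite xy ltNge ly.
- move=> z /mem_finish[[zP _]|[x xQ [Ex ->]]]; first exact: sP.
  have [y [yP sy ly hy ->]] := eligible_sound xQ; have [_ th0] := eligible_paid xQ.
  have [ry by' hyy] := sy; split; rewrite /arrival /need/= ?idx_refresh//.
  split=> //; rewrite ?le_max ?lexx ?orbT//.
  move: hyy; case: (timer y) => [tau'|].
    by move=> [_ h _ _ _]; exact: le_trans h ly.
  by move=> [h _]; move: ly; rewrite h.
- by move=> c c0; apply: le_trans (partial_sum_finish c) (hP _ c0).
Qed.

End Service.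
End Structure.

(** * A measure for the number of iterations *)

Section Progress.
Variables (R : realType) (ND : nd_class R) (I : inst ND) (sigma : online_input I).
Local Notation fam := (@Defs.family R ND I).
Local Notation n := (nelt I).
Local Notation elt := 'I_n.
Local Notation N := (size sigma).
Local Notation rq := (@rq R ND I sigma).
Local Notation entry := (entry sigma).
Local Notation release := (@release R ND I).
Local Notation idx := (@idx R ND I sigma).
Hypothesis sorted_sigma : sorted <=%R (map release sigma).
Hypothesis valid_rq : forall i, valid_request (rq i).
Implicit Types (P Q : seq entry) (x y z : entry) (E : {set elt}) (t tau theta : R).

Definition overdue t P := has (fun x => if timer x is Some tau then tau <= t else false) P.

(** Touched: doubling the level costs [4 * ln 2], at least 2, and the additive 2 is lost when the
    request is served. Fresh: [4 + 4 * n] exceeds any weight after the first service by 2, and the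
    last term counts alarms, each lowering it by at least 2; it is nonnegative as unpaid delay is at
    most twice the level. *)
Definition weight t x : R :=
  if timer x is Some _ then 2 + 4 * ln (n%:R * need x / level x)
  else 4 + 4 * n%:R + 2 * N%:R * (2 - (wait_cost t x - paid x) / level x).

(** One more than the initial weight of a fresh request, so that an arrival pays for the wait that
    it ends. *)
Definition arrival_weight : R := 5 + 4 * n%:R + 4 * N%:R.

Definition future t : nat := #|[set i : 'I_N | t < release (rq i)]|.

(** A wait ended by a timer may change only the last term. The following service loses at least 2
    elsewhere, which pays for restoring that term. *)
Definition measure t P : R :=
  arrival_weight * (future t)%:R + \sum_(x <- P) weight t x + (~~ overdue t P)%:R.

Lemma fresh_residual t P x : structured t P -> x \in P -> fresh x ->
  0 <= wait_cost t x - paid x <= level x + level x.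
Proof.
move=> [uP sP hP] xP fx; have sx := sP _ xP.
rewrite subr_ge0 (sound_paid_le valid_rq sx fx)/=.
have l0 : 0 <= level x.
  have [_ _] := sx; move: fx; rewrite /fresh; case: (timer x) => // _ [-> _].
  exact: need_ge0.
apply: le_trans (hP _ l0); rewrite partial_sumE (big_rem x)//= fx lexx/= lerDl.
rewrite big_seq_cond; apply: sumr_ge0 => y /and3P[/mem_rem yP fy _].
by rewrite subr_ge0 sound_paid_le//; exact: sP.
Qed.

(** For [b = 0], the case of requests of level 0, the quotient is 0 by convention. *)
Lemma ratio_le (a b : R) : 0 <= a <= b + b -> 0 <= a / b <= 2.
Proof.
move=> /andP[a0 ab]; have [b0|b0|b0] := ltgtP 0 b.
- by apply/andP; split; [apply: divr_ge0 => //; exact: ltW|rewrite ler_pdivrMr//; lra].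
- lra.
- by rewrite -b0 invr0 mulr0 lexx/= ler0n.
Qed.

Lemma weight_fresh_ge t P x : structured t P -> x \in P -> fresh x ->
  4 + 4 * n%:R <= weight t x.
Proof.
move=> SP xP fx; have /ratio_le/andP[_ h] := fresh_residual SP xP fx.
move: fx; rewrite /fresh /weight; case: (timer x) => // _.
by rewrite lerDl mulr_ge0 ?mulr_ge0// subr_ge0.
Qed.

Lemma weight_touched_ge t x : sound t x -> timer x -> 2 <= weight t x.
Proof.
rewrite /weight => -[_ _]; case: (timer x) => // tau [l0 bl ln _ _] _.
by rewrite lerDl mulr_ge0// ln_ge0// ler_pdivlMr// mul1r ltW.
Qed.

Lemma weight_raised t tau theta x : need x <= theta -> 0 < theta -> 
  theta < n%:R * need x -> weight t (raised theta tau x) <= 2 + 4 * n%:R.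
Proof.
move=> bl l0 ln; rewrite /weight /= -[need _]/(need x) lerD2l ler_wpM2l//.
have b0 : 0 < need x by rewrite ltNge; apply/negP => h; have := ler0n R n; nra.
have r0 : 0 < n%:R * need x / theta by rewrite divr_gt0// (lt_trans l0).
have le_n : n%:R * need x / theta <= n%:R by rewrite ler_pdivrMr// ler_wpM2l.
apply: le_trans (_ : n%:R * need x / theta <= _) => //.
move: r0; set r := _ / theta => r0.
(* The crude bound ln r <= r - 1 is enough, since the measure need only be polynomial. *)
have := @le_ln1Dx R (r - 1); rewrite (_ : 1 + (r - 1) = r); last lra.
by move=> h; apply: le_trans (h _) _; lra.
Qed.

Lemma measure_ge0 t P : structured t P -> 0 <= measure t P.
Proof.
move=> SP; have [_ sP _] := SP; rewrite !addr_ge0 ?ler0n//.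
  by rewrite mulr_ge0// /arrival_weight; have := ler0n R n; have := ler0n R N; lra.
rewrite big_seq; apply: sumr_ge0 => x xP; have sx := sP _ xP.
have [tx|fx] := boolP (isSome (timer x)).
  by apply: le_trans (weight_touched_ge sx tx).
by apply: le_trans (weight_fresh_ge SP xP fx); have := ler0n R n; lra.
Qed.

Lemma sum_finish t tau theta P E (h : entry -> R) :
  \sum_(z <- finish theta tau E (kept theta P) (eligible theta t P)) h z =
  \sum_(y <- P) (if level y <= theta then
     if (cheap I theta \notin fam_of y) && (E \notin fam_of y)
     then h (raised theta tau (refresh t y)) else 0 else h y).
Proof.
rewrite finishE big_cat/= big_rev big_map/= big_filter eligibleE big_rev big_map big_filter_cond.
rewrite keptE big_rev big_filter [X in X + _]big_mkcond [X in _ + X]big_mkcond -big_split/=.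
apply: eq_bigr => y _; rewrite /is_eligible ltNge.
case: (level y <= theta) => /=; last by rewrite add0r.
rewrite addr0; have -> : fam_of (refresh t y) = fam_of y by rewrite /fam_of idx_refresh.
by [].
Qed.

(** No weight grows, and the request that fired at level [L] loses at least 2, whether it is served,
    touched for the first time, or raised from [L] to [2 L]. *)
Lemma measure_service t tau L P E :
  let theta := L + L in
  structured t P -> candidate t P = Some L -> t <= tau ->
  measure t (finish theta tau E (kept theta P) (eligible theta t P)) + 1 <= measure t P.
Proof.
move=> theta SP cand ttau; have [uP sP hP] := SP.
have L0 : 0 <= L := candidate_ge0 SP cand.
pose c y := if level y <= theta then
   if (cheap I theta \notin fam_of y) && (E \notin fam_of y)
   then weight t (raised theta tau (refresh t y)) else 0 else weight t y.
have raise y : y \in P -> level y <= theta -> cheap I theta \notin fam_of y ->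
   [/\ need y <= theta, 0 < theta & theta < n%:R * need y].
  move=> yP ly cy; have sy := sP _ yP; have [_ hb hy] := sy.
  have xQ : refresh t y \in eligible theta t P by apply/mem_eligible; exists y.
  have [_ th0] := eligible_paid valid_rq SP cand xQ.
  have hn := cheapN_need cy hb; split=> //.
  move: hy; case: (timer y) => [tau'|]; first by move=> [_ h _ _ _]; exact: le_trans h ly.
  by move=> [h _]; rewrite -h.
have wr y : need (refresh t y) = need y by rewrite /need idx_refresh.
have c_le y : y \in P -> c y <= weight t y.
  move=> yP; rewrite /c; case: ifP => // ly; have sy := sP _ yP.
  have [ty|fy] := boolP (isSome (timer y)).
    case: ifP => [/andP[cy _]|_]; last by apply: le_trans (weight_touched_ge sy ty).
    have [by' th0 hn] := raise _ yP ly cy; have [_ _] := sy.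
    rewrite /weight /= -[need (raised _ _ _)]/(need (refresh t y)) wr.
    case: (timer y) ty => // tau' _ [l0 _ _ _ _]; rewrite lerD2l ler_wpM2l//.
    have nb0 : 0 < n%:R * need y by apply: lt_trans hn.
    by rewrite ler_ln ?posrE ?divr_gt0// ler_pM2l// lef_pV2 ?posrE.
  apply: le_trans (weight_fresh_ge SP yP fy).
  case: ifP => [/andP[cy _]|_]; last by have := ler0n R n; lra.
  have [by' th0 hn] := raise _ yP ly cy.
  by apply: le_trans (weight_raised _ _ _ _ _) _; rewrite ?wr//; lra.
have := candidate_spec t P; rewrite cand => -[[x0 [x0P fx0 lx0]] _].
have c_x0 : c x0 + 2 <= weight t x0.
  have lx : level x0 <= theta by rewrite lx0 lerDl.
  have sx := sP _ x0P; rewrite /c lx.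
  have [ty|fy] := boolP (isSome (timer x0)).
    case: ifP => [/andP[cy _]|_]; last by have := weight_touched_ge sx ty; lra.
    have [by' th0 hn] := raise _ x0P lx cy; have [_ _] := sx.
    rewrite /weight /= -[need (raised _ _ _)]/(need (refresh t x0)) wr.
    case: (timer x0) ty => // tau' _ [l0 _ _ _ _].
    have nb0 : 0 < n%:R * need x0 by apply: lt_trans hn.
    have -> : n%:R * need x0 / level x0 = n%:R * need x0 / theta * 2.
      by rewrite /theta -lx0; field; rewrite !gt_eqF// addr_gt0.
    rewrite [ln (_ * 2)]lnM ?posrE ?divr_gt0//.
    (* This is ln(1 + x) <= x at x = -1/2. *)
    have : 2^-1 <= ln 2 :> R.
      have := @le_ln1Dx R (- 2^-1); rewrite (_ : 1 + - 2^-1 = 2^-1); last lra.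
      rewrite lnV ?posrE// => h; rewrite -lerN2; apply: h; lra.
    lra.
  apply: le_trans (weight_fresh_ge SP x0P fy).
  case: ifP => [/andP[cy _]|_]; last by have := ler0n R n; lra.
  have [by' th0 hn] := raise _ x0P lx cy.
  have := @weight_raised t tau theta (refresh t x0); rewrite wr => /(_ by' th0 hn); lra.
rewrite /measure sum_finish -/(c _).
have -> : \sum_(y <- P) c y = c x0 + \sum_(y <- rem x0 P) c y by rewrite (big_rem x0).
have -> : \sum_(y <- P) weight t y = weight t x0 + \sum_(y <- rem x0 P) weight t y.
  by rewrite (big_rem x0).
have : \sum_(y <- rem x0 P) c y <= \sum_(y <- rem x0 P) weight t y.
  by rewrite big_seq [leRHS]big_seq; apply: ler_sum => y /mem_rem; exact: c_le.
by case: overdue; case: overdue => /=; lra.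
Qed.

End Progress.

(** * Waiting for the next event *)

Section Waiting.
Variables (R : realType) (ND : nd_class R) (I : inst ND) (sigma : online_input I).
Local Notation fam := (@Defs.family R ND I).
Local Notation n := (nelt I).
Local Notation elt := 'I_n.
Local Notation N := (size sigma).
Local Notation rq := (@rq R ND I sigma).
Local Notation entry := (entry sigma).
Local Notation release := (@release R ND I).
Local Notation idx := (@idx R ND I sigma).
Hypothesis sorted_sigma : sorted <=%R (map release sigma).
Hypothesis valid_rq : forall i, valid_request (rq i).
Implicit Types (P Q : seq entry) (x y z : entry) (E : {set elt}) (t tau theta : R).

Lemma mem_new_requests t t' (i : 'I_N) :
  (i \in new_requests sigma t t') = (t < release (rq i) <= t').
Proof.
rewrite /new_requests ltNge -!nreleasedP// -leqNgt.
move: (nreleased sigma t) (nreleased sigma t') => a b.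
have [ba|ab] := leqP b a.
  rewrite drop_oversize; last by rewrite size_take_min (leq_trans (geq_minl _ _)).
  by rewrite in_nil; apply/esym/negbTE; rewrite negb_and -!leqNgt -ltnNge; lia.
have mem_take_ord c : (i \in take c (enum 'I_N)) = (i < c)%N.
  have [cN|Nc] := leqP c N; first by rewrite in_take_leq ?size_enum_ord// index_enum_ord.
  rewrite take_oversize; last by rewrite size_enum_ord ltnW.
  by rewrite mem_enum (ltn_trans (ltn_ord i) Nc).
have := cat_take_drop a (take b (enum 'I_N)); rewrite take_takel ?(ltnW ab)// => h.
have : uniq (take b (enum 'I_N)) by rewrite take_uniq// enum_uniq.
rewrite -{1}h cat_uniq => /and3P[_ /hasPn hd _].
have := mem_take_ord b; rewrite -{1}h mem_cat mem_take_ord => <-.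
case: (leqP a i) => hi /=; first by [].
by apply/negP => /hd; rewrite mem_take_ord hi.
Qed.

Lemma wait_untilP t P : 
  match wait_until sigma t (alarm t P) with
  | None => P = [::] /\ forall i, release (rq i) <= t
  | Some t' => [/\ t <= t',
       forall i, t < release (rq i) -> t' <= release (rq i),
       forall a, alarm t P = Some a -> t' <= Num.max t a &
       (exists i, t < release (rq i) <= t') \/
       (exists2 a, alarm t P = Some a & t' = Num.max t a)]
  end.
Proof.
have al := alarm_spec t P.
have hnext : match ohead (drop (nreleased sigma t) sigma) with
  | None => forall i, release (rq i) <= t
  | Some q => exists i, [/\ q = rq i, t < release (rq i) &
               forall j, t < release (rq j) -> release (rq i) <= release (rq j)]
  end.
  case: (ltnP (nreleased sigma t) N) => hN.
    have i0 : 'I_N := Ordinal hN.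
    rewrite (drop_nth (rq (Ordinal hN)))//= -(rq_nth _ (Ordinal hN)).
    exists (Ordinal hN); split => //; first by rewrite ltNge -nreleasedP// ltnn.
    move=> j; rewrite ltNge -(nreleasedP sorted_sigma t) -leqNgt => hj.
    have := sorted_leq_nth le_trans lexx 0 sorted_sigma.
    move=> /(_ (Ordinal hN) j); rewrite !inE !size_map !ltn_ord => /(_ isT isT hj).
    by rewrite !(nth_map (rq j))// -!rq_nth.
  rewrite drop_oversize//= => i; rewrite -nreleasedP//; exact: leq_trans hN.
rewrite /wait_until; case: (alarm t P) al => [a|] al; last first.
  case: (ohead _) hnext => [q [i [-> ti hi]]|hi]; last by split.
  by split=> //; [exact: ltW|left; exists i; rewrite ti lexx].
case: (ohead _) hnext => [q [i [-> ti hi]]|hi]; last first.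
  split=> //; [by rewrite le_max lexx|by move=> i; rewrite ltNge hi|by move=> b [->]|].
  by right; exists a.
split=> //.
- by rewrite le_max lexx.
- move=> j tj; rewrite ge_max (ltW tj)/= ge_min hi ?orbT//.
- by move=> b [<-]; rewrite ge_max !le_max lexx/= [X in _ || X]ge_min lexx orbT.
case: (leP a (release (rq i))) => hai; first by right; exists a.
by left; exists i; rewrite ti le_max lexx orbT.
Qed.

Section Step.
Variables (t t' : R) (P : seq entry).
Hypothesis SP : structured t P.
Hypothesis idle : candidate t P = None.
Hypothesis next : wait_until sigma t (alarm t P) = Some t'.
Let P' := admit_all t' P (new_requests sigma t t').

Lemma idle_quiet x : x \in P -> ~~ fires t P x.
Proof. by have := candidate_spec t P; rewrite idle; apply. Qed.

(** A fresh request of level 0 fires at once, because partial sums are nonnegative. *)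
Lemma idle_level x : x \in P -> 0 < level x.
Proof.
move=> xP; have [_ sP _] := SP; have := idle_quiet xP; have [_ _] := sP _ xP.
rewrite /fires; case: (timer x) => [tau []//|_].
by rewrite -ltNge; apply: le_lt_trans; exact: partial_sum_ge0.
Qed.

Lemma idle_partial_sum c : 0 <= c -> partial_sum t P c <= c.
Proof. by move=> c0; apply: partial_sum_quiet => // x xP _ _; exact: idle_quiet. Qed.

Lemma reach_fresh x : x \in P -> fresh x ->
  let r := reach (idx x) (wait_cost t x + level x / (size P)%:R) in
  t <= r /\ wait_cost r x = wait_cost t x + level x / (size P)%:R.
Proof.
move=> xP fx r; have [_ sP _] := SP; have [rx _ _] := sP _ xP.
have m0 : 0 < level x / (size P)%:R.
  by rewrite divr_gt0 ?idle_level// ltr0n; case: (P) xP.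
have [] := @delay_reach _ _ _ (rq (idx x)) (wait_cost t x + level x / (size P)%:R) (valid_rq _).
  by rewrite ler_wpDr ?(ltW m0)//; exact: delay_homo.
rewrite -/r => h1 h2; split=> //; rewrite leNgt; apply/negP => /ltW /(delay_homo (valid_rq _) h1).
by rewrite h2 leNgt ltrDl m0.
Qed.

Lemma le_next : t <= t'. Proof. by have := wait_untilP t P; rewrite next => -[]. Qed.

Lemma alarm_ge a : alarm t P = Some a -> t <= a.
Proof.
move=> ha; have := alarm_spec t P; rewrite ha => -[[x [xP <-]] _].
have [_ sP _] := SP; have [_ _] := sP _ xP; have := @reach_fresh x xP; rewrite /fresh.
by case: (timer x) => [tau _ []|/(_ isT)[]].
Qed.

Lemma next_le_alarm a : alarm t P = Some a -> t' <= a.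
Proof.
move=> ha; have := wait_untilP t P; rewrite next => -[_ _ /(_ _ ha) h _].
by move: h; rewrite (max_idPr (alarm_ge ha)).
Qed.

Lemma next_touched x tau : x \in P -> timer x = Some tau -> t' <= tau.
Proof.
move=> xP tx; have := alarm_spec t P; case ha: (alarm t P) => [a|] hP.
  apply: le_trans (next_le_alarm ha) _; have [_ /(_ _ xP)] := hP; by rewrite tx.
by rewrite hP in xP.
Qed.

Lemma next_fresh x : x \in P -> fresh x ->
  wait_cost t' x <= wait_cost t x + level x / (size P)%:R.
Proof.
move=> xP fx; have [h1 h2] := reach_fresh xP fx; rewrite -h2.
have [_ sP _] := SP; have [rx _ _] := sP _ xP.
apply: (wait_cost_homo valid_rq); first exact: le_trans le_next.
have := alarm_spec t P; case ha: (alarm t P) => [a|] hP; last by rewrite hP in xP.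
apply: le_trans (next_le_alarm ha) _; have [_ /(_ _ xP)] := hP; move: fx.
by rewrite /fresh; case: (timer x).
Qed.

(** A wait never passes over a release time, so newcomers are released exactly at [t'] and have no
    unpaid delay. *)
Lemma mem_admit z : z \in P' -> z \in P \/ exists i b,
  [/\ t < release (rq i), release (rq i) = t', bottleneck (req (rq i)) = Some b &
      z = (i, (b, (delay (rq i) t', None)))].
Proof.
rewrite /P' admit_allE mem_cat mem_rev => /orP[/mapP[i]|]; last by left.
rewrite mem_filter mem_new_requests => /andP[+ /andP[ti it']] ->.
case hb: (bottleneck _) => [b|//] _; right; exists i, b; split=> //.
apply/eqP; rewrite eq_le it'; have := wait_untilP t P; rewrite next => -[_ h _ _].
exact: h.
Qed.

Lemma structured_admit : structured t' P'.
Proof.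
have [uP sP hP] := SP; have tt' := le_next.
have P'sound : {in P', forall z, sound t' z}.
  move=> z /mem_admit[zP|[i [b [ti <- hb ->]]]].
    have [rz bz hz] := sP _ zP; split=> //; first exact: le_trans tt'.
    case tz: (timer z) hz => [tau|//] [? ? ? _ ?]; split=> //.
    exact: next_touched tz.
  by split; rewrite /arrival/need/= ?hb//.
split=> //.
- rewrite /P' admit_allE map_cat cat_uniq uP andbT map_rev rev_uniq -map_comp map_id.
  apply/andP; split; first by rewrite filter_uniq// drop_uniq// take_uniq// enum_uniq.
  apply/hasPn => i /mapP[x xP ->]; rewrite mem_rev mem_filter mem_new_requests.
  have [rx _ _] := sP _ xP.
  by rewrite ltNge (_ : release (rq (idx x)) <= t)//= andbF.
(* Newcomers contribute 0, and each of the at most [size P] old requests gains at most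
   [c / size P]. *)
- move=> c c0; have h : partial_sum t' P' c <= partial_sum t P c + c.
    have -> : partial_sum t' P' c = partial_sum t' P c.
      rewrite !partial_sumE /P' admit_allE big_cat/= [X in X + _]big1_seq ?add0r//.
      by move=> z /andP[_]; rewrite mem_rev => /mapP[i _ ->]; rewrite /wait_cost/= subrr.
    rewrite !partial_sumE; apply: (@le_trans _ _ (\sum_(y <- P | fresh y && (level y <= c))
       ((wait_cost t y - paid y) + c / (size P)%:R))).
      rewrite big_seq_cond [leRHS]big_seq_cond; apply: ler_sum => x /and3P[xP fx lx].
      rewrite addrAC lerD2r; apply: le_trans (next_fresh xP fx) _.
      by rewrite lerD2l ler_wpM2r.
    rewrite big_split/= lerD2l big_const_seq iter_addr_0.
    have [->|P0] := eqVneq (size P) 0%N; first by rewrite invr0 mulr0 mul0rn.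
    rewrite -[_ *+ _]mulr_natr -mulrA ler_piMr// mulrC ler_pdivrMr ?ltr0n ?lt0n// mul1r ler_nat.
    exact: count_size.
  by apply: le_trans h _; rewrite lerD2r idle_partial_sum.
Qed.

(** An arrival spends its surplus unit, a timer makes [overdue] true, and the alarm of a fresh
    request lowers its weight by 2. *)
Lemma measure_admit : measure t' P' + 1 <= measure t P.
Proof.
have [uP sP hP] := SP; have tt' := le_next.
pose new := [seq i <- new_requests sigma t t' | isSome (bottleneck (req (rq i)))].
have hq : ~~ overdue t P.
  apply/hasPn => x xP; have := idle_quiet xP; rewrite /fires.
  by case: (timer x).
have w_le x : x \in P -> weight t' x <= weight t x.
  move=> xP; have [rx _ _] := sP _ xP; rewrite /weight; case: (timer x) => // .
  rewrite lerD2l ler_wpM2l ?mulr_ge0// lerD2l lerN2 ler_wpM2r//.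
    by rewrite invr_ge0; exact/ltW/idle_level.
  by rewrite lerD2r; exact: (wait_cost_homo valid_rq).
have sumE : \sum_(z <- P') weight t' z = \sum_(z <- P) weight t' z +
   \sum_(i <- new) (4 + 4 * n%:R + 4 * N%:R).
  rewrite /P' admit_allE big_cat/= addrC; congr (_ + _).
  rewrite big_rev big_map; apply: eq_bigr => i _.
  rewrite /weight /wait_cost /= subrr mul0r subr0; ring.
have newE : (future sigma t' + size (new_requests sigma t t') <= future sigma t)%N.
  have -> : size (new_requests sigma t t') = #|[set i in new_requests sigma t t']|.
    rewrite cardsE; apply/esym/card_uniqP.
    by rewrite /new_requests drop_uniq// take_uniq// enum_uniq.
  rewrite /future -finset.cardsUI [X in (_ + X)%N](_ : _ = 0%N) ?addn0.
    apply/subset_leq_card/fintype.subsetP => i.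
    rewrite !inE mem_new_requests => /orP[|/andP[]//]; exact: le_lt_trans.
  apply/eqP; rewrite cards_eq0; apply/eqP/setP => i; rewrite !inE mem_new_requests.
  by apply/negbTE/negP => /andP[h /andP[_]]; rewrite leNgt h.
have size_new : (size new <= size (new_requests sigma t t'))%N by rewrite size_filter count_size.
rewrite /measure sumE big_const_seq count_predT iter_addr_0 hq.
have hW : arrival_weight sigma * (future sigma t')%:R + (4 + 4 * n%:R + 4 * N%:R) *+ size new
   + (size (new_requests sigma t t'))%:R <= arrival_weight sigma * (future sigma t)%:R.
  have : arrival_weight sigma * (future sigma t' + size (new_requests sigma t t'))%:R <=
    arrival_weight sigma * (future sigma t)%:R.
    rewrite ler_wpM2l ?ler_nat// /arrival_weight.
    by have := ler0n R n; have := ler0n R N; lra.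
  rewrite natrD mulrDr => h; apply: le_trans h.
  rewrite -addrA lerD2l -[_ *+ size new]mulr_natr /arrival_weight.
  have : (size new)%:R <= (size (new_requests sigma t t'))%:R :> R by rewrite ler_nat.
  have := ler0n R n; have := ler0n R N; have := ler0n R (size new).
  move: n%:R N%:R (size new)%:R (size (new_requests sigma t t'))%:R => a b c d c0 b0 a0 cd.
  nra.
have hsum : \sum_(z <- P) weight t' z <= \sum_(z <- P) weight t z.
  by rewrite big_seq [leRHS]big_seq; apply: ler_sum.
have := wait_untilP t P; rewrite next => -[_ _ _ [[i hi]|[a ha ht']]].
  have : (1 <= size (new_requests sigma t t'))%N.
    by rewrite -mem_new_requests in hi; case: (new_requests _ _ _) hi.
  rewrite -(ler_nat R) => h; case: (overdue _ _) => /=; lra.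
rewrite (max_idPr (alarm_ge ha)) in ht'.
have s0 := ler0n R (size (new_requests sigma t t')).
have := alarm_spec t P; rewrite ha => -[[x [xP hx]] _].
case tx: (timer x) hx => [tau|] hx.
  have -> : overdue t' P'.
    apply/hasP; exists x; last by rewrite tx hx ht'.
    by rewrite /P' admit_allE mem_cat xP orbT.
  rewrite /=; lra.
have fx : fresh x by rewrite /fresh tx.
have [_ hw] := reach_fresh xP fx; rewrite hx -ht' in hw.
have : weight t' x + 2 <= weight t x.
  rewrite /weight tx hw; set r := wait_cost t x - paid x.
  have -> : wait_cost t x + level x / (size P)%:R - paid x = r + level x / (size P)%:R.
    rewrite /r; lra.
  have l0 := idle_level xP; have sP0 : 0 < (size P)%:R :> R by rewrite ltr0n; case: (P) xP.
  have -> : (r + level x / (size P)%:R) / level x = r / level x + (size P)%:R^-1.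
    by field; rewrite !gt_eqF.
  (* Pending requests have distinct indices, hence there are at most [N] of them. *)
  have hN : 1 <= N%:R * (size P)%:R^-1 :> R.
    by rewrite ler_pdivlMr// mul1r ler_nat (size_structured SP).
  nra.
move=> h2.
have e1 : \sum_(z <- P) weight t' z = weight t' x + \sum_(z <- rem x P) weight t' z.
  by rewrite (big_rem x).
have e2 : \sum_(z <- P) weight t z = weight t x + \sum_(z <- rem x P) weight t z.
  by rewrite (big_rem x).
have hrem : \sum_(z <- rem x P) weight t' z <= \sum_(z <- rem x P) weight t z.
  by rewrite big_seq [leRHS]big_seq; apply: ler_sum => y /mem_rem; exact: w_le.
case: (overdue _ _) => /=; lra.
Qed.

End Step.
End Waiting.

(** * Charging the optimum *)

Section Accounting.
Variables (R : realType) (ND : nd_class R) (I : inst ND) (sigma : online_input I).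
Local Notation fam := (@Defs.family R ND I).
Local Notation n := (nelt I).
Local Notation elt := 'I_n.
Local Notation N := (size sigma).
Local Notation rq := (@rq R ND I sigma).
Local Notation entry := (entry sigma).
Local Notation release := (@release R ND I).
Local Notation idx := (@idx R ND I sigma).
Hypothesis sorted_sigma : sorted <=%R (map release sigma).
Hypothesis valid_rq : forall i, valid_request (rq i).
Implicit Types (P Q : seq entry) (x y z : entry) (E : {set elt}) (t tau theta : R).

Definition update (f : entry -> R) P (h : 'I_N -> R) (i : 'I_N) : R :=
  foldr (fun x a => if idx x == i then f x else a) (h i) P.

Lemma update_out f P h i : i \notin map idx P -> update f P h i = h i.
Proof.
elim: P => //= x P IH; rewrite inE negb_or => /andP[ix iP].
by rewrite /update/= eq_sym (negbTE ix); exact: IH.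
Qed.

Lemma update_in f P h x : uniq (map idx P) -> x \in P -> update f P h (idx x) = f x.
Proof.
elim: P => //= y P IH /andP[yP uP]; rewrite inE /update/= => /predU1P[->|xP].
  by rewrite eqxx.
by case: eqP => [yx|_]; [rewrite yx map_f in yP|exact: IH].
Qed.

Lemma sum_update f P h : uniq (map idx P) ->
  \sum_i update f P h i = \sum_i h i + \sum_(x <- P) (f x - h (idx x)).
Proof.
elim: P => [|x P IH] /=; first by rewrite big_nil addr0.
move=> /andP[xP uP]; rewrite big_cons addrCA -IH//.
rewrite (bigD1 (idx x))//= [in RHS](bigD1 (idx x))//= {1}/update/= eqxx.
rewrite (update_out f h xP) addrA subrK; congr (_ + _).
by apply: eq_bigr => i; rewrite eq_sym => ix; rewrite /update/= (negbTE ix).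
Qed.

Definition base (i : 'I_N) : R := delay (rq i) (release (rq i)).

Definition accounted t P (S : schedule I) (Theta : R) (H : 'I_N -> R) : Prop :=
  [/\ {in P, forall x, H (idx x) = paid x},
      forall i, release (rq i) <= t -> bottleneck (req (rq i)) -> i \notin map idx P ->
        exists s, [/\ s \in S, release (rq i) <= s.1, s.2 \in fam (req (rq i)) &
                      delay (rq i) s.1 <= H i],
      \sum_(s <- S) set_cost s.2 + \sum_i (H i - base i) <= 6 * Theta &
      forall i, t < release (rq i) -> H i = base i].

Lemma accounted_start : accounted (-1) [::] [::] 0 base.
Proof.
split=> // [i h|]; last by rewrite big_nil mulr0 add0r big1// => i _; rewrite subrr.
by have [h0 _ _ _ _] := valid_rq i; have := le_trans h0 h; rewrite ler0N1.
Qed.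

Lemma accounted_admit t t' P S Theta H :
  structured t P -> candidate t P = None -> wait_until sigma t (alarm t P) = Some t' ->
  accounted t P S Theta H ->
  accounted t' (admit_all t' P (new_requests sigma t t')) S Theta H.
Proof.
move=> SP idle next [ha hb hc hd]; split=> //.
- move=> x /(mem_admit sorted_sigma next)[/ha//|[i [b [ti <- _ ->]]]].
  exact: hd.
- move=> i it' hbn iP'; case: (leP (release (rq i)) t) => ti.
    apply: hb => //; apply: contra iP'; rewrite admit_allE map_cat mem_cat => ->.
    by rewrite orbT.
  case/negP: iP'; rewrite admit_allE map_cat mem_cat map_rev mem_rev -map_comp map_id.
  by rewrite mem_filter hbn mem_new_requests// ti it'.
- move=> i t'i; apply: hd; apply: le_lt_trans t'i.
  exact: (le_next sorted_sigma next).
Qed.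

Lemma cheap_cost theta : 0 <= theta -> set_cost (cheap I theta) <= theta.
Proof.
move=> th0; case: (posnP n) => [n0|n0].
  by rewrite /set_cost big_pred0// => e; have := ltn_ord e; rewrite {2}n0.
have n0' : 0 < n%:R :> R by rewrite ltr0n.
apply: (@le_trans _ _ (\sum_(e : elt) theta / n%:R)).
  rewrite /set_cost big_mkcond; apply: ler_sum => e _; case: ifP; last by rewrite divr_ge0.
  by rewrite inE ler_pdivlMr.
by rewrite sumr_const card_ord -[_ *+ n]mulr_natr divfK// gt_eqF.
Qed.

Lemma sum_eligible theta t P (p : pred entry) (h : entry -> R) :
  \sum_(x <- eligible theta t P | p x) h x =
  \sum_(y <- P | is_eligible theta y && p (refresh t y)) h (refresh t y).
Proof. by rewrite eligibleE big_rev/= big_map big_filter_cond. Qed.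

Lemma fam_refresh t x : fam_of (refresh t x) = fam_of x.
Proof. by rewrite /fam_of idx_refresh. Qed.

Section Service.
Variables (t tau L : R) (P : seq entry) (E : {set elt}) (S : schedule I).
Let theta := L + L.
Let Q := eligible theta t P.
Let P' := finish theta tau E (kept theta P) Q.
Hypothesis SP : structured t P.
Hypothesis cand : candidate t P = Some L.
Hypothesis ttau : t <= tau.

(** Also defined for requests that get served: their last [paid] value bounds their final delay and
    has to be accounted for. *)
Definition serviced y : entry :=
  if level y <= theta then
    if (cheap I theta \notin fam_of y) && (E \notin fam_of y)
    then raised theta tau (refresh t y) else refresh t y
  else y.

Lemma mem_serviced z : z \in P' -> exists y, [/\ y \in P, z = serviced y & idx z = idx y].
Proof.
move=> /mem_finish[[zP lz]|[x /mem_eligible[y [yP ly cy ->]] [Ex ->]]].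
  by exists z; rewrite /serviced leNgt lz.
exists y; split=> //; last by rewrite /= -[LHS]/(idx (refresh t y)) idx_refresh.
by rewrite /serviced ly cy -(fam_refresh t) Ex.
Qed.

Lemma serviced_left y : y \in P -> idx y \notin map idx P' ->
  [/\ level y <= theta, serviced y = refresh t y &
      (cheap I theta \in fam_of y) || (E \in fam_of y)].
Proof.
move=> yP yP'; have ly : level y <= theta.
  rewrite leNgt; apply: contra yP' => ly; apply/mapP; exists y => //.
  by rewrite /P' finishE mem_cat orbC keptE mem_rev mem_filter ly yP.
have hy : (cheap I theta \in fam_of y) || (E \in fam_of y).
  apply: contraR yP'; rewrite negb_or => /andP[cy Ey].
  apply/mapP; exists (raised theta tau (refresh t y)); last by rewrite /= -[RHS]/(idx (refresh t y)) idx_refresh.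
  rewrite /P' finishE mem_cat mem_rev; apply/orP; left; apply/mapP; exists (refresh t y) => //.
  by rewrite mem_filter fam_refresh Ey; apply/mem_eligible; exists y.
by split=> //; rewrite /serviced ly -negb_or hy.
Qed.

(** Fresh requests up to level [theta] are brought up to time [t], and those left over then pay
    their penalty up to [tau]. *)
Lemma paid_serviced : \sum_(y <- P) (paid (serviced y) - paid y) =
  partial_sum t P theta + unserved tau Q E.
Proof.
rewrite /unserved sum_eligible partial_sumE [X in X + _]big_mkcond [X in _ + X]big_mkcond.
rewrite -big_split; apply: eq_bigr => y _; rewrite /serviced /is_eligible fam_refresh /=.
case: (level y <= theta); rewrite /= ?andbT ?andbF ?subrr ?addr0//.
rewrite /penalty; case: (_ && _); rewrite /refresh /fresh; case: (timer y) => [tm|] /=;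
  rewrite ?addr0 ?add0r ?subrr//.
by rewrite /wait_cost /paid/=; ring.
Qed.

Lemma accounted_service Theta H : set_cost E <= theta ->
  unserved tau Q E <= theta + theta -> accounted t P S Theta H ->
  accounted t P' (rcons (rcons S (t, cheap I theta)) (t, E)) (Theta + theta)
    (update (fun y => paid (serviced y)) P H).
Proof.
move=> cE uE [ha hb hc hd]; have [uP sP hP] := SP.
have th0 : 0 <= theta by have := candidate_ge0 SP cand; rewrite /theta; lra.
split.
- move=> z /mem_serviced[y [yP -> ->]]; rewrite update_in//.
- move=> i it bi iP'; have [/mapP[y yP yi]|iP] := boolP (i \in map idx P); last first.
    have [s [sS rs Es ds]] := hb i it bi iP.
    by exists s; rewrite update_out//; split=> //; rewrite -!cats1 !mem_cat sS.
  rewrite yi in iP' it *; have [ly hs hy] := serviced_left yP iP'.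
  have dy : wait_cost t y <= paid (refresh t y).
    have := sound_paid_ge valid_rq (sP _ yP); rewrite /refresh.
    by case: (timer y) => [tm|]; [apply|].
  exists (t, if cheap I theta \in fam_of y then cheap I theta else E).
  rewrite update_in//= hs; split=> //.
    by rewrite -!cats1 !mem_cat !mem_seq1; case: ifP => _; rewrite eqxx ?orbT.
  by rewrite -[fam _]/(fam_of y); case: ifP hy.
- rewrite -!cats1 !big_cat !big_seq1/= sumrB sum_update//.
  have -> : \sum_(x <- P) (paid (serviced x) - H (idx x)) =
      \sum_(x <- P) (paid (serviced x) - paid x).
    by rewrite !big_seq; apply: eq_bigr => x xP; rewrite ha.
  (* Two transmissions of cost at most [theta] each, unpaid delays and penalties of at most
     [2 theta] each: the factor 6. *)
  rewrite paid_serviced; have := hP _ th0; have := cheap_cost th0.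
  move: hc; rewrite sumrB; lra.
- move=> i ti; rewrite update_out; first exact: hd.
  apply/negP => /mapP[y yP yi]; have [ry _ _] := sP _ yP.
  by move: ti; rewrite yi ltNge (_ : release (rq (idx y)) <= t).
Qed.

End Service.
End Accounting.

(** * A logarithmic potential for one element *)

Section Potential.
Variable R : realType.
Implicit Types (x y c g m L : R).

(* A potential for the charges of one element: doubling the value of a service
   increases [spread k] by a constant, and [k + 1] bounds it. *)
Definition spread (k : nat) x : R := \sum_(j < k.+1) Num.min 1 (x / 2 ^+ j).

Lemma spread_homo k x y : x <= y -> spread k x <= spread k y.
Proof.
move=> xy; apply: ler_sum => j _; rewrite le_min !ge_min lexx/=.
by rewrite ler_wpM2r ?orbT// invr_ge0 exprn_ge0.
Qed.

Lemma spread_le k x : spread k x <= k.+1%:R.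
Proof.
apply: (@le_trans _ _ (\sum_(j < k.+1) 1)); last by rewrite sumr_const card_ord.
by apply: ler_sum => j _; rewrite ge_min lexx.
Qed.

Lemma spread0 k : spread k 0 = 0.
Proof. by rewrite /spread big1// => j _; rewrite mul0r (min_idPr ler01). Qed.

(** Doubling shifts the index by one, so everything cancels except the new first term min(1, 2x) and
    the old last term [x / 2 ^+ k], which is at most 1/2 and at most [x]. *)
Lemma spread_double k x : 0 <= x -> x <= 2 ^+ k / 2 ->
  Num.min 1 x / 2 <= spread k (2 * x) - spread k x.
Proof.
move=> x0 xk; rewrite /spread big_ord_recl big_ord_recr /= expr0 divr1.
rewrite (eq_bigr (fun j : 'I_k => Num.min 1 (x / 2 ^+ j))); last first.
  move=> j _; congr Num.min; rewrite /bump/= add1n exprS.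
  by field; rewrite expf_neq0.
set s := \sum_(j < k) _; have p0 : 0 < (2 : R) ^+ k by rewrite exprn_gt0.
have p1 : 1 <= (2 : R) ^+ k by rewrite exprn_ege1// ler1n.
have h1 : x / 2 ^+ k <= 2^-1 by rewrite ler_pdivrMr// mulrC.
have h2 : x / 2 ^+ k <= x by rewrite ler_pdivrMr// ler_peMr.
rewrite (min_idPr (le_trans h1 _)); last lra.
by case: (leP 1 x) => hx; case: (leP 1 (2 * x)) => hx2; lra.
Qed.

(** What an element of cost [c] transmitted by the optimum has been charged when [m] is the largest
    value of a service since then. For [c = 0] it vanishes. *)
Definition toll (k : nat) g c m : R := g * c * spread k (m / (g * c)).

Lemma toll_homo k g c m m' : 0 <= g -> 0 <= c -> m <= m' -> toll k g c m <= toll k g c m'.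
Proof.
move=> g0 c0 mm'; rewrite ler_wpM2l ?mulr_ge0// spread_homo//.
by rewrite ler_wpM2r// invr_ge0 mulr_ge0.
Qed.

Lemma toll_le k g c m : 0 <= g -> 0 <= c -> toll k g c m <= g * k.+1%:R * c.
Proof.
move=> g0 c0; rewrite /toll mulrAC ler_wpM2r// ler_wpM2l//; exact: spread_le.
Qed.

Lemma toll0 k g c : toll k g c 0 = 0.
Proof. by rewrite /toll mul0r spread0 mulr0. Qed.

Lemma toll_gain k g c m L : 0 < g -> 0 < c -> 0 <= L -> m <= L -> L <= 2 ^+ k / 2 * (g * c) ->
  Num.min (g * c) L / 2 <= toll k g c (L + L) - toll k g c m.
Proof.
move=> g0 c0 L0 mL hL; have gc : 0 < g * c by rewrite mulr_gt0.
have h := toll_homo k (ltW g0) (ltW c0) mL.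
apply: (@le_trans _ _ (toll k g c (L + L) - toll k g c L)); last by rewrite lerD2l lerN2.
have x0 : 0 <= L / (g * c) by rewrite divr_ge0// ltW.
have := @spread_double k (L / (g * c)) x0; rewrite ler_pdivrMr// => /(_ hL) hs.
have -> : toll k g c (L + L) = g * c * spread k (2 * (L / (g * c))).
  by rewrite /toll; congr (_ * spread k _); rewrite mulrA mulr_natl mulr2n.
rewrite /toll -mulrBr; apply: le_trans (_ : g * c * (Num.min 1 (L / (g * c)) / 2) <= _).
  rewrite mulrA ler_wpM2r// minr_pMr ?(ltW gc)// mulr1.
  by rewrite [g * c * (L / _)]mulrC divfK ?gt_eqF.
by rewrite ler_pM2l.
Qed.

End Potential.

Lemma sum_uniq_le (R : realType) (T : finType) (s : seq T) (h : T -> R) :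
  uniq s -> (forall i, 0 <= h i) -> \sum_(i <- s) h i <= \sum_i h i.
Proof.
move=> us h0; rewrite big_uniq// [leRHS](bigID (mem s))/= lerDl.
by apply: sumr_ge0.
Qed.

(** * Charging each service to a schedule *)

Section Ledger.
Variables (R : realType) (ND : nd_class R) (I : inst ND) (sigma : online_input I).
Local Notation fam := (@Defs.family R ND I).
Local Notation n := (nelt I).
Local Notation elt := 'I_n.
Local Notation N := (size sigma).
Local Notation rq := (@rq R ND I sigma).
Local Notation entry := (entry sigma).
Local Notation release := (@release R ND I).
Local Notation idx := (@idx R ND I sigma).
Hypothesis sorted_sigma : sorted <=%R (map release sigma).
Hypothesis valid_rq : forall i, valid_request (rq i).
Implicit Types (P Q : seq entry) (x y z : entry) (E : {set elt}) (t tau theta : R).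

Variables (g : R) (k : nat) (Sopt : schedule I) (sv : 'I_N -> R).
Hypothesis g1 : 1 <= g.
Hypothesis kn : 4 * n%:R <= 2 ^+ k :> R.
Hypothesis opt_serves : forall i, exists E,
  [/\ (sv i, E) \in Sopt, release (rq i) <= sv i & E \in fam (req (rq i))].

Let D i := delay (rq i) (sv i).
Local Notation base := (@base R ND I sigma).

(** Tolls are paid by the transmissions of [Sopt]. Charged delay counts only up to [D i], the delay
    that [Sopt] itself pays, and above the delay at release. *)
Definition potential (M : R -> R) (chg : 'I_N -> R) : R :=
  \sum_(s <- Sopt) \sum_(e in s.2) toll k g (cost e) (M s.1) +
  g * \sum_i (Num.min (chg i) (D i) - base i).

(* The requests [A] with penalties [pi] certify that serving or delaying them
   costs at least [lev / g]; these penalties have not been charged yet, and they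
   are delays that an unserved request has suffered at time [tau]. *)
Definition evidence (lev tau : R) (M : R -> R) (own top chg : 'I_N -> R) : Prop :=
  exists A (pi : 'I_N -> R),
  [/\ uniq A,
      {in A, forall i, [/\ own i = lev, M (release (rq i)) <= lev, release (rq i) <= tau,
         0 <= pi i & chg i + pi i <= top i]},
      {in A, forall i, pi i = 0 \/ chg i + pi i <= delay (rq i) tau} &
      forall E, lev <= g * (set_cost E + \sum_(i <- A | E \notin fam (req (rq i))) pi i)].

(* [M s]: the largest value of a service at time [s] or later.
   [own i]: the value of the last service dealing with request [i], 0 if none.
   [top i]: the delay of request [i] that the algorithm has taken into account.
   [chg i]: the part of it that was already charged to the optimum. *)
Record ledger t P (M : R -> R) (own top chg : 'I_N -> R) : Prop := Ledger {
  mark_mono : forall r s, r <= s -> M s <= M r;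
  mark_future : forall s, t < s -> M s = 0;
  mark_level : {in P, forall x, M (arrival x) <= level x};
  own_touched : {in P, forall x, timer x -> own (idx x) = level x};
  own_fresh : {in P, forall x, fresh x -> own (idx x) = 0};
  own_future : forall i, t < release (rq i) -> own i = 0;
  chg_top : forall i, chg i <= top i;
  top_paid : {in P, forall x, top (idx x) = paid x};
  top_future : forall i, t < release (rq i) -> top i = base i /\ chg i = base i;
  chg_fresh : {in P, forall x, fresh x -> chg (idx x) = paid x};
  has_evidence : {in P, forall x tau, timer x = Some tau ->
                    evidence (level x) tau M own top chg}
}.

Lemma mark_ge0 t P M own top chg : ledger t P M own top chg -> forall s, 0 <= M s.
Proof.
move=> [mono fut _ _ _ _ _ _ _ _ _] s; rewrite -(fut (Num.max s t + 1)).
  by apply: mono; rewrite (le_trans (y := Num.max s t)) ?le_max ?lexx// lerDl.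
by rewrite (le_lt_trans (y := Num.max s t)) ?le_max ?lexx ?orbT// ltrDl.
Qed.

Lemma ledger_start : ledger (-1) [::] (fun=> 0) (fun=> 0) base base.
Proof. by split. Qed.

Lemma ledger_admit t t' P M own top chg :
  structured t P -> candidate t P = None -> wait_until sigma t (alarm t P) = Some t' ->
  ledger t P M own top chg ->
  ledger t' (admit_all t' P (new_requests sigma t t')) M own top chg.
Proof.
move=> SP idle next [mono fut lev otouch ofresh ofut ct tp tf cf ev].
have tt' := le_next sorted_sigma next; have memP := mem_admit sorted_sigma next.
split=> //.
- by move=> s t's; apply: fut; exact: le_lt_trans t's.
- move=> x /memP[/lev//|[i [b [ti _ hb ->]]]].
  rewrite fut//; have := bottleneck_spec (req (rq i)); by rewrite hb => -[].
- by move=> x /memP[/otouch//|[i [b [ti _ hb ->]]]].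
- by move=> x /memP[/ofresh//|[i [b [ti _ hb ->]]]] _; exact: ofut.
- by move=> i t'i; apply: ofut; exact: le_lt_trans t'i.
- move=> x /memP[/tp//|[i [b [ti it' hb ->]]]]; rewrite (tf _ ti).1 /base it'//.
- by move=> i t'i; apply: tf; exact: le_lt_trans t'i.
- move=> x /memP[/cf//|[i [b [ti it' hb ->]]]] _; rewrite (tf _ ti).2 /base it'//.
- by move=> x /memP[/ev//|[i [b [ti it' hb ->]]]].
Qed.

Section Service.
Variables (t tau L : R) (P : seq entry) (E : {set elt}).
Let theta := L + L.
Let Q := eligible theta t P.
Let P' := finish theta tau E (kept theta P) Q.
Hypothesis SP : structured t P.
Hypothesis cand : candidate t P = Some L.
Hypothesis ttau : t <= tau.
Hypothesis certified : {in Q, forall x, E \in fam_of x} \/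
  theta <= g * pc_opt (pc_instance tau Q).
Variables (M : R -> R) (own top chg : 'I_N -> R).
Hypothesis LP : ledger t P M own top chg.

Let up y := if level y <= theta then refresh t y else y.
Let M' s := if s <= t then Num.max (M s) theta else M s.
Let own' := update (fun y => if is_eligible theta y then theta else own (idx y)) P own.
Let top1 := update (fun y => paid (up y)) P top.
Let top' := update (fun y => if is_eligible theta y
  then Num.max (wait_cost tau y) (paid (up y)) else paid (up y)) P top.
(** Delay accounted for so far is charged now, except for requests whose last service was above
    [theta]: their uncharged penalties may be evidence for entries of higher level. The penalties of
    the present service are not in [top1]; they become new evidence. *)
Let chg' i := if own i <= theta then top1 i else chg i.

Let L0 : 0 <= L. Proof. exact: candidate_ge0 SP cand. Qed.
Let th0 : 0 <= theta. Proof. by rewrite addr_ge0. Qed.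
Let uP : uniq (map idx P). Proof. by have [] := SP. Qed.
Let sP x : x \in P -> sound t x. Proof. by have [_ + _] := SP; apply. Qed.

Let paid_up y : y \in P -> paid y <= paid (up y).
Proof.
move=> yP; rewrite /up; case: ifP => // _; have := sound_paid_le valid_rq (sP yP).
by rewrite /refresh /fresh; case: (timer y) => // /(_ isT).
Qed.

Let top_top1 i : top i <= top1 i.
Proof.
have [/mapP[y yP ->]|iP] := boolP (i \in map idx P); last by rewrite /top1 update_out.
by rewrite /top1 update_in// (top_paid LP yP) paid_up.
Qed.

Let top1_top' i : top1 i <= top' i.
Proof.
have [/mapP[y yP ->]|iP] := boolP (i \in map idx P); last by rewrite /top1 /top' !update_out.
by rewrite /top1 /top' !update_in//; case: ifP => // _; rewrite le_max lexx orbT.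
Qed.

Let chg_chg' i : chg i <= chg' i.
Proof. by rewrite /chg'; case: ifP => // _; apply: le_trans (chg_top LP i) (top_top1 i). Qed.

Let out_future i : t < release (rq i) -> i \notin map idx P.
Proof.
move=> ti; apply/negP => /mapP[y yP yi]; have [ry _ _] := sP yP.
by move: ti; rewrite yi ltNge (_ : release (rq (idx y)) <= t).
Qed.

Let own_le y : y \in P -> level y <= theta -> own (idx y) <= theta.
Proof.
move=> yP ly; have [ty|fy] := boolP (isSome (timer y)); first by rewrite (own_touched LP).
by rewrite (own_fresh LP).
Qed.

(** A service of value [theta] touches only entries of level at most [theta], and for these [own] is
    at most [theta]. This is what keeps older evidence of higher level valid. *)
Let own_gt i : theta < own i ->
  [/\ own' i = own i, top' i = top i & chg' i = chg i].
Proof.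
move=> hi; rewrite /chg' leNgt hi /=.
have [/mapP[y yP yi]|iP] := boolP (i \in map idx P); last by rewrite /own' /top' !update_out.
have ly : (level y <= theta) = false.
  by apply/negP => /(own_le yP); rewrite -yi leNgt hi.
by rewrite yi /own' /top' !update_in// /is_eligible /up ly/= (top_paid LP yP).
Qed.

Let M'_le s c : M s <= c -> theta <= c -> M' s <= c.
Proof. by move=> h1 h2; rewrite /M'; case: ifP => // _; rewrite ge_max h1. Qed.

Lemma ledger_finish : ledger t P' M' own' top' chg'.
Proof.
have cases z : z \in P' -> (z \in P /\ theta < level z) \/ exists y,
    [/\ y \in P, level y <= theta, is_eligible theta y, E \notin fam_of y &
        z = raised theta tau (refresh t y)].
  move=> /mem_finish[|[x /mem_eligible[y [yP ly cy ->]] [Ex ->]]]; [by left|right].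
  by exists y; rewrite /is_eligible ly cy -(fam_refresh t).
have keptE y : theta < level y -> [/\ is_eligible theta y = false & up y = y].
  by move=> ly; rewrite /is_eligible /up leNgt ly.
have idxr y : idx (raised theta tau (refresh t y)) = idx y.
  by rewrite -[LHS]/(idx (refresh t y)) idx_refresh.
split.
- move=> r s rs; rewrite /M'; case: (leP s t) => st.
    by rewrite (le_trans rs st) ge_max !le_max (mark_mono LP rs) lexx orbT.
  by rewrite (mark_future LP st); case: ifP; rewrite ?le_max (mark_ge0 LP).
- by move=> s ts; rewrite /M' leNgt ts/= (mark_future LP).
- move=> z /cases[[zP lz]|[y [yP ly _ _ ->]]].
    by apply: M'_le (ltW lz); exact: (mark_level LP).
  apply: M'_le => //; rewrite /arrival idxr; apply: le_trans ly.
  exact: (mark_level LP).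
- move=> z /cases[[zP lz]|[y [yP ly ey _ ->]]] tz.
    by rewrite /own' update_in// (keptE z lz).1 (own_touched LP).
  by rewrite /own' idxr update_in// ey.
- move=> z /cases[[zP lz]|[y [yP ly ey _ ->]]] // fz.
  by rewrite /own' update_in// (keptE z lz).1 (own_fresh LP).
- by move=> i ti; rewrite /own' update_out ?out_future// (own_future LP).
- move=> i; rewrite /chg'; case: ifP => _; first exact: top1_top'.
  exact: le_trans (chg_top LP i) (le_trans (top_top1 i) (top1_top' i)).
- move=> z /cases[[zP lz]|[y [yP ly ey _ ->]]].
    by rewrite /top' update_in//; have [-> ->] := keptE z lz.
  rewrite /top' idxr update_in// ey /up ly.
  rewrite -[RHS]/(Num.max (wait_cost tau (refresh t y)) (paid (refresh t y))).
  by rewrite /wait_cost idx_refresh.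
- move=> i ti; have iP := out_future ti; have [h1 h2] := top_future LP ti.
  by rewrite /chg' /top' /top1 !update_out// h1 h2 if_same.
- move=> z /cases[[zP lz]|[y [yP ly ey _ ->]]] // fz.
  rewrite /chg' (own_fresh LP)// th0 /top1 update_in//.
  by have [_ ->] := keptE z lz.
- move=> z /cases[[zP lz]|[y [yP ly ey Ey ->]]] tm tz.
    (* A kept entry keeps its evidence: its requests have [own] equal to a level above [theta], so
       nothing recorded about them changes. *)
    have [A [pi [uA hA hA' hE]]] := has_evidence LP zP tz.
    exists A, pi; split=> // i iA; have [ho hM hr hp ht] := hA _ iA.
      have [-> -> ->] : [/\ own' i = own i, top' i = top i & chg' i = chg i].
        by apply: own_gt; rewrite ho.
      by split=> //; exact: M'_le (ltW lz).
    have [_ _ ->] : [/\ own' i = own i, top' i = top i & chg' i = chg i].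
      by apply: own_gt; rewrite ho.
    exact: hA'.
  case: tz => <- /=; case: certified => [all|cert].
    have : refresh t y \in Q.
      by apply/mem_eligible; exists y; split=> //; case/andP: ey.
    by move=> /all; rewrite fam_refresh (negbTE Ey).
  (* On [Q] this difference is the penalty at [tau], so the evidence is the prize-collecting
     instance itself. *)
  exists (map idx Q), (fun i => top' i - chg' i); split.
  + exact: uniq_eligible SP.
  + move=> i /mapP[x /mem_eligible[y' [y'P ly' cy' ->]] ->]; rewrite idx_refresh.
    have [ry' _ _] := sP y'P; have ey' : is_eligible theta y' by rewrite /is_eligible ly' cy'.
    split.
    * by rewrite /own' update_in// ey'.
    * apply: M'_le => //; apply: le_trans ly'; exact: (mark_level LP).
    * exact: le_trans ttau.
    * rewrite subr_ge0 /chg' own_le//; exact: top1_top'.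
    * by rewrite addrC subrK.
  + move=> i /mapP[x /mem_eligible[y' [y'P ly' cy' ->]] ->]; rewrite idx_refresh.
    have ey' : is_eligible theta y' by rewrite /is_eligible ly' cy'.
    rewrite [chg' _ + _]addrC subrK /chg' own_le// /top' /top1 !update_in// ey'.
    case: (leP (wait_cost tau y') (paid (up y'))) => h; last by right.
    by left; rewrite subrr.
  + move=> E'; apply: le_trans cert _; rewrite ler_wpM2l ?(le_trans ler01)//.
    apply: (@le_trans _ _ (pc_cost (pc_instance tau Q) E')).
      rewrite /pc_opt; exact: bigmin_le_cond.
    rewrite pc_cost_instance lerD2l big_map !sum_eligible.
    rewrite big_seq_cond [leRHS]big_seq_cond; apply: ler_sum => y' /and3P[y'P ey' _].
    have [ly' _] := andP ey'.
    rewrite idx_refresh /chg' own_le// /top' /top1 !update_in// ey' /up ly'.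
    by rewrite /penalty /wait_cost idx_refresh.
Qed.

Let g0 : 0 < g. Proof. exact: lt_le_trans g1. Qed.

Let gain_e (s : R * {set elt}) (e : elt) : R :=
  toll k g (cost e) (M' s.1) - toll k g (cost e) (M s.1).
Let gain_d i : R := Num.min (chg' i) (D i) - Num.min (chg i) (D i).

Let gain_e_ge0 s e : 0 <= gain_e s e.
Proof.
rewrite subr_ge0 toll_homo ?cost_ge0 ?(ltW g0)//.
by rewrite /M'; case: ifP => // _; rewrite le_max lexx.
Qed.

Let gain_d_ge0 i : 0 <= gain_d i.
Proof. by rewrite subr_ge0 le_min !ge_min lexx orbT chg_chg'. Qed.

Let gainE : potential M' chg' - potential M chg =
  \sum_(s <- Sopt) \sum_(e in s.2) gain_e s e + g * \sum_i gain_d i.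
Proof.
rewrite /potential opprD addrACA -mulrBr -!sumrB; congr (_ + g * _).
  by apply: eq_bigr => s _; rewrite -sumrB.
by apply: eq_bigr => i _; rewrite /gain_d; ring.
Qed.

Let gain_e_sum_ge0 : 0 <= \sum_(s <- Sopt) \sum_(e in s.2) gain_e s e.
Proof. by apply: sumr_ge0 => s _; apply: sumr_ge0 => e _. Qed.

Let gain_d_sum_ge0 : 0 <= \sum_i gain_d i.
Proof. by apply: sumr_ge0. Qed.

(** At times up to [t], [M] jumps from at most [L] to at least [2 L]; [kn] places [L] in the range
    where doubling gains. *)
Let gain_charge (s : R * {set elt}) e : s.1 <= t -> M s.1 <= L ->
  L <= 2 * n%:R * (g * cost e) -> Num.min (g * cost e) L / 2 <= gain_e s e.
Proof.
move=> st sL hL; have [c0|c0] := ltP 0 (cost e); last first.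
  apply: le_trans (gain_e_ge0 s e); have : g * cost e <= 0 by rewrite pmulr_rle0.
  by case: (leP (g * cost e) L); lra.
apply: (@le_trans _ _ (toll k g (cost e) (L + L) - toll k g (cost e) (M s.1))).
  apply: toll_gain => //; apply: le_trans hL _; rewrite ler_wpM2r//.
    by rewrite mulr_ge0// ltW.
  by have := kn; lra.
by rewrite lerD2r toll_homo ?(ltW g0) ?(ltW c0)// /M' st le_max lexx orbT.
Qed.

(* The elements transmitted by the optimum in the current window. *)
Let window : {set elt} :=
  [set e | has (fun s : R * {set elt} => [&& s.1 <= t, M s.1 <= L & e \in s.2]) Sopt].

(** Elements with [g * cost e] below [L / (2 * n)] pay nothing: all of them together amount to at
    most [L / 2]. *)
Let share (e : elt) : R := if L <= 2 * n%:R * (g * cost e) then Num.min (g * cost e) L / 2 else 0.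

Let share_ge0 e : 0 <= share e.
Proof.
rewrite /share; case: ifP => // _; rewrite divr_ge0// le_min L0 andbT.
by rewrite mulr_ge0 ?(ltW g0) ?cost_ge0.
Qed.

Let window_gain : \sum_(e in window) share e <= \sum_(s <- Sopt) \sum_(e in s.2) gain_e s e.
Proof.
have -> : \sum_(s <- Sopt) \sum_(e in s.2) gain_e s e =
   \sum_(e : elt) \sum_(s <- Sopt | e \in s.2) gain_e s e.
  by rewrite (exchange_big_dep xpredT).
rewrite [leLHS]big_mkcond; apply: ler_sum => e _; case: ifP; last first.
  by move=> _; apply: sumr_ge0.
rewrite inE => /hasP[s sS /and3P[st sL es]].
rewrite (big_rem s)//= es ler_wpDr//; first by apply: sumr_ge0.
by rewrite /share; case: ifP => // hL; exact: gain_charge.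
Qed.

(** Had [Sopt] served [i] by time [t], the serving transmission would come after the arrival, where
    [M] is at most [L] by monotonicity, and would lie in the window. *)
Let unserved_late i : M (release (rq i)) <= L -> window \notin fam (req (rq i)) -> t < sv i.
Proof.
move=> Mi; apply: contraNlt => svt; have [F [FS rF Ff]] := opt_serves i.
apply: family_up Ff; apply/fintype.subsetP => e eF; rewrite inE; apply/hasP.
exists (sv i, F) => //=; rewrite svt eF andbT /=; apply: le_trans Mi.
exact: (mark_mono LP).
Qed.

(** The evidence is applied to the window. Its elements pay shares; requests that it leaves
    unsatisfied still wait in [Sopt] after the timer, so their penalties are delay of [Sopt] that is
    charged now. *)
Let gain_touched x tau0 : x \in P -> level x = L -> timer x = Some tau0 -> tau0 <= t ->
  L / 4 <= potential M' chg' - potential M chg.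
Proof.
move=> xP lx tx t0t; have [A [pi [uA hA hA' hE]]] := has_evidence LP xP tx.
rewrite lx in hA hE; rewrite gainE.
have penalties : \sum_(i <- A | window \notin fam (req (rq i))) pi i <= \sum_i gain_d i.
  apply: le_trans (sum_uniq_le uA gain_d_ge0); rewrite big_mkcond !big_seq.
  apply: ler_sum => i iA; have [ho hM hr hp ht] := hA _ iA.
  case: ifP => // hw; have late := unserved_late hM hw.
  have [->//|ct'] := hA' _ iA.
  have cD : chg i + pi i <= D i.
    apply: le_trans ct' _; apply: (delay_homo (valid_rq i)) => //.
    exact: ltW (le_lt_trans t0t late).
  have cc : chg i + pi i <= chg' i.
    by rewrite /chg' ho lerDl L0; apply: le_trans ht (top_top1 i).
  rewrite /gain_d lerBrDr addrC (min_idPl _); last by rewrite (le_trans _ cD)// lerDl.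
  by rewrite le_min cc cD.
have := hE window; rewrite mulrDr => hw.
have hsum : g * \sum_(i <- A | window \notin fam (req (rq i))) pi i <= g * \sum_i gain_d i.
  by rewrite ler_pM2l.
have := window_gain; have := gain_d_sum_ge0.
(* One element with [g * cost e >= L] alone pays [L / 2]. Otherwise every share is half of
   [g * cost e], except for the small elements. *)
have [/existsP[e /and3P[eY hL geL]] _ _|] :=
  boolP [exists e, [&& e \in window, L <= 2 * n%:R * (g * cost e) & L <= g * cost e]].
  have : L / 2 <= \sum_(e in window) share e.
    rewrite (bigD1 e)//= /share hL (min_idPr geL) lerDl; apply: sumr_ge0 => e' _.
    exact: share_ge0.
  have := gain_d_sum_ge0; have : 0 <= g * \sum_i gain_d i by rewrite mulr_ge0 ?(ltW g0).
  have := window_gain; have := L0; lra.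
rewrite negb_exists => /forallP small gd wg.
have costs_le : g * set_cost window <= 2 * (\sum_(e in window) share e) + L / 2.
  case: (posnP n) => [n0|n0].
    have -> : set_cost window = 0.
      by rewrite /set_cost big_pred0// => e; have := ltn_ord e; rewrite {2}n0.
    rewrite mulr0 addr_ge0 ?divr_ge0 ?L0// mulr_ge0// sumr_ge0// => e _; exact: share_ge0.
  have n0' : 0 < n%:R :> R by rewrite ltr0n.
  apply: (@le_trans _ _ (\sum_(e in window) (2 * share e + L / (2 * n%:R)))).
    rewrite /set_cost mulr_sumr; apply: ler_sum => e eY.
    have := small e; rewrite eY /= negb_and -!ltNge /share.
    case: ifP => hL /=.
      rewrite ltNge hL /= => geL; rewrite (min_idPl (ltW geL)).
      have : 0 <= L / (2 * n%:R) by rewrite divr_ge0 ?L0// mulr_ge0.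
      by rewrite [2 * (_ / 2)]mulrC divfK ?pnatr_eq0//; lra.
    move=> _; rewrite mulr0 add0r ler_pdivlMr; last by rewrite mulr_gt0.
    by rewrite mulrC ltW// ltNge hL.
  rewrite big_split/= -mulr_sumr lerD2l sumr_const -[_ *+ _]mulr_natr.
  apply: (@le_trans _ _ (L / (2 * n%:R) * n%:R)).
    rewrite ler_wpM2l ?divr_ge0 ?L0 ?mulr_ge0// ler_nat.
    by rewrite -[leqRHS]card_ord max_card.
  by rewrite invfM mulrA divfK// gt_eqF.
have : 0 <= \sum_(e in window) share e by apply: sumr_ge0 => e _; exact: share_ge0.
have : 0 <= g * \sum_i gain_d i by rewrite mulr_ge0 ?(ltW g0).
lra.
Qed.

(** Since [L] is the least firing level, unpaid delay up to level [L / 2] is at most [L / 2], so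
    levels between [L / 2] and [L] hold another [L / 2]. Either [Sopt] has served one of those
    requests, using an element of cost above [L / 2], or it suffers all this delay. *)
Let gain_fresh x : 0 < L -> x \in P -> level x = L -> fresh x -> fires t P x ->
  {in P, forall y, fires t P y -> L <= level y} ->
  L / 4 <= potential M' chg' - potential M chg.
Proof.
move=> Lp xP lx fx firex hmin; rewrite gainE.
pose half (y : entry) := fresh y && (L / 2 < level y <= L).
have residual : L / 2 <= \sum_(y <- P | half y) (wait_cost t y - paid y).
  have low : partial_sum t P (L / 2) <= L / 2.
    apply: partial_sum_quiet; first by rewrite divr_ge0 ?L0.
    move=> y yP _ ly; apply/negP => /(hmin _ yP); have := Lp; lra.
  have : L <= partial_sum t P L.
    by move: firex fx; rewrite /fires /fresh lx; case: (timer x).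
  rewrite partial_sumE in low; rewrite partial_sumE (bigID (fun y => level y <= L / 2))/=.
  rewrite (eq_bigl (fun y => fresh y && (level y <= L / 2))); last first.
    move=> y; rewrite -andbA; congr (_ && _); rewrite andbC; case: leP => //= h.
    by apply: le_trans h _; have := Lp; lra.
  rewrite [X in _ + X](eq_bigl half); last first.
    by move=> y; rewrite /half -andbA -ltNge; congr (_ && _); rewrite andbC.
  by lra.
have [/hasP[y yP /andP[/andP[fy /andP[ly yL]] svt]]|late] :=
  boolP (has (fun y => half y && (sv (idx y) <= t)) P).
  have [F [FS rF Ff]] := opt_serves (idx y).
  have [_ by' hy] := sP yP; have := bottleneck_spec (req (rq (idx y))); rewrite by'.
  move=> [_ _ /(_ _ Ff)].
  have ny : need y = level y.
    by move: hy fy; rewrite /fresh; case: (timer y) => // -[-> _].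
  rewrite ny => -[l0|[e eF ce]]; first by have := Lp; lra.
  have sL : M (sv (idx y)) <= L.
    apply: le_trans yL; apply: le_trans (mark_level LP yP); exact: (mark_mono LP).
  have n1 : 1 <= n%:R :> R by rewrite ler1n (leq_trans _ (ltn_ord e)).
  have gc : L / 2 <= g * cost e.
    by apply: le_trans (ltW ly) (le_trans ce _); rewrite ler_peMl// cost_ge0.
  have hL : L <= 2 * n%:R * (g * cost e).
    have : g * cost e <= n%:R * (g * cost e).
      by rewrite ler_peMl// mulr_ge0 ?(ltW g0) ?cost_ge0.
    by rewrite -mulrA; lra.
  have h1 := @gain_charge (sv (idx y), F) e svt sL hL.
  have h2 : L / 4 <= Num.min (g * cost e) L / 2.
    by case: (leP (g * cost e) L) => _; have := Lp; lra.
  rewrite (big_rem _ FS)/= (bigD1 e)//=.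
  have h3 : 0 <= g * \sum_i gain_d i by rewrite mulr_ge0 ?(ltW g0).
  have h4 : 0 <= \sum_(s <- rem (sv (idx y), F) Sopt) \sum_(e' in s.2) gain_e s e'.
    by apply: sumr_ge0 => s _; apply: sumr_ge0 => e' _.
  have h5 : 0 <= \sum_(i in F | i != e) gain_e (sv (idx y), F) i by apply: sumr_ge0.
  lra.
have h : \sum_(y <- P | half y) (wait_cost t y - paid y) <= \sum_i gain_d i.
  have uB : uniq [seq idx y | y <- P & half y].
    by apply: subseq_uniq uP; apply: map_subseq; exact: filter_subseq.
  apply: le_trans (sum_uniq_le uB gain_d_ge0); rewrite big_map big_filter.
  rewrite big_seq_cond [leRHS]big_seq_cond; apply: ler_sum => y /andP[yP hy].
  have [fy /andP[_ yL]] := andP hy.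
  have svt : t < sv (idx y).
    by rewrite ltNge; apply: contra late => svt; apply/hasP; exists y; rewrite // hy.
  have ly : level y <= theta by apply: le_trans yL _; rewrite lerDl L0.
  have ry : arrival y <= t by have [] := sP yP.
  rewrite /gain_d (chg_fresh LP yP fy) /chg' own_le// /top1 update_in//.
  have -> : paid (up y) = wait_cost t y.
    by rewrite /up ly /refresh; move: fy; rewrite /fresh; case: (timer y).
  have wD : wait_cost t y <= D (idx y) by apply: (delay_homo (valid_rq _)) => //; exact: ltW.
  rewrite (min_idPl wD) (min_idPl _)//; apply: le_trans wD.
  exact: (sound_paid_le valid_rq (sP yP) fy).
have : \sum_i gain_d i <= g * \sum_i gain_d i by rewrite ler_peMl.
have := gain_e_sum_ge0; have := Lp; lra.
Qed.

(** The gain [L / 4] is an eighth of [theta]; a service of value 0 needs no gain. *)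
Lemma ledger_service Theta : Theta <= 8 * potential M chg ->
  exists M1 own1 top1 chg1,
    ledger t P' M1 own1 top1 chg1 /\ Theta + theta <= 8 * potential M1 chg1.
Proof.
move=> hT; exists M', own', top', chg'; split; first exact: ledger_finish.
suff : L / 4 <= potential M' chg' - potential M chg by rewrite /theta; lra.
have := L0; rewrite le_eqVlt => /predU1P[<-|Lp].
  by rewrite mul0r gainE addr_ge0// mulr_ge0// ltW.
have := candidate_spec t P; rewrite cand => -[[x [xP firex lx]] hmin].
have [|fx] := boolP (isSome (timer x)); last exact: gain_fresh lx fx firex hmin.
case tx: (timer x) => [tau0|//] _; apply: gain_touched xP lx (tx) _.
by move: firex; rewrite /fires tx.
Qed.

End Service.
End Ledger.

(** * Closure properties of polynomially bounded functions *)

Section PolynomialBounds.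

Definition polynomially_bounded (f : nat -> nat) : Prop :=
  exists p : {poly nat}, forall x, (f x <= p.[x])%N.

Lemma pb_const c : polynomially_bounded (fun=> c).
Proof. by exists c%:P => x; rewrite hornerC. Qed.

Lemma pb_id : polynomially_bounded id.
Proof. by exists 'X => x; rewrite hornerX. Qed.

Lemma pb_add f g : polynomially_bounded f -> polynomially_bounded g ->
  polynomially_bounded (fun x => f x + g x)%N.
Proof. by move=> [p hp] [q hq]; exists (p + q) => x; rewrite hornerD leq_add. Qed.

Lemma pb_succ f : polynomially_bounded f -> polynomially_bounded (fun x => (f x).+1).
Proof. by move=> hf; have [p hp] := pb_add hf (pb_const 1); exists p => x; rewrite -addn1. Qed.

Lemma pb_mul f g : polynomially_bounded f -> polynomially_bounded g ->
  polynomially_bounded (fun x => f x * g x)%N.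
Proof. by move=> [p hp] [q hq]; exists (p * q) => x; rewrite hornerM leq_mul. Qed.

Lemma horner_nat_homo (p : {poly nat}) x y : (x <= y)%N -> (p.[x] <= p.[y])%N.
Proof.
move=> xy; rewrite !horner_coef; apply: leq_sum => i _.
by rewrite leq_mul// !natrXE; case: i => [[|m] _] //=; rewrite leq_exp2r.
Qed.

Lemma pb_horner (p : {poly nat}) f : polynomially_bounded f ->
  polynomially_bounded (fun x => p.[f x]).
Proof.
move=> [q hq]; exists (p \Po q) => x; rewrite horner_comp.
exact: horner_nat_homo.
Qed.

Lemma pb_steps p f : polynomially_bounded f -> polynomially_bounded (fun x => steps p (f x)).
Proof.
move=> hf; elim: p => [pr|a IHa b IHb|a IHa b IHb|a IHa b IHb|a IHa] /=.
- exact: pb_const.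
- by do 2?apply: pb_add => //; exact: pb_const.
- by do 2?apply: pb_add => //; exact: pb_const.
- by do 2?apply: pb_add => //; exact: pb_const.
apply: pb_add (pb_const 1%N); apply: pb_mul; first exact: pb_succ.
by apply: pb_add => //; exact: pb_const.
Qed.

End PolynomialBounds.

(** * Costs of schedules, and the logarithm *)

Section Costs.
Variables (R : realType) (ND : nd_class R) (I : inst ND) (sigma : online_input I).
Local Notation fam := (@Defs.family R ND I).
Local Notation n := (nelt I).
Local Notation elt := 'I_n.
Local Notation N := (size sigma).
Local Notation rq := (@rq R ND I sigma).
Local Notation release := (@release R ND I).
Local Notation base := (@base R ND I sigma).
Hypothesis valid_rq : forall i, valid_request (rq i).

Lemma service_time_le (S : schedule I) q s : s \in S -> release q <= s.1 ->
  s.2 \in fam (req q) -> (service_time S q <= s.1%:E)%E.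
Proof.
rewrite /service_time => + rs fs; elim: S => // s' S IH; rewrite big_cons inE.
move=> /predU1P[<-|/IH h]; first by rewrite rs fs ge_min lexx.
by case: ifP => // _; rewrite ge_min h orbT.
Qed.

Lemma service_timeP (S : schedule I) q :
  service_time S q = +oo%E \/
  exists s, [/\ s \in S, release q <= s.1, s.2 \in fam (req q) &
                service_time S q = s.1%:E].
Proof.
rewrite /service_time; elim: S => [|s S IH]; first by left; rewrite big_nil.
rewrite big_cons; case: ifP => [/andP[rs fs]|_].
  rewrite minEle; case: ifP => _; first by right; exists s; rewrite inE eqxx.
  case: IH => [->|[s' [s'S ? ? ->]]]; [by left|right; exists s'].
  by rewrite inE s'S orbT.
case: IH => [->|[s' [s'S ? ? ->]]]; [by left|right; exists s'].
by rewrite inE s'S orbT.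
Qed.

Lemma base_ge0 i : 0 <= base i.
Proof. by have [_ ? _ _ _] := valid_rq i. Qed.

Lemma schedule_cost_ge0 (S : schedule I) : (0 <= schedule_cost sigma S)%E.
Proof.
rewrite /schedule_cost; apply: adde_ge0.
  by rewrite lee_fin; apply: sumr_ge0 => s _; exact: set_cost_ge0.
rewrite big_tnth; apply: sume_ge0 => i _; rewrite -/(rq i).
case: (service_timeP S (rq i)) => [->|[s [_ rs _ ->]]] /=; first exact: leey.
rewrite lee_fin; apply: le_trans (base_ge0 i) _.
exact: (delay_homo (valid_rq i)).
Qed.

Lemma schedule_cost_le (S : schedule I) (H : 'I_N -> R) :
  (forall i, exists s, [/\ s \in S, release (rq i) <= s.1, s.2 \in fam (req (rq i)) &
      delay (rq i) s.1 <= H i]) ->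
  (schedule_cost sigma S <= (\sum_(s <- S) set_cost s.2 + \sum_i H i)%:E)%E.
Proof.
move=> hS; rewrite /schedule_cost EFinD leeD2l// big_tnth -sumEFin.
apply: lee_sum => i _; rewrite -/(rq i); have [s [sS rs fs ds]] := hS i.
have := service_time_le sS rs fs.
case: (service_timeP S (rq i)) => [->//|[s' [_ rs' _ ->]]] /=.
rewrite !lee_fin => ss'; apply: le_trans ds; exact: (delay_homo (valid_rq i)).
Qed.

Lemma schedule_cost_served (S : schedule I) :
  schedule_cost sigma S = +oo%E \/
  exists sv : 'I_N -> R,
    (forall i, exists E, [/\ (sv i, E) \in S, release (rq i) <= sv i & E \in fam (req (rq i))]) /\
    schedule_cost sigma S = (\sum_(s <- S) set_cost s.2 + \sum_i delay (rq i) (sv i))%:E.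
Proof.
have [[i hi]|hS] := pselect (exists i, service_time S (rq i) = +oo%E).
  left; rewrite /schedule_cost [X in (_ + X)%E]big_tnth (bigD1 i)//= -/(rq i) hi /=.
  rewrite addye ?addey// -ltNye (lt_le_trans (ltNyr 0))//.
  apply: sume_ge0 => j _; rewrite -/(rq j).
  case: (service_timeP S (rq j)) => [->|[s [_ rs _ ->]]] /=; first exact: leey.
  rewrite lee_fin; apply: le_trans (base_ge0 j) _; exact: (delay_homo (valid_rq j)).
right; have hs i : exists s, [/\ s \in S, release (rq i) <= s.1, s.2 \in fam (req (rq i)) &
                service_time S (rq i) = s.1%:E].
  by case: (service_timeP S (rq i)) => // hi; case: hS; exists i.
have [f hf] := choice hs; exists (fun i => (f i).1); split=> [i|].
  by exists (f i).2; have [fS ? ? _] := hf i; split=> //; case: (f i) fS.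
rewrite /schedule_cost EFinD [X in (_ + X)%E = _]big_tnth; congr (_ + _)%E; rewrite -sumEFin.
by apply: eq_bigr => i _; rewrite -/(rq i); have [_ _ _ ->] := hf i.
Qed.

(** For n > 1 and k = [up_log 2 n], the power 2^(k-1) is below n and ln 2 is at least 1/2, so k - 1
    <= 2 ln n. The remaining 4 is absorbed by the maximum with 1. *)
Lemma log_nelt_ge : ((up_log 2 n).+3)%:R <= 6 * log_nelt I :> R.
Proof.
rewrite /log_nelt; set l := ln _.
have l1 : 1 <= Num.max 1 l by rewrite le_max lexx.
have ll : l <= Num.max 1 l by rewrite le_max lexx orbT.
case: (leqP n 1) => n1.
  rewrite (_ : up_log 2 n = 0%N); last by case: (n) n1 => [|[|]].
  lra.
have := up_log_bounds (isT : (1 < 2)%N) n1; set k := up_log 2 n => /andP[hk _].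
have k0 : (0 < k)%N by rewrite up_log_gt0.
have h : ln (2 : R) *+ k.-1 <= l.
  rewrite -lnXn// ler_ln ?posrE ?exprn_gt0// ?ltr0n ?(ltn_trans _ n1)//.
  by rewrite -natrX ler_nat ltnW.
have ln2 : 2^-1 <= ln 2 :> R.
  have := @le_ln1Dx R (- 2^-1); rewrite (_ : 1 + - 2^-1 = 2^-1); last lra.
  by rewrite lnV ?posrE// => h'; rewrite -lerN2; apply: h'; lra.
have : 2^-1 *+ k.-1 <= l by apply: le_trans h; rewrite lerMn2r ln2 orbT.
rewrite -[_ *+ k.-1]mulr_natr.
have -> : (k.+3)%:R = (k.-1)%:R + 4 :> R by rewrite -{1}(prednK k0) -natrD addn4.
lra.
Qed.

End Costs.

(** * The main loop *)

Section MainLoop.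
Variables (R : realType) (ND : nd_class R) (I : inst ND) (sigma : online_input I).
Local Notation val := (Defs.val R (request I)).
Local Notation fam := (@Defs.family R ND I).
Local Notation n := (nelt I).
Local Notation N := (size sigma).
Local Notation rq := (@rq R ND I sigma).
Local Notation entry := (entry sigma).
Local Notation release := (@release R ND I).
Local Notation base := (@base R ND I sigma).
Hypothesis sorted_sigma : sorted <=%R (map release sigma).
Hypothesis valid_rq : forall i, valid_request (rq i).
Variables (g alpha : R).
Hypothesis g1 : 1 <= g.
(** The two extra doublings make [2 ^+ k / 2] at least [2 * n], as [gain_charge] requires. Below, 48
    is 6 (cost per value) times 8 (value per potential). *)
Let k := (up_log 2 n).+2.
Hypothesis alphaE : 48 * g * k.+1%:R <= alpha.

(** Comparison with each schedule separately: the infimum [online_opt] need not be attained, while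
    the ledger needs an actual schedule. *)
Definition competitive_at (c : config R (request I) (world I)) : Prop :=
  forall Sopt, (schedule_cost sigma (log (env c)) <= alpha%:E * schedule_cost sigma Sopt)%E.

Local Notation runs := (runs fam (online_ext sigma) competitive_at).
Variables (K : nat).
Hypotheses (nK : (n < K)%N) (NK : (N <= K)%N).
Variables (pc : prog) (Tpc : nat).
Hypothesis run_pc : forall w tau (Q : seq entry), (size Q <= N)%N ->
  runs pc (pc_encode (pc_instance tau Q)) w Tpc%:R (fun v w' =>
    pc_cost (pc_instance tau Q) (vset n v) <= g * pc_opt (pc_instance tau Q) /\ w' = w).

(** The accounts of the algorithm are fixed before [Sopt], which the run does not depend on; a
    ledger exists for every [Sopt] of finite cost. *)
Definition bookkept t (P : seq entry) (S : schedule I) : Prop :=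
  exists Theta H, accounted t P S Theta H /\
    forall Sopt sv,
      (forall i, exists E, [/\ (sv i, E) \in Sopt, release (rq i) <= sv i &
                               E \in fam (req (rq i))]) ->
      exists M own top chg, ledger g t P M own top chg /\
        Theta <= 8 * potential g k Sopt sv M chg.

Definition loop_inv (j : nat) (v : val) (w : world I) : Prop :=
  exists P, [/\ v = senv (now w) P, structured (now w) P, measure (now w) P <= j%:R &
                bookkept (now w) P (log w)].

Definition iteration_steps : nat :=
  (steps candidateP K + steps waitP K + service_steps K Tpc + 12)%N.

Lemma four_n_le : 4 * n%:R <= 2 ^+ k :> R.
Proof.
have -> : 2 ^+ k = 4 * (2 ^ up_log 2 n)%:R :> R by rewrite natrX /k !exprS; ring.
by rewrite ler_pM2l// ler_nat up_logP.
Qed.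

Lemma alpha_gt0 : 0 < alpha.
Proof. by apply: lt_le_trans alphaE; rewrite !mulr_gt0// (lt_le_trans _ g1). Qed.

Lemma finished t S : (forall i, release (rq i) <= t) -> bookkept t [::] S ->
  competitive_at (Config (Ret VUnit) [::] (World t S)).
Proof.
move=> rt [Th [H [[_ served cost _] opt]]] Sopt /=.
have [->|[sv [hsv ->]]] := schedule_cost_served valid_rq Sopt.
  by rewrite gt0_muley ?lte_fin ?alpha_gt0// leey.
have [M [own [top [chg [_ hT]]]]] := opt _ _ hsv.
have g0 : 0 <= g by apply: le_trans g1.
apply: (@le_trans _ _ (\sum_(s <- S) set_cost s.2 + \sum_i H i)%:E).
  apply: schedule_cost_le => // i; apply: served => //.
  have [F [_ _ Fi]] := hsv i; have := bottleneck_spec (req (rq i)).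
  by case: (bottleneck _) => // /(_ F); rewrite Fi.
set D := \sum_i delay (rq i) (sv i); set C := \sum_(s <- Sopt) set_cost s.2.
have C0 : 0 <= C by apply: sumr_ge0 => s _; exact: set_cost_ge0.
have baseD : \sum_i base i <= D.
  apply: ler_sum => i _; have [F [_ rs _]] := hsv i.
  exact: (delay_homo (valid_rq i)).
have base0 : 0 <= \sum_i base i by apply: sumr_ge0 => i _; exact: base_ge0.
have pot : potential g k Sopt sv M chg <= g * k.+1%:R * C + g * (D - \sum_i base i).
  rewrite /potential lerD//.
    rewrite /C mulr_sumr; apply: ler_sum => s _; rewrite /set_cost mulr_sumr.
    by apply: ler_sum => e _; apply: toll_le => //; exact: cost_ge0.
  rewrite ler_wpM2l// -sumrB; apply: ler_sum => i _.
  by rewrite lerD2r ge_min lexx orbT.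
rewrite sumrB in cost; rewrite -EFinM lee_fin.
have h1 : 48 * (g * k.+1%:R * C) <= alpha * C by rewrite !mulrA ler_wpM2r.
have k1 : 1 <= k.+1%:R :> R by rewrite ler1n.
have h2 : 48 * g <= alpha by apply: le_trans alphaE; rewrite ler_peMr// mulr_ge0.
have h3 : 48 * (g * (D - \sum_i base i)) <= alpha * (D - \sum_i base i).
  by rewrite mulrA ler_wpM2r// subr_ge0.
have h4 : \sum_i base i <= alpha * \sum_i base i.
  by apply: ler_peMl => //; apply: le_trans h2; apply: le_trans g1 _; rewrite ler_peMl// ler1n.
have h5 : alpha * D = alpha * (D - \sum_i base i) + alpha * \sum_i base i by ring.
rewrite mulrDr h5; lra.
Qed.

(** The loop never exits by itself: the run ends only inside a wait, where [finished] supplies the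
    final property. Hence the [False] in the second case. *)
Lemma runs_iteration j v w : loop_inv j v w ->
  runs (Match candidateP waitP (serviceP pc)) v w iteration_steps%:R (fun v' w' =>
    (exists u, v' = VInl u /\ exists2 j', (j' < j)%N & loop_inv j' u w') \/
    (exists u, v' = VInr u /\ False)).
Proof.
move=> [P [-> SP hj [Th [H [acc opt]]]]].
have sizeP := size_structured SP; have [uP sP hP] := SP.
have kP : all_known w P by move=> x /sP[].
have hc := evp_candidate competitive_at sorted_sigma (now w) kP (leq_trans sizeP NK).
have h0 : runs (Prim Id) (senv (now w) P) w 1
  (fun v w' => v = senv (now w) P /\ w' = w) by apply: runs_prim.
have h1 : runs (Fork (Prim Id) candidateP) (senv (now w) P) w (1 + (steps candidateP K)%:R + 3)
  (fun v w' => v = VPair (senv (now w) P) (vopt I (candidate (now w) P)) /\ w' = w).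
  apply: (runs_fork h0) => // v1 w1 [-> ->].
  by apply: (runs_weaken (lexx _) _ hc) => v2 w2 [-> ->].
have next_j P' (w' : world I) : structured (now w') P' ->
    measure (now w') P' + 1 <= measure (now w) P -> bookkept (now w') P' (log w') ->
    exists u : val, VInl (senv (now w') P') = VInl u /\ exists2 j', (j' < j)%N & loop_inv j' u w'.
  move=> SP' hm hb; exists (senv (now w') P'); split=> //.
  have m0 := measure_ge0 valid_rq SP'.
  have j0 : (0 < j)%N by rewrite -(ltr0n R); apply: lt_le_trans hj; lra.
  exists j.-1; first by rewrite prednK.
  exists P'; split=> //.
  by move: hj; rewrite -{1}(prednK j0) -natr1; lra.
have split_steps : iteration_steps%:R = 1 + (steps candidateP K)%:R + 3 +
   (1 + (1 + ((steps waitP K)%:R + (service_steps K Tpc)%:R)) + 2) + 2 + 2 :> R.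
  by rewrite /iteration_steps !natrD; ring.
rewrite split_steps; set B := (steps waitP K)%:R + _.
have B0 : 0 <= B by rewrite addr_ge0.
suff h2 : runs (Seq (Prim Dist) (Case waitP (serviceP pc)))
    (VPair (senv (now w) P) (vopt I (candidate (now w) P))) w (1 + (1 + B) + 2) (fun v' w' =>
    (exists u, v' = VInl u /\ exists2 j', (j' < j)%N & loop_inv j' u w') \/
    (exists u, v' = VInr u /\ False)).
  apply: (@runs_weaken _ _ _ _ _ _ _ _ _ _ (1 + (steps candidateP K)%:R + 3 +
     (1 + (1 + B) + 2) + 2) _ _ _ _ (fun v w h => h)); first lra.
  by apply: (runs_seq h1) => [|v1 w1 [-> ->]//]; lra.
case cand: (candidate (now w) P) => [L|]; last first.
  have h3 : runs (Prim Dist) (VPair (senv (now w) P) (VInl VUnit)) w 1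
    (fun v w' => v = VInl (VPair (senv (now w) P) VUnit) /\ w' = w) by apply: runs_prim.
  apply: (runs_seq h3) => [|_ _ [-> ->]]; first lra.
  apply: runs_case_inl.
  have hw := @runs_wait _ _ _ _ competitive_at sorted_sigma K nK NK (now w) P w erefl kP sizeP.
  apply: (runs_weaken _ _ (hw _)) => [|v' w' [t' [hn -> ->]]|hn].
  - by rewrite /B lerDl.
  - left; apply: (next_j _ (World t' (log w))) => /=.
    + exact: structured_admit.
    + exact: measure_admit.
    exists Th, H; split; first exact: accounted_admit.
    move=> Sopt sv hsv; have [M [own [top [chg [hl hT]]]]] := opt _ _ hsv.
    by exists M, own, top, chg; split=> //; exact: ledger_admit.
  have := wait_untilP sorted_sigma (now w) P; rewrite hn => -[P0 hrel].
  case: w hj acc opt sP kP hc h0 h1 next_j hw hn hrel {cand h3 SP hP} => t S /= *.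
  by apply: finished => //; exists Th, H; rewrite -P0.
have h3 : runs (Prim Dist) (VPair (senv (now w) P) (VInr (VNum L))) w 1
    (fun v w' => v = VInr (lenv (now w) P L) /\ w' = w) by apply: runs_prim.
apply: (runs_seq h3) => [|_ _ [-> ->]]; first lra.
apply: runs_case_inr.
have L0 := candidate_ge0 SP cand.
have hs := runs_service sorted_sigma valid_rq nK NK run_pc erefl L0 kP sizeP.
apply: (runs_weaken _ _ (hs _)) => [|v' w' [tau [E [-> -> [ttau cE uE] cert]]]|x xQ].
- by rewrite /B lerDr.
- left; set w1 := World _ _; apply: (next_j _ w1) => /=.
  + exact: structured_finish.
  + exact: measure_service.
  exists (Th + (L + L)), (update (fun y => paid (serviced (now w) tau L E y)) P H).
  split; first exact: accounted_service.
  move=> Sopt sv hsv; have [M [own [top [chg [hl hT]]]]] := opt _ _ hsv.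
  exact: (ledger_service valid_rq g1 four_n_le hsv SP cand ttau cert hl).
exact: (eligible_paid valid_rq SP cand).
Qed.

Definition online_steps (J : nat) : nat :=
  (steps startP K + (J.+1 * (iteration_steps + 1) + 1) + 2)%N.

(** The premise on [J] bounds the initial measure, with all requests still to come. *)
Lemma ub_online J m : ((5 + 4 * n + 4 * N) * N + 1 <= J)%N ->
  ub fam (online_ext sigma) competitive_at m (online_init I (onlineP pc)) (online_steps J)%:R.
Proof.
move=> hJ.
have h1 := evp_start sigma competitive_at (world0 I) nK.
have h : runs (onlineP pc) (vinst I) (world0 I) (online_steps J)%:R (fun _ _ => False).
  have -> : (online_steps J)%:R = (steps startP K)%:R +
      (J.+1%:R * (iteration_steps%:R + 1) + 1) + 2 :> R.
    rewrite /online_steps; move: iteration_steps (steps startP K) => a b.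
    by rewrite !natrD natrM natrD -(natr1 J); ring.
  apply: (runs_seq h1) => [|_ _ [-> ->]].
    by apply: addr_ge0 => //; apply: mulr_ge0 => //; apply: addr_ge0.
  apply: (runs_loop (I := loop_inv)) => //; first exact: runs_iteration.
  exists [::]; split=> //.
  - split=> // c c0; rewrite partial_sumE big_nil; exact: addr_ge0.
  - rewrite /measure big_nil addr0 /=; apply: (@le_trans _ _ ((5 + 4 * n + 4 * N) * N + 1)%:R).
      rewrite natrD lerD// natrM ler_pM//.
      + by rewrite /arrival_weight !addr_ge0 ?mulr_ge0.
      + by rewrite /arrival_weight (natrD _ (5 + 4 * n)) (natrD _ 5) (natrM _ 4 n) (natrM _ 4 N).
      by rewrite ler_nat -[leqRHS]card_ord max_card.
    by rewrite ler_nat.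
  - exists 0, base; split; first exact: accounted_start.
    move=> Sopt sv hsv; exists (fun=> 0), (fun=> 0), base, base; split; first exact: ledger_start.
    rewrite mulr_ge0// /potential big1 ?add0r; last first.
      by move=> s _; rewrite big1// => e _; exact: toll0.
    apply: mulr_ge0; first exact: le_trans g1.
    apply: sumr_ge0 => i _; rewrite subr_ge0 le_min lexx/=.
    have [F [_ rs _]] := hsv i; exact: (delay_homo (valid_rq i)).
have [_ h2] := h; rewrite -[(online_steps J)%:R]addr0; exact: h2.
Qed.

End MainLoop.

(** * Polynomial running time *)

Section Sizes.
Variables (R : realType) (ND : nd_class R) (I : inst ND) (sigma : online_input I).
Local Notation val := (Defs.val R (request I)).
Local Notation n := (nelt I).
Local Notation N := (size sigma).
Local Notation rq := (@rq R ND I sigma).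
Local Notation entry := (entry sigma).

Lemma size_le_vsize (s : seq val) : (size s <= vsize (vlist s))%N.
Proof. by elim: s => //= v s IH; rewrite ltnS (leq_trans IH)// ltnW// ltnS leq_addl. Qed.

Lemma vsize_vlist_le (s : seq val) b : all (fun v => vsize v <= b)%N s ->
  (vsize (vlist s) <= size s * (b + 2) + 2)%N.
Proof. by elim: s => //= v s IH /andP[vb /IH]; lia. Qed.

Lemma vsize_le_vlist (s : seq val) : all (fun v => vsize v <= vsize (vlist s))%N s.
Proof.
elim: s => //= v s IH; apply/andP; split; first by lia.
by apply: sub_all IH => u; lia.
Qed.

Lemma nelt_le_size : (n <= online_size sigma)%N.
Proof.
have := size_le_vsize [seq VNum (cost e) | e <- enum 'I_n].
rewrite size_map size_enum_ord /online_size /vinst /=; lia.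
Qed.

Lemma input_le_size : (N <= online_size sigma)%N.
Proof.
have := size_le_vsize [seq vreq (req q) | q <- sigma].
rewrite size_map /online_size /=; lia.
Qed.

Lemma vreq_le_size i : (vsize (vreq (req (rq i))) <= online_size sigma)%N.
Proof.
have := vsize_le_vlist [seq vreq (req q) | q <- sigma].
rewrite all_map => /(@all_tnthP _ _ _ (in_tuple sigma)) h; have {h} := h i; rewrite /= => h.
by rewrite /online_size /= (leq_trans h)// ltnW// ltnS leq_addl.
Qed.

Definition pc_size (s : nat) : nat := (s + (s * (s + 4) + 2) + 1)%N.

Lemma pc_encode_size tau (Q : seq entry) : (size Q <= N)%N ->
  (vsize (pc_encode (pc_instance tau Q)) <= pc_size (online_size sigma))%N.
Proof.
move=> sQ; set s := online_size sigma.
have -> : pc_instance tau Q = rev [seq (req (rq (idx x)), penalty tau x) | x <- Q].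
  by rewrite -[RHS]cats0 -(foldl_cons_map (fun x => (req (rq (idx x)), penalty tau x))).
rewrite /pc_encode map_rev -map_comp /=; set l := rev _.
have : all (fun v => vsize v <= s + 2)%N l.
  by rewrite all_rev all_map; apply/allP => x _ /=; have := vreq_le_size (idx x); rewrite /s/=; lia.
move/vsize_vlist_le; rewrite size_rev size_map => hl.
have hv : (vsize (vinst I) <= s)%N by rewrite /s /online_size /=; lia.
have hQ : (size Q * (s + 2 + 2) <= s * (s + 4))%N.
  by rewrite leq_mul ?(leq_trans sQ) ?input_le_size//; lia.
rewrite -[X in (X <= _)%N]/(vsize (vinst I) + vsize (vlist l)).+1 /pc_size.
move: (vsize (vinst I)) (vsize (vlist l)) (size Q * _)%N (s * (s + 4))%N hv hl hQ => a b c d.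
lia.
Qed.

End Sizes.

(** The assumption on [pc] and the conclusion are both bounds by [ub], which makes this the common
    core of the two claims. List lengths are bounded by [K], the input size plus one. *)
Lemma online_core (R : realType) (ND : nd_class R) (gamma : inst ND -> R)
    (pc : prog) (p : {poly nat}) :
  (forall I, 1 <= gamma I) -> offline pc ->
  (forall (I : inst ND) (Q : pc_input I), pc_valid Q -> forall m,
     ub (@Defs.family R ND I) (@pc_ext R ND I)
       (fun c => pc_cost Q (pc_output c) <= gamma I * pc_opt Q) m (pc_init pc Q)
       (p.[vsize (pc_encode Q)])%:R) ->
  exists p' : {poly nat}, forall (I : inst ND) (sigma : online_input I), valid_input sigma ->
    forall m, ub (@Defs.family R ND I) (online_ext sigma)
      (competitive_at sigma (288 * gamma I * log_nelt I)) m (online_init I (onlineP pc))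
      (p'.[online_size sigma])%:R.
Proof.
move=> g1 off hpc.
pose T s := p.[pc_size s].
pose total s := online_steps s.+1 (T s) ((5 + 4 * s + 4 * s) * s + 1).
have [p' hp'] : polynomially_bounded total.
  have poly_T : polynomially_bounded T.
    apply: pb_horner; rewrite /pc_size.
    by repeat first [exact: pb_const | exact: pb_id | apply: pb_add | apply: pb_mul].
  rewrite /total /online_steps /iteration_steps /service_steps /forward_time.
  by repeat first [exact: pb_const | exact: pb_id | exact: poly_T | apply: pb_steps |
    apply: pb_add | apply: pb_mul | apply: pb_succ].
exists p' => I sigma [sorted_sigma valid] m.
have valid_rq i : valid_request (rq (sigma := sigma) i) by exact: valid.
set s := online_size sigma.
apply: (@ub_le _ _ _ _ _ _ _ _ _ (total s)%:R); first by rewrite ler_nat hp'.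
apply: (@ub_online _ _ _ _ sorted_sigma valid_rq (gamma I)) => //.
- rewrite -!mulrA -[288]/(48 * 6)%:R natrM -!mulrA ler_pM2l// mulrCA ler_pM2l; last first.
    exact: lt_le_trans (g1 I).
  exact: log_nelt_ge.
- by rewrite ltnS nelt_le_size.
- by rewrite ltnW// ltnS input_le_size.
- move=> w tau Q sQ.
  have h := hpc I (pc_instance tau Q) (@pc_valid_instance _ _ _ _ tau Q).
  have hr := runs_offline (online_ext sigma) (competitive_at sigma (288 * gamma I * log_nelt I))
    (Post := fun v => pc_cost (pc_instance tau Q) (vset (nelt I) v) <=
      gamma I * pc_opt (pc_instance tau Q)) w off _ h.
  apply: (runs_weaken _ _ (hr _)) => //.
  by rewrite ler_nat horner_nat_homo// pc_encode_size.
have := nelt_le_size sigma; have := input_le_size sigma; rewrite -/s => h1 h2.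
by rewrite leq_add2r leq_mul// leq_add ?leq_mul// leq_add2l leq_mul.
Qed.

Lemma deterministic_onlineP pc : deterministic (onlineP pc) = deterministic pc.
Proof. by rewrite /deterministic /= !andbT. Qed.

Section Optimum.
Variables (R : realType) (ND : nd_class R) (I : inst ND) (sigma : online_input I).
Hypothesis valid : valid_input sigma.

Lemma online_opt_ge0 : (0 <= online_opt sigma)%E.
Proof.
apply: le_ereal_inf_tmp => _ [S _ <-]; apply: schedule_cost_ge0 => i.
by have [_] := valid; apply.
Qed.

Lemma competitive_opt (alpha : R) c : 0 < alpha -> competitive_at sigma alpha c ->
  (online_cost sigma c <= alpha%:E * online_opt sigma)%E.
Proof.
move=> a0 hc; rewrite -lee_pdivrMl//; apply: le_ereal_inf_tmp => _ [S _ <-].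
by rewrite lee_pdivrMl//; exact: hc.
Qed.

End Optimum.

Theorem theorem4p1 (R : realType) :
  exists C : R, 0 < C /\
  forall (ND : nd_class R) (gamma : inst ND -> R),
    (forall I : inst ND, 1 <= gamma I) ->
    (pc_approx_det gamma ->
       competitive_det (fun I => C * gamma I * log_nelt I)) /\
    (pc_approx_rand gamma ->
       competitive_rand (fun I => C * gamma I * log_nelt I)).
Proof.
exists 288; split=> // ND gamma g1.
have alpha0 I : 0 < 288 * gamma I * log_nelt I.
  rewrite !mulr_gt0//; first exact: lt_le_trans (g1 I).
  by rewrite /log_nelt lt_max ltr01.
split.
- move=> [pc [p [off det h]]].
  have [|p' hp'] := online_core (p := p) g1 off.
    move=> I Q vQ m; have [hh hQ] := h I Q vQ.
    by apply: ub_deterministic => //; rewrite /config_uses /= andbT.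
  exists (onlineP pc), p'; split; first by rewrite deterministic_onlineP.
  move=> I sigma vs /=; have hub := hp' I sigma vs.
  have hh : halted (online_run sigma no_coins p'.[online_size sigma] (onlineP pc)).
    apply: halted_deterministic hub; rewrite /config_uses andbT.
    exact: (etrans (deterministic_onlineP pc) det).
  split=> //; apply: competitive_opt => //.
  by have := ub_halted (hub p'.[online_size sigma]) hh.
move=> [pc [p [off h]]].
have [|p' hp'] := online_core (p := p) g1 off.
  move=> I Q vQ m; have [hT hQ] := h I Q vQ.
  exact: ub_expected_time.
exists (onlineP pc), p' => I sigma vs; have hub := hp' I sigma vs; split.
  exact: expected_time_le hub.
apply: expected_value_le.
  by apply: mule_ge0; [rewrite lee_fin ltW|exact: online_opt_ge0].
move=> coins m hh; apply: competitive_opt => //.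
exact: ub_halted (hub m) _ hh.
Qed.
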